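(* Consider a fixed collection of $p$ predictors partitioned into $k$ blocks, with an $n\times p$ design $X$ whose columns are centered and such that columns in different blocks are orthogonal (block orthogonality), and with $\lim_{n\to\infty}\frac1nX^TX=D$ for some positive definite $p\times p$ matrix $D$. Each model $\mathcal M_\gamma$ (a subset of predictors) is equipped with the block hyper-$g$ prior (hyperparameter $2<a\le4$) whose blocks are the nonempty intersections of $\mathcal M_\gamma$ with the $k$ blocks. Suppose the data are generated by a true model $\mathcal M_T:y=\alpha_T\mathbf 1+\sum_{i\in B_T}X_{i,T}\beta_{i,T}+\epsilon$, $\epsilon\sim N(0,\sigma^2I_n)$, where $B_T$ is the set of blocks containing at least one nonzero coefficient, and assume that for every model $\mathcal M_\gamma\not\supseteq\mathcal M_T$, $\lim_{n\to\infty}\frac1n\beta_T^TX_T^T(I-P_{X_\gamma})X_T\beta_T>0$. Then, as $n\to\infty$: (i) for any model $\mathcal M_\gamma\supset\mathcal M_T$ such that all predictors in $\mathcal M_\gamma$ that are not in $\mathcal M_T$ lie in blocks not in $B_T$, $BF(\mathcal M_\gamma:\mathcal M_T)$ converges in distribution to some non-degenerate random variable $W_\gamma$; (ii) for every other model $\mathcal M_\gamma\ne\mathcal M_T$, $BF(\mathcal M_\gamma:\mathcal M_T)\to0$ in probability.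
   Context: Block hyper-$g$ prior on blocks $X_1,\dots,X_m$: $\pi(\alpha,\sigma^2)\propto1/\sigma^2$; $\beta\mid g,\sigma^2\sim N(0,A\sigma^2)$ with $A$ block diagonal with blocks $g_i(X_i^TX_i)^{-1}$; $g_i$ independent with densities $\frac{a-2}{2}(1+g_i)^{-a/2}$, $g_i>0$. The response is centered. $X_T$, $\beta_T$ are the design and coefficient vector of the true model, $X_\gamma$ the design of $\mathcal M_\gamma$, and $P_{X_\gamma}$ the projection onto its column space. $BF(\mathcal M_\gamma:\mathcal M_T)=p(y\mid\mathcal M_\gamma)/p(y\mid\mathcal M_T)$. The number of predictors $p$ is fixed while $n\to\infty$. *)

(* Defs.v *)
From HB Require Import structures.
From mathcomp Require Import all_boot all_order all_algebra.
From mathcomp Require Import all_classical all_reals all_analysis.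
Set Implicit Arguments. Unset Strict Implicit. Unset Printing Implicit Defensive.
Import Order.TTheory GRing.Theory Num.Theory.
Import numFieldNormedType.Exports.
Local Open Scope ring_scope.

Section Defs.
Variable R : realType.

(* Iterated Lebesgue integral over R^k (column vectors); for nonnegative
   measurable integrands this is the integral w.r.t. Lebesgue measure on R^k
   (Tonelli). *)
Fixpoint iint (k : nat) : ('cV[R]_k -> \bar R) -> \bar R :=
  if k is k'.+1 then
    fun f => (\int[@lebesgue_measure R]_(x in setT)
                iint (fun v : 'cV[R]_k' => f (col_mx (x%:M : 'M[R]_1) v)))%E
  else fun f => f 0.

Definition mvn_pdf (q : nat) (mu : 'cV[R]_q) (S : 'M[R]_q) (x : 'cV[R]_q) : R :=
  (2 * pi) `^ (- (q%:R) / 2) * (\det S) `^ (- 1 / 2)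
  * expR (- (((x - mu)^T *m invmx S *m (x - mu)) 0 0) / 2).

Definition hyperg (a g : R) : R := (a - 2) / 2 * (1 + g) `^ (- a / 2).

Definition Xsub (n p : nat) (X : 'M[R]_(n, p)) (G : {set 'I_p}) : 'M[R]_(n, #|G|) :=
  \matrix_(i, j) X i (enum_val j).

(* prior covariance A = block diagonal with blocks g_b (X_b^T X_b)^{-1}:
   defined as the inverse of the block diagonal precision with blocks
   X_b^T X_b / g_b, b ranging over the blocks met by G *)
Definition Acov (n p k : nat) (blk : 'I_p -> 'I_k) (X : 'M[R]_(n, p))
  (G : {set 'I_p}) (g : 'cV[R]_k) : 'M[R]_#|G| :=
  let Xs := Xsub X G in
  invmx (\matrix_(j, l) if blk (enum_val j) == blk (enum_val l)
                         then ((Xs^T *m Xs) j l) / g (blk (enum_val j)) 0 else 0).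

(* marginal likelihood p(y | M_G) under pi(alpha, sigma^2) ∝ 1/sigma^2,
   beta | g, sigma^2 ~ N(0, sigma^2 A), g_b iid hyper-g(a).
   The g's of blocks not met by G integrate out to 1. *)
Definition marg (n p k : nat) (blk : 'I_p -> 'I_k) (a : R) (X : 'M[R]_(n, p))
  (G : {set 'I_p}) (y : 'cV[R]_n) : \bar R :=
  (\int[@lebesgue_measure R]_(s in setT) \int[@lebesgue_measure R]_(al in setT)
    iint (fun g : 'cV[R]_k => iint (fun b : 'cV[R]_#|G| =>
      (if (0 < s) && [forall i, 0 < g i 0] then
         s^-1 * (\prod_i hyperg a (g i 0))
         * mvn_pdf (al *: const_mx 1 + Xsub X G *m b) (s *: 1%:M) y
         * mvn_pdf 0 (s *: Acov blk X G g) b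
       else 0)%:E)))%E.

Definition BF (n p k : nat) (blk : 'I_p -> 'I_k) (a : R) (X : 'M[R]_(n, p))
  (G T : {set 'I_p}) (y : 'cV[R]_n) : R :=
  fine (marg blk a X G y) / fine (marg blk a X T y).

Definition gprob (n : nat) (mu : 'cV[R]_n) (s2 : R) (E : 'cV[R]_n -> bool) : R :=
  fine (iint (fun y => (mvn_pdf mu (s2 *: 1%:M) y * (if E y then 1 else 0))%:E)).

Definition projmx (n q : nat) (Z : 'M[R]_(n, q)) : 'M[R]_n :=
  Z *m invmx (Z^T *m Z) *m Z^T.

End Defs.

(* Submission.v *)
Require Import Defs.
From HB Require Import structures.
From mathcomp Require Import all_boot all_order all_algebra.
From mathcomp Require Import all_classical all_reals all_analysis.
From mathcomp Require Import measurable_realfun ring lra zify.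
Import Order.TTheory GRing.Theory Num.Theory.
Import numFieldNormedType.Exports.
Local Open Scope ring_scope.
Local Open Scope classical_set_scope.
Set Implicit Arguments. Unset Strict Implicit. Unset Printing Implicit Defensive.

(* The marginal likelihood of a model is a one-dimensional integral over the
   variance of an inverse-gamma kernel times, for each block b, a function
   Psi_q(Q_b / 2s) of the regression sum of squares Q_b of the block, where
   Psi_q(x) = E[(1+g)^(-q/2) exp(x g/(1+g))] and q is the number of predictors
   of the model in b.  Off an event of vanishing probability the noise e
   satisfies |e|^2 ~ n sigma^2 with bounded projections on the column space of X,
   and there a Laplace argument compares the two integrals.  If the model misses
   a true predictor, its residual sum of squares exceeds that of the true model
   by a multiple of n and the Bayes factor is exponentially small; an extra
   predictor in a true block, where Q_b grows like n, costs a factor n^(-1/2); in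
   the remaining case the factors of the true blocks cancel and the Bayes factor
   approaches the product over the other blocks of Psi_q(x_b), where the
   2 x_b = e^T P_b e / sigma^2 are independent chi-square variables.

   The integrals defining gprob are lower integrals (Bayes factors are not shown
   to be measurable), so events are compared with test functions: combinations
   of Gaussian kernels exp(- e^T N e / 2 sigma^2), of mean det(1 + N)^(-1/2).
   Chernoff bounds are such tests, and, by a Bernstein approximation in the
   variables exp(-x_b), so are approximations of the distribution function of the
   limit. *)

(** The sample space changes with [n], so every statement about Bayes factors is a deterministic
    inequality on the set [good_noise], with thresholds in [n] that depend only on bounds for the
    sums of squares. No central limit theorem is involved: the [x_b] have the same joint law for all
    large [n], and the mean of a polynomial in the [exp(- x_b)], computed under the density of [y]
    or on the space carrying the limit variable, is the same number [pval], a function of the block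
    sizes. It ties [gprob] to the limit law.

    In the Laplace argument, [Psi_q(x) <= exp x] and a lower bound of order [exp x] over a power of
    [x] reduce a marginal likelihood, up to polynomial factors, to the inverse-gamma kernel of the
    residual sum of squares. This decides exponential rates; the finer comparison is pointwise in
    [s], near [s = sigma^2]. The remainder is bounded by a multiple of the density [(1 + s)^(-2)],
    which is measurable with mass 1 and so splits off from a lower integral. *)

(** * Lower integrals of arbitrary nonnegative functions *)

Section lower_integral.
Local Open Scope ereal_scope.
Context d (T : measurableType d) (R : realType).
Variable mu : {measure set T -> \bar R}.
Implicit Types f g : T -> \bar R.

Import HBNNSimple.

Lemma lower_integral_le f g : (forall x, 0 <= f x) -> (forall x, f x <= g x) ->
  \int[mu]_x f x <= \int[mu]_x g x.
Proof.
move=> f0 fg; have g0 x : 0 <= g x by exact: le_trans (f0 x) (fg x).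
rewrite !ge0_integralTE//; apply: ereal_sup_le => _ [h hf <-].
exists h => // x.
exact: le_trans (hf x) (fg x).
Qed.

Lemma sintegralTE (h : {nnsfun T >-> R}) : sintegral mu h = \int[mu]_x (h x)%:E.
Proof. by rewrite integral_nnsfun// patch_setT. Qed.

(** [f] is arbitrary: scaling a simple function below [f] gives a measurable function below [c * f],
    and the supremum does the rest. The reverse inequality follows by scaling with [c^-1]. *)
Lemma lower_integralZl_le f (c : R) : (0 < c)%R -> (forall x, 0 <= f x) ->
  c%:E * \int[mu]_x f x <= \int[mu]_x (c%:E * f x).
Proof.
move=> c0 f0.
have cf0 x : 0 <= c%:E * f x by rewrite mule_ge0// lee_fin ltW.
rewrite -lee_pdivlMl// ge0_integralTE//; apply: ge_ereal_sup => _ [h hf <-].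
rewrite lee_pdivlMl// sintegralTE -ge0_integralZl_EFin//=; last 3 first.
  by move=> x _; rewrite lee_fin.
  by apply/measurable_EFinP; exact: measurable_funPT.
  exact: ltW.
apply: lower_integral_le => x.
  by rewrite mule_ge0// lee_fin// ltW.
by rewrite lee_pmul2l.
Qed.

Lemma lower_integralZl f (c : R) : (0 <= c)%R -> (forall x, 0 <= f x) ->
  \int[mu]_x (c%:E * f x) = c%:E * \int[mu]_x f x.
Proof.
rewrite le_eqVlt => /predU1P[<- f0|c0 f0].
  by rewrite mul0e integral0_eq// => x _; rewrite mul0e.
apply/eqP; rewrite eq_le lower_integralZl_le// andbT.
rewrite -lee_pdivrMl//.
have -> : \int[mu]_x f x = \int[mu]_x (c^-1%:E * (c%:E * f x)).
  by apply: eq_integral => x _; rewrite muleA -EFinM mulVf ?gt_eqF// mul1e.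
apply: lower_integralZl_le; first by rewrite invr_gt0.
by move=> x; rewrite mule_ge0// lee_fin ltW.
Qed.

(** Only [g] is measurable. A simple [h] below [f + g] is at most [k + g] with [k] the positive part
    of [h - g], which is measurable and below [f]; conversely [h + g] lies below [f + g] for every
    simple [h] below [f]. Both times additivity is applied to measurable functions. *)
Lemma lower_integralD f (g : T -> R) : (forall x, 0 <= f x) ->
  (forall x, (0 <= g x)%R) -> measurable_fun setT g ->
  \int[mu]_x (f x + (g x)%:E) = \int[mu]_x f x + \int[mu]_x (g x)%:E.
Proof.
move=> f0 g0 mg.
have fg0 x : 0 <= f x + (g x)%:E by rewrite adde_ge0// lee_fin.
have mEg : measurable_fun setT (EFin \o g) by exact/measurable_EFinP.
apply/eqP; rewrite eq_le; apply/andP; split.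
- rewrite [leLHS]ge0_integralTE//; apply: ge_ereal_sup => _ [h hfg <-].
  rewrite sintegralTE.
  have mh : measurable_fun setT h by exact: measurable_funPT.
  pose k x := Num.max (h x - g x)%R 0%R.
  have mk : measurable_fun setT k.
    by apply: measurable_funrpos; exact: measurable_funB.
  have k0 x : (0 <= k x)%R by rewrite /k le_max lexx orbT.
  apply: (@le_trans _ _ (\int[mu]_x ((k x)%:E + (g x)%:E))).
    apply: lower_integral_le => x; first by rewrite lee_fin.
    by rewrite -EFinD lee_fin -lerBlDr /k le_max lexx.
  have -> : \int[mu]_x ((k x)%:E + (g x)%:E) =
      \int[mu]_x (k x)%:E + \int[mu]_x (g x)%:E.
    by apply: ge0_integralD => // [x _||x _]; rewrite ?lee_fin//; exact/measurable_EFinP.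
  apply: leeD => //; apply: lower_integral_le => x; first by rewrite lee_fin.
  rewrite /k; case: (lerP (h x - g x)%R 0%R) => // _.
  by rewrite EFinB leeBlDr.
- have [gy|gfin] := eqVneq (\int[mu]_x (g x)%:E) +oo.
    suff -> : \int[mu]_x (f x + (g x)%:E) = +oo by rewrite leey.
    apply/eqP; rewrite -leye_eq -gy; apply: lower_integral_le => x.
      by rewrite lee_fin.
    by rewrite leeDr.
  have gf : \int[mu]_x (g x)%:E \is a fin_num.
    by rewrite ge0_fin_numE ?integral_ge0// ?ltey// => x _; rewrite lee_fin.
  rewrite -leeBrDr// [leLHS]ge0_integralTE//.
  apply: ge_ereal_sup => _ [h hf <-]; rewrite leeBrDr//.
  rewrite sintegralTE.
  have <- : \int[mu]_x ((h x)%:E + (g x)%:E) =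
      \int[mu]_x (h x)%:E + \int[mu]_x (g x)%:E.
    apply: ge0_integralD => // [x _||x _]; rewrite ?lee_fin//.
    by apply/measurable_EFinP; exact: measurable_funPT.
  apply: lower_integral_le => x; first by rewrite adde_ge0// lee_fin.
  by rewrite leeD2r.
Qed.

End lower_integral.

(** * Scalar products and positive definite matrices *)

Section dot_product.
Variable R : realType.

Definition dot n (u v : 'cV[R]_n) : R := (u^T *m v) 0 0.

Lemma dotE n (u v : 'cV[R]_n) : dot u v = \sum_i u i 0 * v i 0.
Proof. by rewrite /dot mxE; apply: eq_bigr => i _; rewrite mxE. Qed.

Lemma dotC n (u v : 'cV[R]_n) : dot u v = dot v u.
Proof. by rewrite !dotE; apply: eq_bigr => i _; rewrite mulrC. Qed.

Lemma dotDl n (u v w : 'cV[R]_n) : dot (u + v) w = dot u w + dot v w.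
Proof. by rewrite /dot linearD mulmxDl mxE. Qed.

Lemma dotDr n (u v w : 'cV[R]_n) : dot w (u + v) = dot w u + dot w v.
Proof. by rewrite /dot mulmxDr mxE. Qed.

Lemma dotZl n a (u v : 'cV[R]_n) : dot (a *: u) v = a * dot u v.
Proof. by rewrite /dot linearZ /= -scalemxAl mxE. Qed.

Lemma dotZr n a (u v : 'cV[R]_n) : dot u (a *: v) = a * dot u v.
Proof. by rewrite dotC dotZl dotC. Qed.

Lemma dotNl n (u v : 'cV[R]_n) : dot (- u) v = - dot u v.
Proof. by rewrite -scaleN1r dotZl mulN1r. Qed.

Lemma dotNr n (u v : 'cV[R]_n) : dot u (- v) = - dot u v.
Proof. by rewrite dotC dotNl dotC. Qed.

Lemma dot0l n (v : 'cV[R]_n) : dot 0 v = 0.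
Proof. by rewrite /dot trmx0 mul0mx mxE. Qed.

Lemma dot0r n (v : 'cV[R]_n) : dot v 0 = 0.
Proof. by rewrite dotC dot0l. Qed.

Lemma dot_sumr n (I : Type) (r : seq I) (P : pred I) (F : I -> 'cV[R]_n) v :
  dot v (\sum_(i <- r | P i) F i) = \sum_(i <- r | P i) dot v (F i).
Proof. by rewrite /dot mulmx_sumr summxE. Qed.

Lemma dotMl m n (A : 'M[R]_(m, n)) u v : dot (A *m u) v = dot u (A^T *m v).
Proof. by rewrite /dot trmx_mul mulmxA. Qed.

Lemma dotMr m n (A : 'M[R]_(m, n)) u v : dot u (A *m v) = dot (A^T *m u) v.
Proof. by rewrite dotMl trmxK. Qed.

Lemma dot_ge0 n (u : 'cV[R]_n) : 0 <= dot u u.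
Proof. by rewrite dotE sumr_ge0// => i _; rewrite -expr2 sqr_ge0. Qed.

Lemma dot_eq0 n (u : 'cV[R]_n) : dot u u = 0 -> u = 0.
Proof.
rewrite dotE => /eqP; rewrite psumr_eq0; last by move=> i _; rewrite -expr2 sqr_ge0.
move=> /allP u0; apply/colP => i; rewrite mxE; apply/eqP.
by have := u0 i (mem_index_enum _); rewrite mulf_eq0 orbb.
Qed.

Lemma dot_gt0 n (u : 'cV[R]_n) : u != 0 -> 0 < dot u u.
Proof. by move=> u0; rewrite lt_def dot_ge0 andbT; apply: contra_neq u0 => /dot_eq0. Qed.

Lemma dot_col_mx m n (a b : 'cV[R]_m) (u v : 'cV[R]_n) :
  dot (col_mx a u) (col_mx b v) = dot a b + dot u v.
Proof. by rewrite /dot tr_col_mx mul_row_col mxE. Qed.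

Lemma trmx_mulE n (u v : 'cV[R]_n) : u^T *m v = (dot u v)%:M.
Proof. exact: mx11_scalar. Qed.

Lemma dot1 (a b : 'cV[R]_1) : dot a b = a 0 0 * b 0 0.
Proof. by rewrite dotE big_ord1. Qed.

Definition pd n (M : 'M[R]_n) :=
  M^T = M /\ forall x : 'cV[R]_n, x != 0 -> 0 < dot x (M *m x).

Lemma pd_unit n (M : 'M[R]_n) : pd M -> M \in unitmx.
Proof.
case=> sM pM; rewrite -row_free_unit -kermx_eq0; apply/rowV0P => v /sub_kermxP vM.
have /eqP : M *m v^T = 0 by rewrite -[M]trmxK -trmx_mul sM vM trmx0.
move=> /eqP Mv; apply/eqP; rewrite -trmx_eq0; apply/negPn/negP => /pM.
by rewrite Mv dot0r ltxx.
Qed.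

(** Logarithm of an unnormalised Gaussian kernel with precision [M]; for positive definite [M] the
    mode solves [M *m z = u]. *)
Definition gexp n (M : 'M[R]_n) (u x : 'cV[R]_n) := - 2^-1 * dot x (M *m x) + dot u x.

End dot_product.

(** * Slices of a Gaussian kernel at a fixed first coordinate *)

Section gaussian_section.
Variables (R : realType) (n : nat) (M : 'M[R]_(1 + n)).
Hypothesis pM : pd M.
Let a := M 0 0.
Let w : 'cV[R]_n := dlsubmx M.
Let B : 'M[R]_n := drsubmx M.
Let q := invmx B *m w.
Let s := a - dot q w.

Lemma pd_blockE : M = block_mx a%:M w^T w B.
Proof.
rewrite -[LHS]submxK; congr block_mx; last first.
  by rewrite /w trmx_dlsub pM.1.
rewrite [LHS]mx11_scalar; congr (_%:M); rewrite !mxE.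
by congr (M _ _); apply/val_inj.
Qed.

Let MdotE (x : R) (v : 'cV[R]_n) : dot (col_mx x%:M v) (M *m col_mx x%:M v) =
  a * x ^+ 2 + 2 * x * dot w v + dot v (B *m v).
Proof.
rewrite [in LHS]pd_blockE mul_block_col dot_col_mx dot1 -scalar_mxM trmx_mulE dotDr.
rewrite mul_mx_scalar dotZr (dotC v w) !mxE /= !mulr1n; ring.
Qed.

Lemma pd_drsubmx : pd B.
Proof.
split; first by rewrite /B trmx_drsub pM.1.
move=> v v0; have := pM.2 (col_mx 0%:M v).
rewrite MdotE expr2 !(mulr0, mul0r, add0r); apply.
by apply: contra v0 => /eqP; rewrite -col_mx0 => /eq_col_mx[_ ->].
Qed.

Let uB : B \in unitmx. Proof. exact: pd_unit pd_drsubmx. Qed.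
Let Bq : B *m q = w. Proof. by rewrite /q mulmxA mulmxV// mul1mx. Qed.
Let sB : B^T = B. Proof. exact: pd_drsubmx.1. Qed.

(** The Schur complement [s] is the value of the quadratic form at the vector [(1, - q)]. *)
Lemma schur_gt0 : 0 < s.
Proof.
have := pM.2 (col_mx 1%:M (- q)); rewrite MdotE mulmxN Bq dotNr dotNr dotNl.
rewrite (dotC w q) /s => H.
suff : 0 < a * 1 ^+ 2 + 2 * 1 * - dot q w - - dot q w by lra.
apply: H; apply/eqP; rewrite -col_mx0 => /eq_col_mx[/matrixP/(_ 0 0)].
by rewrite !mxE /= => /eqP; rewrite oner_eq0.
Qed.

Lemma det_schur : \det M = s * \det B.
Proof.
rewrite {1}pd_blockE.
have -> : block_mx (a%:M : 'M[R]_1) w^T w B = block_mx (1%:M : 'M[R]_1) (q^T) 0 1%:M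
    *m block_mx (s%:M : 'M[R]_1) 0 w B.
  rewrite mulmx_block !mul1mx !mul0mx !add0r.
  congr block_mx; last by rewrite -Bq trmx_mul sB.
  by rewrite trmx_mulE -raddfD /s subrK.
by rewrite det_mulmx det_ublock det_lblock !det1 !mul1r det_mx11 !mxE mulr1n.
Qed.

(** A slice of a Gaussian kernel is again one, with precision [B] and a linear term affine in [t].
    The Gaussian inductions over [iint] rest on this. *)
Lemma gexp_section (u : 'cV[R]_(1 + n)) (t : R) (v : 'cV[R]_n) :
  gexp M u (col_mx t%:M v) =
  gexp B (dsubmx u - t *: w) v + (t * u 0 0 - 2^-1 * a * t ^+ 2).
Proof.
rewrite /gexp MdotE -{1}[u]vsubmxK dot_col_mx dot1 dotDl dotNl dotZl !mxE mulr1n.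
have -> : lshift n 0 = 0 :> 'I_(1 + n) by apply/val_inj.
by field.
Qed.

(* Completing the square in the first coordinate. *)
Lemma gexp_section_max (z u : 'cV[R]_(1 + n)) (t : R) : M *m z = u ->
  exists2 zt, B *m zt = dsubmx u - t *: w &
    2^-1 * dot (dsubmx u - t *: w) zt + (t * u 0 0 - 2^-1 * a * t ^+ 2) =
    2^-1 * dot u z - 2^-1 * s * (t - z 0 0) ^+ 2.
Proof.
move=> Mz; pose z' := dsubmx z; pose z0 := z 0 0.
have zE : z = col_mx z0%:M z'.
  rewrite -[LHS]vsubmxK; congr col_mx; rewrite [LHS]mx11_scalar !mxE.
  by congr ((z _ _)%:M); apply/val_inj.
have uE : u = col_mx (z0 * a + dot w z')%:M (z0 *: w + B *m z').
  rewrite -Mz {1}pd_blockE zE mul_block_col !mul_mx_scalar trmx_mulE.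
  by rewrite scale_scalar_mx -raddfD.
have u0E : u 0 0 = z0 * a + dot w z'.
  rewrite uE mxE; case: splitP => // j _.
  by rewrite !ord1 mxE mulr1n.
exists (z' + (z0 - t) *: q).
  by rewrite uE col_mxKd mulmxDr -scalemxAr Bq scalerBl addrA [B *m z' + _]addrC.
rewrite u0E -/z0 uE zE col_mxKd dot_col_mx dot1 !(dotDl, dotDr, dotNl, dotZl, dotZr).
rewrite !mxE !mulr1n !(dotMl, sB) Bq /s (dotC w q) (dotC z' w).
by field.
Qed.

End gaussian_section.

(** * Monotonicity, scaling and products for iterated integrals *)

Section iterated_integral.
Variable R : realType.
Local Notation mu := (@lebesgue_measure R).
Local Open Scope ereal_scope.

Lemma iint_ge0 n (f : 'cV[R]_n -> \bar R) : (forall x, 0 <= f x) -> 0 <= iint f.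
Proof.
elim: n f => [|n IH] f f0 /=; first exact: f0.
by apply: integral_ge0 => x _; exact: IH.
Qed.

Lemma iint_le n (f g : 'cV[R]_n -> \bar R) : (forall x, 0 <= f x) ->
  (forall x, f x <= g x) -> iint f <= iint g.
Proof.
elim: n f g => [|n IH] f g f0 fg /=; first exact: fg.
by apply: lower_integral_le => x; [exact: iint_ge0|exact: IH].
Qed.

Lemma eq_iint n (f g : 'cV[R]_n -> \bar R) : f =1 g -> iint f = iint g.
Proof. by move=> /funext ->. Qed.

Lemma iintZl n (f : 'cV[R]_n -> \bar R) (c : R) : (0 <= c)%R ->
  (forall x, 0 <= f x) -> iint (fun x => c%:E * f x) = c%:E * iint f.
Proof.
move=> c0; elim: n f => [//|n IH] f f0 /=.
rewrite -lower_integralZl//; last by move=> x; exact: iint_ge0.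
by apply: eq_integral => x _; rewrite IH.
Qed.

(** Each stage only pulls a constant out of a lower integral. *)
Lemma iint_prod n (h : 'I_n -> R -> R) (c : 'I_n -> R) :
  (forall i x, (0 <= h i x)%R) ->
  (forall i, \int[mu]_x (h i x)%:E = (c i)%:E) ->
  iint (fun g : 'cV[R]_n => (\prod_i h i (g i 0))%:E) = (\prod_i c i)%:E.
Proof.
move=> h0; elim: n h c h0 => [|n IH] h c h0 hc /=; first by rewrite !big_ord0.
have c0 i : (0 <= c i)%R.
  by rewrite -lee_fin -hc integral_ge0// => x _; rewrite lee_fin.
rewrite big_ord_recl EFinM -hc -[RHS]muleC -lower_integralZl ?prodr_ge0//; last first.
  by move=> x; rewrite lee_fin.
apply: eq_integral => x _.
rewrite -(IH (fun i => h (lift ord0 i)))// muleC -iintZl//; last first.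
  by move=> y; rewrite lee_fin prodr_ge0.
apply: eq_iint => v; rewrite -EFinM big_ord_recl; congr (_ * _)%:E.
  rewrite !mxE; case: splitP => [j _|j /eqP//]; by rewrite ord1 mxE mulr1n.
apply: eq_bigr => i _; rewrite !mxE; case: splitP => [j|j /= ij].
  by rewrite ord1.
by case: ij => ij; congr (h _ (v _ 0%R)); apply/val_inj.
Qed.

End iterated_integral.

(** * Gaussian integrals in several variables *)

Section gaussian_integral.
Variable R : realType.
Local Notation mu := (@lebesgue_measure R).

Lemma integral_gauss1 (s z c : R) : 0 < s ->
  (\int[mu]_x (expR (c - 2^-1 * s * (x - z) ^+ 2))%:E =
  (expR c * (2 * pi) `^ (1 / 2) * s `^ (- 1 / 2))%:E)%E.
Proof.
move=> s0; pose sg : R := (Num.sqrt s)^-1.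
have sg0 : sg != 0 by rewrite invr_neq0// gt_eqF// sqrtr_gt0.
have sg2 : sg ^+ 2 = s^-1 by rewrite exprVn sqr_sqrtr// ltW.
have pk : 0 < normal_peak sg by exact: normal_peak_gt0.
transitivity (\int[mu]_x ((expR c * (normal_peak sg)^-1)%:E * (normal_pdf z sg x)%:E))%E.
  apply: eq_integral => x _; rewrite -EFinM; congr EFin.
  rewrite normal_pdfE//= /normal_fun.
  have E (P C Y : R) : P != 0 -> C / P * (P * Y) = C * Y by move=> P0; field.
  rewrite E ?gt_eqF// -expRD; congr expR.
  by rewrite sg2; field; rewrite gt_eqF.
rewrite lower_integralZl; last 2 first.
  by rewrite mulr_ge0// ?expR_ge0// invr_ge0 ltW.
  by move=> x; rewrite lee_fin normal_pdf_ge0.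
rewrite integral_normal_pdf mule1; congr EFin; rewrite -mulrA; congr *%R.
rewrite /normal_peak invrK sg2 -mulrnAr sqrtrM ?invr_ge0 ?ltW//.
have pi2 : 0 <= pi *+ 2 :> R by rewrite mulrn_wge0// pi_ge0.
rewrite -!powR12_sqrt ?invr_ge0 ?pi2 ?(ltW s0)//.
by rewrite -powR_inv1 ?(ltW s0)// -powRrM mulrC mulr_natl div1r.
Qed.

Lemma pd_det_gt0 n (M : 'M[R]_n) : pd M -> 0 < \det M.
Proof.
elim: n M => [|n IH] M pM; first by rewrite det_mx00.
by rewrite (det_schur pM) mulr_gt0 ?(schur_gt0 pM)// IH//; exact: pd_drsubmx pM.
Qed.

(** Integrating out all coordinates but the first leaves a one-dimensional Gaussian whose precision
    is the Schur complement and whose centre is the first coordinate of [z]. *)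
Lemma iint_gauss n (M : 'M[R]_n) (u z : 'cV[R]_n) : pd M -> M *m z = u ->
  iint (fun x => (expR (gexp M u x))%:E) =
  ((2 * pi) `^ (n%:R / 2) * (\det M) `^ (- 1 / 2) * expR (2^-1 * dot u z))%:E.
Proof.
elim: n M u z => [|n IH] M u z pM Mz /=.
  rewrite (flatmx0 z) dot0r mulr0 mul0r powRr0 det_mx00 powR1 !mul1r expR0.
  by rewrite /gexp !dot0r dot0l mulr0 addr0 expR0.
have pB := pd_drsubmx pM.
pose a := M 0 0; pose w : 'cV[R]_n := dlsubmx (M : 'M[R]_(1 + n)).
pose B : 'M[R]_n := drsubmx (M : 'M[R]_(1 + n)).
pose s := a - dot (invmx B *m w) w.
have s0 : 0 < s := schur_gt0 pM.
pose K := (2 * pi) `^ (n%:R / 2) * (\det B) `^ (- 1 / 2).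
have K0 : 0 <= K by rewrite mulr_ge0 ?powR_ge0.
transitivity (\int[mu]_x (K%:E *
    (expR (2^-1 * dot u z - 2^-1 * s * (x - z 0 0) ^+ 2))%:E))%E.
  apply: eq_integral => t _.
  have [zt Bz <-] := gexp_section_max pM t Mz.
  transitivity (iint (fun v => ((expR (t * u 0 0 - 2^-1 * a * t ^+ 2))%:E *
      (expR (gexp B (dsubmx (u : 'cV[R]_(1 + n)) - t *: w) v))%:E)%E)).
    by apply: eq_iint => v; rewrite gexp_section// expRD mulrC EFinM.
  rewrite iintZl ?expR_ge0//.
  by rewrite (IH _ _ zt pB Bz) -/K -!EFinM [in RHS]expRD; congr EFin; ring.
rewrite lower_integralZl// integral_gauss1// -EFinM det_schur// -/a -/w -/B -/s.
congr EFin.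
have -> : (s * \det B) `^ (- 1 / 2) = s `^ (- 1 / 2) * \det B `^ (- 1 / 2).
  by rewrite powRM ?(ltW s0) ?(ltW (pd_det_gt0 pB)).
have -> : n.+1%:R / 2 = n%:R / 2 + 1 / 2 :> R by rewrite -natr1; field.
rewrite powRD; last by rewrite mulf_neq0 ?pnatr_eq0 ?gt_eqF ?pi_gt0 ?implybT.
by rewrite /K; ring.
Qed.

(** The induction works for arbitrary [f] because the integral of the kernel over the inner
    coordinates is the explicit measurable function [g] of the first one, so that [lower_integralD]
    applies again at the outer level. *)
Lemma iintD_gauss n (M : 'M[R]_n) (u : 'cV[R]_n) (c : R)
    (f : 'cV[R]_n -> \bar R) : 0 <= c -> pd M -> (forall x, 0 <= f x)%E ->
  (iint (fun x => f x + (c * expR (gexp M u x))%:E) =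
  iint f + iint (fun x => (c * expR (gexp M u x))%:E))%E.
Proof.
elim: n M u c f => [//|n IH] M u c f c0 pM f0 /=.
have pB := pd_drsubmx pM.
pose a := M 0 0; pose w : 'cV[R]_n := dlsubmx (M : 'M[R]_(1 + n)).
pose B : 'M[R]_n := drsubmx (M : 'M[R]_(1 + n)).
pose s := a - dot (invmx B *m w) w.
pose K := (2 * pi) `^ (n%:R / 2) * (\det B) `^ (- 1 / 2).
have K0 : 0 <= K by rewrite mulr_ge0 ?powR_ge0.
pose z := invmx M *m u.
have Mz : M *m z = u by rewrite /z mulmxA mulmxV ?mul1mx// pd_unit.
pose g x := c * K * expR (2^-1 * dot u z - 2^-1 * s * (x - z 0 0) ^+ 2).
have sec x v : c * expR (gexp M u (col_mx (x%:M : 'M[R]_1) v)) =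
    c * expR (x * u 0 0 - 2^-1 * a * x ^+ 2) *
    expR (gexp B (dsubmx (u : 'cV[R]_(1 + n)) - x *: w) v).
  by rewrite gexp_section// [in LHS]expRD [expR (gexp _ _ _) * _]mulrC mulrA.
have c1 x : 0 <= c * expR (x * u 0 0 - 2^-1 * a * x ^+ 2).
  by rewrite mulr_ge0 ?expR_ge0.
have gE x : iint (fun v => (c * expR (gexp M u (col_mx (x%:M : 'M[R]_1) v)))%:E) = (g x)%:E.
  have [zt Bz zE] := gexp_section_max pM x Mz.
  under eq_iint do rewrite sec EFinM.
  rewrite iintZl// (iint_gauss pB Bz) -EFinM; congr EFin.
  by rewrite /g -zE [in RHS]expRD -/K; ring.
under eq_integral => x _.
  under eq_iint do rewrite sec.
  rewrite IH//.
  under [X in (_ + X)%E]eq_iint do rewrite -sec.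
  rewrite gE; over.
under [X in _ = (_ + X)%E]eq_integral do rewrite gE.
rewrite lower_integralD//.
- by move=> x; exact: iint_ge0.
- by move=> x; rewrite mulr_ge0 ?expR_ge0// mulr_ge0.
- apply: measurable_funM => //; apply: measurableT_comp => //.
  apply: measurable_funB => //; apply: measurable_funM => //.
  by apply: measurable_funX; exact: measurable_funB.
Qed.

End gaussian_integral.

(** * Bounds for [gprob] by combinations of Gaussian kernels *)

Section gaussian_test_functions.
Variables (R : realType) (n : nat) (m : 'cV[R]_n) (tau : R).
Hypothesis tau0 : 0 < tau.
Implicit Types (s : seq (R * 'M[R]_n)) (y e : 'cV[R]_n).

(** A test is a list of pairs of a coefficient and a matrix; [tev] is its value at the noise [e],
    and [tval] its mean when [e] is normal with covariance [tau] times the identity. *)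
Definition tev s e : R :=
  \sum_(i <- s) i.1 * expR (- (dot e (i.2 *m e) / (2 * tau))).

Definition tval s : R := \sum_(i <- s) i.1 * (\det (1%:M + i.2)) `^ (- 1 / 2).

(** Makes each kernel, multiplied by the Gaussian density, a positive definite Gaussian kernel
    again. *)
Definition twf s := forall i, i \in s -> pd (1%:M + i.2).

Let phi y := mvn_pdf m (tau *: 1%:M) y.

Lemma mvn_pdf_scalarE q (v x : 'cV[R]_q) (t : R) : 0 < t ->
  mvn_pdf v (t *: 1%:M) x = (2 * pi) `^ (- (q%:R / 2)) * (t ^+ q) `^ (- 1 / 2) *
    expR (- (dot (x - v) (x - v) / (2 * t))).
Proof.
move=> t0; rewrite /mvn_pdf mulNr; congr (_ * _ * expR _).
  by rewrite scalemx1 det_scalar.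
rewrite scalemx1 invmx_scalar mul_mx_scalar -scalemxAl mxE -/(dot _ _).
by field; rewrite gt_eqF.
Qed.

Lemma iint_gauss_term (c : R) (N : 'M[R]_n) : pd (1%:M + N) ->
  exists (K : R) (M : 'M[R]_n) (u : 'cV[R]_n), [/\ 0 <= K, pd M,
    (forall y, phi y * (c * expR (- (dot (y - m) (N *m (y - m)) / (2 * tau)))) =
       c * K * expR (gexp M u y)) &
    iint (fun y => (K * expR (gexp M u y))%:E) =
      ((\det (1%:M + N)) `^ (- 1 / 2))%:E].
Proof.
move=> pN; pose M := tau^-1 *: (1%:M + N).
have pM : pd M.
  split; first by rewrite /M linearZ /= pN.1.
  by move=> x x0; rewrite /M -scalemxAl dotZr mulr_gt0 ?invr_gt0// pN.2.
pose k := (2 * pi) `^ (- (n%:R / 2)) * (tau ^+ n) `^ (- 1 / 2) : R.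
pose K := k * expR (- (2^-1 * dot m (M *m m))).
have k0 : 0 <= k by rewrite mulr_ge0 ?powR_ge0.
have K0 : 0 <= K by rewrite mulr_ge0 ?expR_ge0.
exists K, M, (M *m m); split => // [y|].
  rewrite /phi mvn_pdf_scalarE// -/k /K.
  have E (A B C D : R) : A * B = C * D -> k * A * (c * B) = c * (k * C) * D.
    by move=> AB; rewrite mulrACA AB; ring.
  apply: E; rewrite -!expRD; congr expR.
  rewrite /gexp !mulmxBr !(dotDl, dotDr, dotNl, dotNr).
  have -> : dot (M *m m) y = dot m (M *m y) by rewrite dotMl pM.1.
  rewrite /M -!scalemxAl !dotZr !mulmxDl !mul1mx !dotDr (dotC y m).
  have -> : dot y (N *m m) = dot m (N *m y).
    have := pN.1; rewrite linearD /= trmx1 => /addrI sN.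
    by rewrite dotMr sN dotC.
  by field; rewrite gt_eqF.
transitivity (K%:E * iint (fun y => (expR (gexp M (M *m m) y))%:E))%E.
  by rewrite -iintZl// => y; rewrite lee_fin expR_ge0.
rewrite (iint_gauss pM erefl) -EFinM; congr EFin.
have dN : 0 < \det (1%:M + N) := pd_det_gt0 pN.
have -> : \det M `^ (- 1 / 2) =
    ((tau ^+ n) `^ (- 1 / 2))^-1 * \det (1%:M + N) `^ (- 1 / 2).
  rewrite /M detZ powRM ?exprn_ge0 ?invr_ge0 ?(ltW tau0)// ?(ltW dN)//.
  congr (_ * _); rewrite exprVn -(@powR_inv1 _ (tau ^+ n)) ?exprn_ge0 ?(ltW tau0)//.
  by rewrite -powRrM -powRN; congr (_ `^ _); ring.
rewrite /K /k powRN dotMl pM.1 expRN.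
have -> (A B E D : R) : 0 < A -> 0 < B -> 0 < E ->
    A^-1 * B * E^-1 * (A * (B^-1 * D) * E) = D.
  by move=> A0 B0 E0; field; rewrite !gt_eqF.
- by [].
- by rewrite powR_gt0// mulr_gt0 ?pi_gt0.
- by rewrite powR_gt0// exprn_gt0.
- exact: expR_gt0.
Qed.

Lemma iintD_tev (f : 'cV[R]_n -> \bar R) s : (forall i, i \in s -> 0 <= i.1) ->
  twf s -> (forall y, 0 <= f y)%E ->
  (iint (fun y => f y + (phi y * tev s (y - m))%:E) = iint f + (tval s)%:E)%E.
Proof.
move=> + + f0; elim: s => [_ _|[c N] s IH s0 ws].
  rewrite /tval big_nil adde0; apply: eq_iint => y.
  by rewrite /tev big_nil mulr0 adde0.
have phi0 y : 0 <= phi y by rewrite !mulr_ge0 ?powR_ge0 ?expR_ge0.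
have s0' i : i \in s -> 0 <= i.1 by move=> si; apply: s0; rewrite inE si orbT.
have ws' : twf s by move=> i si; apply: ws; rewrite inE si orbT.
have c0 : 0 <= c by apply: (s0 (c, N)); rewrite mem_head.
have [K [M [u [K0 pM KE IK]]]] := iint_gauss_term c (ws (c, N) (mem_head _ _)).
transitivity (iint (fun y => (f y + (phi y * tev s (y - m))%:E)
    + (c * K * expR (gexp M u y))%:E)%E).
  apply: eq_iint => y; rewrite /tev big_cons mulrDr KE EFinD.
  by rewrite [X in (_ + X)%E]addeC addeA.
have tev0 e : 0 <= tev s e.
  by rewrite /tev big_seq sumr_ge0// => i si; rewrite mulr_ge0 ?expR_ge0 ?s0'.
rewrite iintD_gauss// ?mulr_ge0//; last first.
  by move=> y; rewrite adde_ge0// lee_fin mulr_ge0.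
rewrite IH// -addeA; congr (_ + _)%E; rewrite /tval big_cons [in RHS]addrC EFinD.
congr (_ + _)%E; rewrite EFinM -IK -iintZl//; last first.
  by move=> y; rewrite lee_fin mulr_ge0 ?expR_ge0.
by apply: eq_iint => y; rewrite -EFinM mulrA.
Qed.

(** Additivity of lower integrals is available for nonnegative summands, so a test with coefficients
    of both signs is split into two nonnegative tests, and the negative part is moved to the other
    side of each inequality. *)
Let tpos s := [seq i <- s | 0 <= i.1].
Let tneg s := [seq (- i.1, i.2) | i <- s & ~~ (0 <= i.1)].

Let tevE s e : tev s e = tev (tpos s) e - tev (tneg s) e.
Proof.
rewrite /tev /tpos /tneg big_map !big_filter (bigID (fun i => 0 <= i.1)) /=.
by congr (_ + _); rewrite -sumrN; apply: eq_bigr => i _ /=; ring.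
Qed.

Let tvalE s : tval s = tval (tpos s) - tval (tneg s).
Proof.
rewrite /tval /tpos /tneg big_map !big_filter (bigID (fun i => 0 <= i.1)) /=.
by congr (_ + _); rewrite -sumrN; apply: eq_bigr => i _ /=; ring.
Qed.

Let tpos_ge0 s i : i \in tpos s -> 0 <= i.1.
Proof. by rewrite mem_filter => /andP[]. Qed.

Let tneg_ge0 s i : i \in tneg s -> 0 <= i.1.
Proof.
by move=> /mapP[j + ->]; rewrite mem_filter -ltNge => /andP[/ltW j0 _] /=; rewrite oppr_ge0.
Qed.

Let twf_pos s : twf s -> twf (tpos s).
Proof. by move=> ws i; rewrite mem_filter => /andP[_]; exact: ws. Qed.

Let twf_neg s : twf s -> twf (tneg s).
Proof.
by move=> ws i /mapP[j + ->] /=; rewrite mem_filter => /andP[_]; exact: ws.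
Qed.

Let phi_ge0 y : 0 <= phi y.
Proof. by rewrite !mulr_ge0 ?powR_ge0 ?expR_ge0. Qed.

Let tev_ge0 s e : (forall i, i \in s -> 0 <= i.1) -> 0 <= tev s e.
Proof.
by move=> s0; rewrite /tev big_seq sumr_ge0// => i si; rewrite mulr_ge0 ?expR_ge0 ?s0.
Qed.

Let iint_tev s : (forall i, i \in s -> 0 <= i.1) -> twf s ->
  iint (fun y => (phi y * tev s (y - m))%:E) = (tval s)%:E.
Proof.
move=> s0 ws; have := @iintD_tev (cst 0%E) s s0 ws (fun=> lexx _).
under eq_iint do rewrite add0e.
move=> ->; suff -> : iint (cst 0%E : 'cV[R]_n -> _) = 0%E by rewrite add0e.
elim: (n) => //= k ->; exact: integral0.
Qed.

Variable E : 'cV[R]_n -> bool.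
Let ind y : R := if E y then 1 else 0.

Let indphi_ge0 y : (0 <= (phi y * ind y)%:E)%E.
Proof. by rewrite lee_fin mulr_ge0// /ind; case: (E y). Qed.

Lemma gprob_fin : iint (fun y => (phi y * ind y)%:E) = (gprob m tau E)%:E.
Proof.
(* The zero matrix gives the constant test 1, which dominates the indicator. *)
have w1 : twf [:: (1, 0)].
  move=> i; rewrite inE => /eqP -> /=; rewrite addr0; split; first exact: trmx1.
  by move=> x x0; rewrite mul1mx dot_gt0.
rewrite /gprob fineK// ge0_fin_numE ?iint_ge0//.
apply: (@le_lt_trans _ _ (tval [:: (1, 0)])%:E); last exact: ltry.
rewrite -iint_tev//; last by move=> i; rewrite inE => /eqP ->.
apply: iint_le => // y; rewrite lee_fin ler_wpM2l// /tev big_seq1 /= mul0mx dot0r.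
by rewrite mul0r oppr0 expR0 mulr1 /ind; case: (E y).
Qed.

Lemma gprob_ge0 : 0 <= gprob m tau E.
Proof. by rewrite -lee_fin -gprob_fin iint_ge0. Qed.

Lemma gprob_le_tval s : twf s -> (forall y, ind y <= tev s (y - m)) ->
  gprob m tau E <= tval s.
Proof.
move=> ws Es; rewrite tvalE -lee_fin EFinB leeBrDr// -gprob_fin.
rewrite -iintD_tev//; [|exact: tneg_ge0|exact: twf_neg].
rewrite -iint_tev; [|exact: tpos_ge0|exact: twf_pos].
apply: iint_le => y.
  by rewrite adde_ge0// lee_fin mulr_ge0// tev_ge0//; exact: tneg_ge0.
rewrite -EFinD lee_fin -mulrDr ler_wpM2l// -lerBrDr -tevE; exact: Es.
Qed.

Lemma gprob_ge_tval s : twf s -> (forall y, tev s (y - m) <= ind y) ->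
  tval s <= gprob m tau E.
Proof.
move=> ws Es; rewrite tvalE -lee_fin EFinB leeBlDr// -gprob_fin.
rewrite -iintD_tev//; [|exact: tneg_ge0|exact: twf_neg].
rewrite -iint_tev; [|exact: tpos_ge0|exact: twf_pos].
apply: iint_le => y.
  by rewrite lee_fin mulr_ge0// tev_ge0//; exact: tpos_ge0.
rewrite -EFinD lee_fin -mulrDr ler_wpM2l// -lerBlDr -tevE; exact: Es.
Qed.

End gaussian_test_functions.

(** * Block orthogonal designs and their weighted projections *)

Section design.
Variables (R : realType) (n p k : nat) (blk : 'I_p -> 'I_k) (X : 'M[R]_(n, p)).
Implicit Types (G : {set 'I_p}) (f g : 'I_k -> R) (b : 'I_k).

Definition gram G : 'M[R]_#|G| := (Xsub X G)^T *m Xsub X G.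

Definition blockdiag G f : 'M[R]_#|G| := diag_mx (\row_j f (blk (enum_val j))).

(** Under block orthogonality this acts as the scalar [f b] on the span of the columns of [G] in
    block [b] and as 0 on the orthogonal complement. Constant 1 gives the projection onto all
    columns of [G], the indicator of a block the projection onto that block; functions on blocks
    become commuting symmetric matrices. *)
Definition blockproj G f : 'M[R]_n :=
  Xsub X G *m invmx (gram G) *m blockdiag G f *m (Xsub X G)^T.

Definition blocksize G b := #|[set j in G | blk j == b]|.

Lemma gramE G i j : gram G i j = \sum_l X l (enum_val i) * X l (enum_val j).
Proof. by rewrite /gram mxE; apply: eq_bigr => l _; rewrite !mxE. Qed.

Lemma gram_sym G : (gram G)^T = gram G.
Proof. by rewrite /gram trmx_mul trmxK. Qed.

Lemma dot_gram G x : dot x (gram G *m x) = dot (Xsub X G *m x) (Xsub X G *m x).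
Proof. by rewrite dotMl mulmxA. Qed.

Lemma gram_pd G : gram G \in unitmx -> pd (gram G).
Proof.
move=> uG; split; first exact: gram_sym.
move=> x x0; rewrite dot_gram dot_gt0//; apply: contra_neq x0 => Xx.
by rewrite -[x]mul1mx -(mulVmx uG) -!mulmxA Xx !mulmx0.
Qed.

Lemma blockdiag_tr G f : (blockdiag G f)^T = blockdiag G f.
Proof. exact: tr_diag_mx. Qed.

Lemma blockdiagM G f g : blockdiag G f *m blockdiag G g = blockdiag G (f \* g).
Proof.
rewrite /blockdiag mulmx_diag; congr diag_mx.
by apply/rowP => j; rewrite !mxE.
Qed.

Lemma blockdiag1 G : blockdiag G (fun=> 1) = 1%:M.
Proof.
by rewrite -diag_const_mx; congr diag_mx; apply/rowP => j; rewrite !mxE.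
Qed.

Lemma eq_blockdiag G f g : f =1 g -> blockdiag G f = blockdiag G g.
Proof. by move=> /funext ->. Qed.

Lemma blockdiag_sum G (I : finType) (c : I -> R) (F : I -> 'I_k -> R) :
  blockdiag G (fun b => \sum_i c i * F i b) = \sum_i c i *: blockdiag G (F i).
Proof.
apply/matrixP => i j; rewrite summxE !mxE.
transitivity (\sum_l c l * F l (blk (enum_val i)) *+ (i == j)).
  by rewrite -sumrMnl.
by apply: eq_bigr => l _; rewrite !mxE mulrnAr.
Qed.

Lemma prod_blockE G f :
  \prod_(j < #|G|) f (blk (enum_val j)) = \prod_b f b ^+ blocksize G b.
Proof.
rewrite -(big_enum_val (fun j => f (blk j))) /=.
rewrite (partition_big blk predT)//=; apply: eq_bigr => b _.
rewrite (eq_bigr (fun=> f b)); last by move=> j /andP[_ /eqP ->].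
by rewrite prodr_const; congr (_ ^+ _); apply: eq_card => j; rewrite !inE.
Qed.

Lemma det_blockdiag G f : \det (blockdiag G f) = \prod_b f b ^+ blocksize G b.
Proof.
by rewrite det_diag -prod_blockE; apply: eq_bigr => j _; rewrite mxE.
Qed.

Hypothesis oX : forall j l : 'I_p, blk j != blk l -> \sum_i X i j * X i l = 0.

(** Block orthogonality at the level of matrices; the calculus of [blockproj] follows from this
    commutation. *)
Lemma blockdiag_gramC G f : blockdiag G f *m gram G = gram G *m blockdiag G f.
Proof.
apply/matrixP => i j; rewrite mul_diag_mx mul_mx_diag [LHS]mxE [RHS]mxE gramE !mxE.
have [<-|bij] := eqVneq (blk (enum_val i)) (blk (enum_val j)); first by rewrite mulrC.
by rewrite oX// mulr0 mul0r.
Qed.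

(** With [r] the root of [f], commutation turns the product into the congruence of the Gram matrix
    by the invertible diagonal matrix of [r]. *)
Lemma pd_blockdiag_gram G f : gram G \in unitmx -> (forall b, 0 < f b) ->
  pd (blockdiag G f *m gram G).
Proof.
move=> uG f0; split.
  by rewrite trmx_mul blockdiag_tr gram_sym blockdiag_gramC.
move=> x x0; pose r b := Num.sqrt (f b).
have fE : blockdiag G f = blockdiag G r *m blockdiag G r.
  by rewrite blockdiagM; apply: eq_blockdiag => b /=; rewrite -expr2 sqr_sqrtr// ltW.
have ur : blockdiag G r *m blockdiag G (fun b => (r b)^-1) = 1%:M.
  rewrite blockdiagM -(blockdiag1 G); apply: eq_blockdiag => b /=.
  by rewrite divff// gt_eqF// sqrtr_gt0.
rewrite fE -[_ *m gram G]mulmxA blockdiag_gramC -!mulmxA dotMr blockdiag_tr.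
rewrite (mulmxA (Xsub X G)^T) -/(gram G); apply: (gram_pd uG).2; apply: contra_neq x0 => rx.
have : blockdiag G (fun b => (r b)^-1) *m (blockdiag G r *m x) = x.
  rewrite mulmxA blockdiagM (_ : blockdiag _ _ = 1%:M) ?mul1mx//.
  by rewrite -ur blockdiagM; apply: eq_blockdiag => b /=; rewrite mulrC.
by rewrite rx mulmx0.
Qed.

Lemma blockdiag_invgramC G f : gram G \in unitmx ->
  blockdiag G f *m invmx (gram G) = invmx (gram G) *m blockdiag G f.
Proof.
move: (blockdiag_gramC G f); move: (gram G) => K DK uK.
rewrite -[LHS]mul1mx -(mulVmx uK) -!mulmxA; congr (_ *m _).
by rewrite mulmxA -DK -mulmxA mulmxV// mulmx1.
Qed.

Lemma blockproj_tr G f : gram G \in unitmx -> (blockproj G f)^T = blockproj G f.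
Proof.
move=> uG; rewrite /blockproj !trmx_mul trmxK blockdiag_tr trmx_inv gram_sym.
by rewrite !mulmxA -[X in X *m _ = _]mulmxA blockdiag_invgramC// mulmxA.
Qed.

Lemma blockproj_sub G f : gram G \in unitmx ->
  blockproj G f *m Xsub X G = Xsub X G *m blockdiag G f.
Proof.
move=> uG; rewrite /blockproj -[LHS]mulmxA -/(gram G) -[LHS]mulmxA.
by rewrite blockdiag_gramC [LHS]mulmxA mulmxKV.
Qed.

Lemma blockprojM G f g : gram G \in unitmx ->
  blockproj G f *m blockproj G g = blockproj G (f \* g).
Proof.
move=> uG.
have aux (Z : 'M[R]_(n, #|G|)) Ki Df Dg (P : 'M[R]_n) : P *m Z = Z *m Df ->
    Df *m Ki = Ki *m Df ->
    P *m (Z *m Ki *m Dg *m Z^T) = Z *m Ki *m (Df *m Dg) *m Z^T.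
  by move=> PZ DK; rewrite !mulmxA PZ -[_ *m _ *m Ki]mulmxA DK !mulmxA.
by rewrite /(blockproj _ (_ \* _)) -blockdiagM -(aux _ _ _ _ _ (blockproj_sub f uG))// blockdiag_invgramC.
Qed.

Lemma blockproj_sum G (I : finType) (c : I -> R) (F : I -> 'I_k -> R) :
  blockproj G (fun b => \sum_i c i * F i b) = \sum_i c i *: blockproj G (F i).
Proof.
rewrite /blockproj blockdiag_sum mulmx_sumr mulmx_suml; apply: eq_bigr => i _.
by rewrite -scalemxAr -scalemxAl.
Qed.

Lemma projmxE G : projmx (Xsub X G) = blockproj G (fun=> 1).
Proof. by rewrite /blockproj blockdiag1 mulmx1. Qed.

End design.

(** * Polynomials against exponentials *)

Section polynomial_vs_exponential.
Variable R : realType.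

(** From [exp(- t) <= 1 / t] at [t = c x / (d + 1)], raised to the power [d + 1]. *)
Lemma poly_expRN_le (d : nat) (c K e : R) : 0 < c -> 0 < e ->
  exists2 x0, 0 < x0 & forall x, x0 <= x -> K * x ^+ d * expR (- (c * x)) <= e.
Proof.
move=> c0 e0; pose A := (d.+1%:R / c) ^+ d.+1.
have A0 : 0 <= A by rewrite exprn_ge0// divr_ge0// ltW.
exists (1 + `|K| * A / e).
  by rewrite ltr_wpDr// divr_ge0 ?mulr_ge0// ltW.
move=> x x0; have xp : 0 < x.
  by apply: lt_le_trans x0; rewrite ltr_wpDr// divr_ge0 ?mulr_ge0// ltW.
have -> : expR (- (c * x)) = (expR (- (c * x / d.+1%:R))) ^+ d.+1.
  by rewrite -expRM_natl; congr expR; field.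
have le1 : expR (- (c * x / d.+1%:R)) <= d.+1%:R / c / x.
  have t0 : 0 < c * x / d.+1%:R by rewrite divr_gt0 ?mulr_gt0.
  have -> : d.+1%:R / c / x = (c * x / d.+1%:R)^-1.
    by field; rewrite !gt_eqF// ltr0n.
  rewrite expRN lef_pV2 ?posrE ?expR_gt0//.
  by apply: (le_trans _ (expR_ge1Dx _)); rewrite lerDr.
have le2 : x ^+ d * expR (- (c * x / d.+1%:R)) ^+ d.+1 <= A / x.
  apply: (@le_trans _ _ (x ^+ d * (d.+1%:R / c / x) ^+ d.+1)).
    by rewrite ler_wpM2l ?exprn_ge0 ?(ltW xp)// lerXn2r// ?nnegrE ?expR_ge0// !divr_ge0// ltW.
  rewrite [in X in X <= _]expr_div_n -/A exprS.
  suff -> : x ^+ d * (A / (x * x ^+ d)) = A / x by [].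
  by field; rewrite gt_eqF// expf_neq0// gt_eqF.
rewrite -mulrA; apply: (@le_trans _ _ (`|K| * (A / x))).
  apply: (le_trans (ler_wpM2r _ (ler_norm K))); last by rewrite ler_wpM2l.
  by rewrite mulr_ge0// exprn_ge0 ?expR_ge0// ltW.
rewrite mulrA ler_pdivrMr// [e * x]mulrC -ler_pdivrMr//; apply: (le_trans _ x0).
by rewrite lerDr.
Qed.

End polynomial_vs_exponential.

(** * The hyper-g density and its total mass *)

Section hyper_g.
Variables (R : realType) (a : R).
Local Notation mu := (@lebesgue_measure R).
Hypotheses (a2 : 2 < a) (a4 : a <= 4).

Lemma is_derive_powRD (r x : R) : -1 < x ->
  is_derive x 1 (fun y : R => (1 + y) `^ r) (r * (1 + x) `^ (r - 1)).
Proof.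
move=> x1; have x0 : 0 < 1 + x by rewrite -ltrBlDl sub0r.
have H1 : is_derive (1 + x) 1 (fun y : R => y `^ r) (r * (1 + x) `^ (r - 1)).
  exact: is_derive1_powR.
have H2 : is_derive x 1 (fun y : R => 1 + y) 1.
  by have := is_deriveD (is_derive_cst (1 : R) x 1) (is_derive_id x 1); rewrite add0r.
have := @is_derive1_comp _ (fun y : R => y `^ r) (fun y => 1 + y) x _ _ H1 H2.
by rewrite mulr1.
Qed.

Lemma continuous_powRD (r x : R) : -1 < x ->
  (1 + y) `^ r @[y --> x] --> (1 + x) `^ r.
Proof.
move=> /(is_derive_powRD r)[dx _].
by have /derivable1_diffP/differentiable_continuous := dx.
Qed.

(** Extended by zero so that integrals run over the whole line. With parameter 4 it is
    [(1 + s)^(-2)] for [s > 0], used later in the variance variable as an integrable majorant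
    unrelated to the prior. *)
Definition hgpdf g : R := if 0 < g then hyperg a g else 0.

(** The factor in [g] left by a block with [q] predictors once the coefficients are integrated out;
    [g / (1 + g)] is the shrinkage factor. *)
Definition hgker (q : nat) (x g : R) : R :=
  hgpdf g * (1 + g) `^ (- (q%:R / 2)) * expR (x * (g / (1 + g))).

Definition Psi q x : R := fine (\int[mu]_g (hgker q x g)%:E)%E.

Lemma hyperg_ge0 g : 0 <= hyperg a g.
Proof. by rewrite mulr_ge0 ?powR_ge0// divr_ge0// subr_ge0 ltW. Qed.

Lemma hgpdf_ge0 g : 0 <= hgpdf g.
Proof. by rewrite /hgpdf; case: ifP => // _; exact: hyperg_ge0. Qed.

Lemma measurable_hgpdf : measurable_fun setT hgpdf.
Proof.
apply: measurable_fun_ifT => //; first exact: measurable_fun_ltr.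
rewrite (_ : hyperg a = cst ((a - 2) / 2) \* (fun x => (1 + x) `^ (- a / 2)))//.
apply: measurable_funM => //.
have m1 : measurable_fun setT (fun x : R => 1 + x) by exact: measurable_funD.
exact: measurableT_comp (@measurable_powR R (- a / 2)) m1.
Qed.

(** The antiderivative is [- (1 + g)^(1 - a / 2)], which vanishes at infinity because [2 < a]. *)
Lemma integral_hgpdf : (\int[mu]_g (hgpdf g)%:E = 1)%E.
Proof.
transitivity (\int[mu]_(g in `]0%R, +oo[) (hyperg a g)%:E)%E.
  rewrite [RHS]integral_mkcond; apply: eq_integral => g _.
  by rewrite patchE mem_setE in_itv /= andbT /hgpdf; case: ifP.
have cf : {within `[0, +oo[, continuous (hyperg a)}.
  apply: continuous_in_subspaceT => x; rewrite inE /= in_itv /= andbT => x0.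
  apply: cvgM; first exact: cvg_cst.
  by apply: continuous_powRD; apply: lt_le_trans x0.
rewrite integral_itv_obnd_cbnd; last first.
  apply/measurable_EFinP; apply: open_continuous_measurable_fun.
    exact: interval_open.
  move=> x; rewrite inE /= in_itv /= andbT => x0.
  apply: cvgM; first exact: cvg_cst.
  by apply: continuous_powRD; apply: lt_trans x0.
rewrite (@ge0_continuous_FTC2y _ _ (fun x => - (1 + x) `^ (1 - a / 2)) _ 0)//.
- by rewrite addr0 powR1 sub0e EFinN oppeK.
- by move=> x _; exact: hyperg_ge0.
- rewrite -oppr0; apply: cvgN.
  have r0 : 0 < a / 2 - 1 by rewrite subr_gt0 ltr_pdivlMr// mul1r.
  apply/cvgr0Pnorm_le => e e0; near=> x.
  have x0 : 0 < 1 + x by rewrite ltr_pwDl//; near: x; exact: nbhs_pinfty_ge.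
  rewrite ger0_norm ?powR_ge0// (_ : 1 - a / 2 = - (a / 2 - 1)); last by rewrite opprB.
  rewrite powRN -[leRHS]invrK lef_pV2 ?posrE ?invr_gt0 ?powR_gt0//.
  have -> : e^-1 = (e^-1 `^ (a / 2 - 1)^-1) `^ (a / 2 - 1).
    by rewrite -powRrM mulVf ?gt_eqF// powRr1// invr_ge0 ltW.
  apply: ge0_ler_powR; rewrite ?nnegrE ?powR_ge0 ?(ltW x0) ?(ltW r0)//.
  by rewrite ler_wpDl//; near: x; exact: nbhs_pinfty_ge.
- move=> x x0; apply: derivableN.
  by have [] := is_derive_powRD (1 - a / 2) (lt_trans (ltrN10 R) x0).
- apply: cvgN; apply: cvg_at_right_filter.
  by apply: continuous_powRD; rewrite ltrN10.
- move=> x; rewrite in_itv /= andbT => x0.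
  have H := is_derive_powRD (1 - a / 2) (lt_trans (ltrN10 R) x0).
  rewrite derive1E deriveN//.
  rewrite (@derive_val _ _ _ _ _ _ _ H) /hyperg -mulNr; congr (_ * _ `^ _); field.
Unshelve. all: by end_near.
Qed.

End hyper_g.

(** * Growth of [Psi] in the sum of squares and decay in the block size *)

Section Psi_bounds.
Variables (R : realType) (a : R).
Local Notation mu := (@lebesgue_measure R).
Hypotheses (a2 : 2 < a) (a4 : a <= 4).
Local Notation hgpdf := (hgpdf a).
Local Notation hgker := (hgker a).
Local Notation Psi := (Psi a).

Let pdf0 := hgpdf_ge0 a2.

Lemma hgker_ge0 q x g : 0 <= hgker q x g.
Proof. by rewrite !mulr_ge0 ?powR_ge0 ?expR_ge0 ?pdf0. Qed.

Lemma hgpdf_eq0 g : g <= 0 -> hgpdf g = 0.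
Proof. by rewrite /Submission.hgpdf leNgt; case: ltrP. Qed.

Lemma hgker_eq0 q x g : g <= 0 -> hgker q x g = 0.
Proof. by move=> g0; rewrite /Submission.hgker hgpdf_eq0// !mul0r. Qed.

Lemma ratio_bounds (g : R) : 0 < g -> 0 <= g / (1 + g) <= 1.
Proof.
move=> g0; have g1 : 0 < 1 + g by rewrite ltr_wpDl.
by rewrite divr_ge0 ?(ltW g0) ?(ltW g1)//= ler_pdivrMr// mul1r lerDr.
Qed.

Lemma powRN_half_le1 (q : nat) (g : R) : 0 < g -> (1 + g) `^ (- (q%:R / 2)) <= 1.
Proof.
move=> g0; rewrite powRN invf_le1 ?powR_gt0 ?ltr_wpDl//.
suff : 1 `^ (q%:R / 2) <= (1 + g) `^ (q%:R / 2) by rewrite powR1.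
apply: ge0_ler_powR; rewrite ?nnegrE ?addr_ge0// ?(ltW g0)//.
by rewrite lerDl ltW.
Qed.

Lemma hgker_le q x y g : x <= y -> hgker q x g <= hgker q y g.
Proof.
move=> xy; have [g0|g0] := lerP g 0; first by rewrite !hgker_eq0.
rewrite ler_wpM2l ?mulr_ge0 ?powR_ge0 ?pdf0// ler_expR ler_wpM2r//.
by have /andP[] := ratio_bounds g0.
Qed.

(** The ratio [g / (1 + g)] is at most 1. Together with [hgker_le] this says, after integration,
    that [ln Psi] is nondecreasing and 1-Lipschitz. *)
Lemma hgker_shift q x y g : x <= y -> hgker q y g <= expR (y - x) * hgker q x g.
Proof.
move=> xy; have [g0|g0] := lerP g 0; first by rewrite !hgker_eq0// mulr0.
rewrite mulrCA ler_wpM2l ?mulr_ge0 ?powR_ge0 ?pdf0// -expRD ler_expR.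
rewrite -lerBlDr -mulrBl ler_piMr ?subr_ge0//.
by have /andP[] := ratio_bounds g0.
Qed.

Lemma hgker0_le q g : hgker q 0 g <= hgpdf g.
Proof.
have [g0|g0] := lerP g 0; first by rewrite hgker_eq0// hgpdf_eq0.
by rewrite /Submission.hgker mul0r expR0 mulr1 ler_piMr ?pdf0 ?powRN_half_le1.
Qed.

Lemma integral_hgker_ub q x : 0 <= x ->
  (\int[mu]_g (hgker q x g)%:E <= (expR x)%:E)%E.
Proof.
move=> x0; rewrite -[leRHS]mule1 -(integral_hgpdf a2) -lower_integralZl ?expR_ge0//.
apply: lower_integral_le => g; first by rewrite lee_fin hgker_ge0.
rewrite -EFinM lee_fin (le_trans (hgker_shift q g x0))// subr0.
by rewrite ler_wpM2l ?expR_ge0 ?hgker0_le.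
Qed.

Lemma integral_hgker q x : 0 <= x ->
  (\int[mu]_g (hgker q x g)%:E = (Psi q x)%:E)%E.
Proof.
move=> x0; rewrite /Submission.Psi fineK// ge0_fin_numE.
  exact: le_lt_trans (integral_hgker_ub q x0) (ltry _).
by apply: integral_ge0 => g _; rewrite lee_fin hgker_ge0.
Qed.

Lemma Psi_ge0 q x : 0 <= Psi q x.
Proof. by rewrite fine_ge0// integral_ge0// => g _; rewrite lee_fin hgker_ge0. Qed.

Lemma Psi_le_expR q x : 0 <= x -> Psi q x <= expR x.
Proof. by move=> x0; rewrite -lee_fin -integral_hgker// integral_hgker_ub. Qed.

Lemma Psi_le q x y : 0 <= x -> x <= y -> Psi q x <= Psi q y.
Proof.
move=> x0 xy; rewrite -lee_fin -!integral_hgker ?(le_trans x0)//.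
by apply: lower_integral_le => g; rewrite lee_fin ?hgker_ge0 ?hgker_le.
Qed.

Lemma Psi_shift q x y : 0 <= x -> x <= y -> Psi q y <= expR (y - x) * Psi q x.
Proof.
move=> x0 xy; rewrite -lee_fin EFinM -!integral_hgker ?(le_trans x0)//.
rewrite -lower_integralZl ?expR_ge0//; last by move=> g; rewrite lee_fin hgker_ge0.
by apply: lower_integral_le => g; rewrite -?EFinM lee_fin ?hgker_ge0 ?hgker_shift.
Qed.

Lemma Psi_size_le q q' x : 0 <= x -> (q <= q')%N -> Psi q' x <= Psi q x.
Proof.
move=> x0 qq; rewrite -lee_fin -!integral_hgker//.
apply: lower_integral_le => g; rewrite lee_fin ?hgker_ge0//.
have [g0|g0] := lerP g 0; first by rewrite !hgker_eq0.
rewrite ler_wpM2r ?expR_ge0// ler_wpM2l ?pdf0//.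
have g1 : 0 < 1 + g by rewrite ltr_wpDl.
rewrite !powRN lef_pV2 ?posrE ?powR_gt0//; apply: ler_powR.
  by rewrite lerDl ltW.
by rewrite ler_wpM2r// ler_nat.
Qed.

Lemma Psi00 : Psi 0 0 = 1.
Proof.
apply: EFin_inj; rewrite -integral_hgker// -(integral_hgpdf a2).
apply: eq_integral => g _; rewrite /Submission.hgker mul0r oppr0 powRr0 mulr1.
by rewrite mul0r expR0 mulr1.
Qed.

Let unit_itv_lb q x (c r : R) : 0 <= x -> 0 <= c -> 0 < r ->
  (forall g, r <= g <= r + 1 -> c <= hgker q x g) -> c <= Psi q x.
Proof.
move=> x0 c0 r0 H; rewrite -lee_fin -integral_hgker//.
have -> : (c%:E = \int[mu]_g (c * \1_`[r, r + 1] g)%:E)%E.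
  under eq_integral do rewrite EFinM.
  rewrite lower_integralZl//.
  rewrite integral_indic//= setIT.
  by rewrite lebesgue_measure_itv /= lte_fin ltrDl ltr01 -EFinB addrAC subrr add0r mule1.
apply: lower_integral_le => g; rewrite lee_fin; first by rewrite mulr_ge0// indicE.
rewrite indicE; case: (boolP (g \in _)); last by rewrite mulr0 hgker_ge0.
by rewrite inE /= in_itv /= mulr1; exact: H.
Qed.

(* The mass of [hgker q x] near its mode, [g] of order [x], decays polynomially
   relative to [expR x]. *)
Lemma Psi_lb q x : 1 <= x ->
  expR (x - 1) * ((a - 2) / 2) * ((3 * x) ^+ (q + 2))^-1 <= Psi q x.
Proof.
move=> x1; have x0 : 0 < x by exact: lt_le_trans x1.
apply: (@unit_itv_lb _ _ _ x) => //; first exact: ltW.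
  by rewrite !mulr_ge0 ?expR_ge0 ?invr_ge0 ?exprn_ge0 ?mulr_ge0 ?subr_ge0// ltW.
move=> g /andP[xg gx]; have g0 : 0 < g by exact: lt_le_trans xg.
have g1 : 0 < 1 + g by rewrite ltr_wpDl.
rewrite /Submission.hgker /Submission.hgpdf g0 /hyperg [leRHS]mulrC -!mulrA ler_pM ?expR_ge0//.
- by rewrite !mulr_ge0 ?invr_ge0 ?exprn_ge0 ?mulr_ge0 ?subr_ge0// ltW.
- rewrite ler_expR; have -> : x * (g / (1 + g)) = x - x / (1 + g).
    by field; rewrite gt_eqF.
  by rewrite lerD2l lerN2 ler_pdivrMr// mul1r (le_trans xg)// lerDr.
rewrite ler_wpM2l ?subr_ge0 ?(ltW a2)// ler_wpM2l//.
rewrite -powRD; last by rewrite (gt_eqF g1) implybT.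
have -> : - a / 2 - q%:R / 2 = - ((a + q%:R) / 2) by field.
rewrite powRN lef_pV2 ?posrE ?powR_gt0 ?exprn_gt0 ?mulr_gt0//.
(* The exponent [(a + q) / 2] is at most [q + 2] because [a <= 4]; afterwards
   [1 + g <= 2 + x <= 3 x]. *)
apply: (@le_trans _ _ ((1 + g) `^ (q + 2)%:R)).
  apply: ler_powR; first by rewrite lerDl ltW.
  rewrite natrD ler_pdivrMr//.
  by have := ler0n R q; move: a4; lra.
rewrite powR_mulrn ?(ltW g1)// lerXn2r ?nnegrE ?(ltW g1) ?mulr_ge0 ?(ltW x0)//.
by move: gx x1; lra.
Qed.

Lemma Psi_gt0 q x : 0 <= x -> 0 < Psi q x.
Proof.
have pos y : 1 <= y -> 0 < Psi q y.
  move=> y1; apply: lt_le_trans (Psi_lb q y1).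
  by rewrite !mulr_gt0 ?expR_gt0 ?invr_gt0 ?exprn_gt0 ?mulr_gt0 ?subr_gt0// (lt_le_trans _ y1).
move=> x0; have [x1|x1] := lerP 1 x; first exact: pos.
rewrite -(pmulr_rgt0 _ (expR_gt0 (1 - x))).
exact: lt_le_trans (pos _ (lexx 1)) (Psi_shift q x0 (ltW x1)).
Qed.

(** Strictness serves the nondegeneracy of the limit law. The gain [c] is collected on
    [1 <= g <= 2], where [g / (1 + g)] is at least one half. *)
Lemma Psi_lt01 q : Psi q 0 < Psi q 1.
Proof.
pose c := hyperg a 2 * 3 `^ (- (q%:R / 2)) * (expR (2^-1) - 1).
have c0 : 0 < c.
  rewrite !mulr_gt0 ?powR_gt0 ?subr_gt0 ?ltr_wpDl ?invr_gt0//.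
  by rewrite expR_gt1 invr_gt0.
rewrite -lte_fin -!integral_hgker//.
apply: (@lt_le_trans _ _ (\int[mu]_g ((hgker q 0 g)%:E + (c * \1_`[1, 2] g)%:E))%E).
  rewrite lower_integralD//.
  - have -> : (\int[mu]_g (c * \1_`[1, 2] g)%:E = c%:E)%E.
      under eq_integral do rewrite EFinM.
      rewrite lower_integralZl ?(ltW c0)//.
      rewrite integral_indic//= setIT lebesgue_measure_itv /= lte_fin ltr1n.
      by rewrite -EFinB -EFinM; congr EFin; ring.
    by rewrite integral_hgker// -EFinD lte_fin ltrDl.
  - by move=> g; rewrite lee_fin hgker_ge0.
  - by move=> g; rewrite mulr_ge0 ?(ltW c0)// indicE.
  - by apply: measurable_funM => //; exact: measurable_indic.
apply: lower_integral_le => g.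
  by rewrite adde_ge0// lee_fin ?hgker_ge0// mulr_ge0 ?(ltW c0)// indicE.
rewrite -EFinD lee_fin indicE; case: (boolP (g \in _)); last first.
  by rewrite mulr0 addr0 hgker_le.
rewrite inE /= in_itv /= mulr1 => /andP[g1 g2].
have g0 : 0 < g by exact: lt_le_trans g1.
have pg : 0 < 1 + g by rewrite ltr_wpDl.
rewrite /Submission.hgker mul0r expR0 mulr1 mul1r -lerBrDl.
rewrite [leRHS](_ : _ = hgpdf g * (1 + g) `^ (- (q%:R / 2)) * (expR (g / (1 + g)) - 1)); last by ring.
rewrite /c.
have dec (r : R) : 0 <= r -> 3 `^ (- r) <= (1 + g) `^ (- r).
  move=> r0; rewrite !powRN lef_pV2 ?posrE ?powR_gt0//.
  apply: ge0_ler_powR; rewrite ?nnegrE ?(ltW pg)//.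
  by move: g2; lra.
have e1 : 1 <= expR (2^-1 : R) by rewrite ltW// expR_gt1 invr_gt0.
have h0 := hyperg_ge0 a2 2.
apply: ler_pM; [by apply: mulr_ge0; rewrite ?powR_ge0|by rewrite subr_ge0| |].
- apply: ler_pM; rewrite ?powR_ge0//; last by apply: dec; rewrite divr_ge0.
  rewrite /Submission.hgpdf g0 /hyperg (_ : 1 + 2 = 3 :> R); last by ring.
  rewrite ler_wpM2l ?divr_ge0 ?subr_ge0 ?(ltW a2)// mulNr.
  by rewrite dec// divr_ge0// (le_trans _ (ltW a2)).
rewrite lerD2r ler_expR ler_pdivlMr// ler_pdivrMl//.
by move: g1; lra.
Qed.

(** Where [1 + g >= (2 / e)^2], an additional predictor contributes a factor
    [(1 + g)^(-1/2) <= e / 2]. Elsewhere [g / (1 + g)] stays below [1 - et], so the kernel is at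
    most [exp(x (1 - et))] times the density, which is exponentially small relative to [Psi_lb]. *)
Lemma Psi_size_small q q' e : (q < q')%N -> 0 < e ->
  exists2 x0, 0 < x0 & forall x, x0 <= x -> Psi q' x <= e * Psi q x.
Proof.
move=> qq e0; pose et := (e / 2) ^+ 2.
have et0 : 0 < et by rewrite exprn_gt0// divr_gt0.
(* [K] gathers the constants of [Psi_lb], so that the choice of [x0] makes [exp(x (1 - et))] at most
   [e / 2] times that bound. *)
pose K := expR 1 * ((a - 2) / 2)^-1 * 3 ^+ (q + 2).
have [x0 x00 x0P] := poly_expRN_le (q + 2) K et0 (divr_gt0 e0 (ltr0n R 2)).
exists (1 + x0); first by rewrite addr_gt0.
move=> x xx; have x1 : 1 <= x by rewrite (le_trans _ xx)// lerDl ltW.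
have xp : 0 < x by exact: lt_le_trans x1.
have bd : Psi q' x <= e / 2 * Psi q x + expR (x * (1 - et)).
  rewrite -lee_fin EFinD EFinM -!integral_hgker ?(ltW xp)//.
  rewrite -lower_integralZl ?divr_ge0 ?(ltW e0)//; last by move=> g; rewrite lee_fin hgker_ge0.
  rewrite -[(expR _)%:E]mule1 -(integral_hgpdf a2) -lower_integralZl ?expR_ge0//.
  under [X in (_ + X)%E]eq_integral do rewrite -EFinM.
  rewrite -lower_integralD; last 3 first.
  - by move=> g; rewrite -EFinM lee_fin mulr_ge0 ?hgker_ge0 ?divr_ge0 ?(ltW e0).
  - by move=> g; rewrite mulr_ge0 ?expR_ge0.
  - by apply: measurable_funM => //; exact: measurable_hgpdf.
  apply: lower_integral_le => g; first by rewrite lee_fin hgker_ge0.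
  rewrite -EFinM -EFinD lee_fin.
  have [g0|g0] := lerP g 0; first by rewrite !hgker_eq0// hgpdf_eq0// !mulr0 addr0.
  have g1 : 0 < 1 + g by rewrite ltr_wpDl.
  have [get|get] := lerP ((1 + g)^-1) et.
    rewrite -[leLHS]addr0 lerD ?mulr_ge0 ?expR_ge0//.
    rewrite /Submission.hgker [leRHS]mulrA ler_wpM2r ?expR_ge0// [leRHS]mulrCA ler_wpM2l//.
    apply: (@le_trans _ _ ((1 + g) `^ (- (q.+1%:R / 2)))).
      rewrite !powRN lef_pV2 ?posrE ?powR_gt0//; apply: ler_powR.
        by rewrite lerDl ltW.
      by rewrite ler_wpM2r// ler_nat.
    have -> : - (q.+1%:R / 2) = - 2^-1 + - (q%:R / 2) :> R by rewrite -natr1; field.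
    rewrite powRD; last by rewrite (gt_eqF g1) implybT.
    rewrite ler_wpM2r ?powR_ge0// powRN powR12_sqrt ?(ltW g1)// -sqrtrV ?(ltW g1)//.
    have e2 : 0 <= e / 2 by rewrite divr_ge0// ltW.
    by rewrite -(ger0_norm e2) -sqrtr_sqr ler_sqrt// sqr_ge0.
  rewrite -[leLHS]add0r; apply: lerD.
    by apply: mulr_ge0; rewrite ?hgker_ge0// divr_ge0// ltW.
  rewrite [leRHS]mulrC /Submission.hgker; apply: ler_pM; rewrite ?expR_ge0 ?mulr_ge0 ?powR_ge0 ?pdf0//.
    by rewrite ler_piMr ?pdf0 ?powRN_half_le1.
  rewrite ler_expR ler_wpM2l ?(ltW xp)//.
  have -> : g / (1 + g) = 1 - (1 + g)^-1 by field; rewrite gt_eqF.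
  by rewrite lerD2l lerN2 ltW.
apply: (le_trans bd); rewrite [leRHS](_ : _ = e / 2 * Psi q x + e / 2 * Psi q x); last by field.
rewrite lerD2l; have c0 : 0 < (a - 2) / 2 by rewrite divr_gt0 ?subr_gt0.
have x3 : 0 < (3 * x) ^+ (q + 2) by rewrite exprn_gt0 ?mulr_gt0.
have e20 : 0 <= e / 2 by rewrite divr_ge0// ltW.
apply: le_trans (ler_wpM2l e20 (Psi_lb q x1)).
have xx0 : x0 <= x by rewrite (le_trans _ xx)// lerDr.
have B0 : 0 <= expR (x - 1) * ((a - 2) / 2) * ((3 * x) ^+ (q + 2))^-1.
  by rewrite !mulr_ge0 ?expR_ge0 ?invr_ge0 ?subr_ge0 ?(ltW a2)// ltW.
apply: le_trans (ler_wpM2r B0 (x0P x xx0)).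
have E1 : expR (x * (1 - et)) = expR x * expR (- (et * x)).
  by rewrite -expRD; congr expR; ring.
have E2 : expR (x - 1) = expR x / expR 1 by rewrite expRD expRN.
rewrite /K exprMn E1 E2.
have E3 : (3 : R) ^+ (q + 2) != 0 by rewrite expf_neq0.
have Ex : x ^+ (q + 2) != 0 by rewrite expf_neq0// gt_eqF.
rewrite le_eqVlt; apply/orP; left; apply/eqP.
field.
by rewrite Ex E3 subr_eq0 !gt_eqF ?expR_gt0.
Qed.

End Psi_bounds.

Lemma powR_prod (R : realType) (I : finType) (A : I -> R) (Q : pred I) (r : R) : (forall i, 0 <= A i) ->
  (\prod_(i | Q i) A i) `^ r = \prod_(i | Q i) A i `^ r.
Proof.
move=> A0; elim: (index_enum I) => [|i l IH]; first by rewrite !big_nil powR1.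
by rewrite !big_cons; case: ifP => // _; rewrite powRM ?IH// prodr_ge0.
Qed.

(** * The marginal likelihood as an integral over the variance *)

Section marginal_likelihood.
Variables (R : realType) (n p k : nat) (blk : 'I_p -> 'I_k) (a : R).
Variable (X : 'M[R]_(n, p)) (G : {set 'I_p}) (y : 'cV[R]_n).
Local Notation mu := (@lebesgue_measure R).
Local Notation one := (const_mx 1 : 'cV[R]_n).
Hypotheses (a2 : 2 < a) (n0 : (0 < n)%N).
Hypothesis cX : forall j : 'I_p, \sum_i X i j = 0.
Hypothesis oX : forall j l : 'I_p, blk j != blk l -> \sum_i X i j * X i l = 0.
Hypothesis uG : gram X G \in unitmx.

Definition ctot : R := dot y y - dot one y ^+ 2 / n%:R.

Definition Qblk b : R := dot y (blockproj blk X G (fun c => (c == b)%:R) *m y).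

(** The power [(m + 1) / 2] of [1 / s] combines the prior [1 / s], the likelihood [s^(- m / 2)] and
    a factor [s^(1 / 2)] from the integration over the intercept. *)
Definition invgammaker (m : nat) (S s : R) : R :=
  if 0 < s then expR (- (m.+1%:R / 2) * ln s - S / (2 * s)) else 0.

(** Common to all models, hence it cancels in Bayes factors; the last two factors come from the
    integration over the intercept. *)
Definition margc : R :=
  (2 * pi) `^ (- (n%:R / 2)) * (2 * pi) `^ (1 / 2) * n%:R `^ (- 1 / 2).

Lemma Xsub_one : (Xsub X G)^T *m one = 0.
Proof.
apply/colP => j; rewrite !mxE -[RHS](cX (enum_val j)).
by apply: eq_bigr => i _; rewrite !mxE mulr1.
Qed.

Lemma blockproj_one f : blockproj blk X G f *m one = 0.
Proof. by rewrite /blockproj -mulmxA Xsub_one mulmx0. Qed.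

Lemma dot_one : dot one one = n%:R.
Proof. by rewrite dotE (eq_bigr (fun=> 1)) ?sumr_const ?card_ord// => i _; rewrite !mxE mulr1. Qed.

Lemma dot_center (al : R) : dot (y - al *: one) (y - al *: one) =
  ctot + n%:R * (al - dot one y / n%:R) ^+ 2.
Proof.
rewrite !(dotDl, dotDr, dotNl, dotNr, dotZl, dotZr) dot_one (dotC y one) /ctot.
by field; rewrite pnatr_eq0 -lt0n.
Qed.

Lemma Qblk_ge0 b : 0 <= Qblk b.
Proof.
rewrite /Qblk.
have -> : blockproj blk X G (fun c => (c == b)%:R) =
    blockproj blk X G (fun c => (c == b)%:R) *m blockproj blk X G (fun c => (c == b)%:R).
  by rewrite blockprojM//; congr blockproj; apply/funext => c /=; case: eqP; rewrite ?mulr1 ?mulr0.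
by rewrite -mulmxA dotMr blockproj_tr// dot_ge0.
Qed.

Lemma blockproj_Qblk (f : 'I_k -> R) :
  dot y (blockproj blk X G f *m y) = \sum_b f b * Qblk b.
Proof.
have -> : f = fun c => \sum_b f b * (c == b)%:R.
  apply/funext => c; rewrite (bigD1 c)//= eqxx mulr1 big1 ?addr0// => b /negPf bc.
  by rewrite eq_sym bc mulr0.
rewrite blockproj_sum mulmx_suml dot_sumr; apply: eq_bigr => b _.
rewrite -scalemxAl dotZr; congr (_ * _).
rewrite (bigD1 b)//= eqxx mulr1 big1 ?addr0// => c /negPf bc.
by rewrite eq_sym bc mulr0.
Qed.

Lemma AcovE (g : 'cV[R]_k) : (forall b, 0 < g b 0) ->
  Acov blk X G g = invmx (blockdiag blk G (fun b => (g b 0)^-1) *m gram X G).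
Proof.
move=> g0; rewrite /Acov; congr invmx; apply/matrixP => j l.
rewrite mul_diag_mx !mxE; case: eqP => [_|/eqP jl].
  by rewrite mulrC; congr (_ * _); rewrite mxE.
rewrite (_ : \sum__ _ = 0) ?mulr0// -[RHS](oX jl).
by apply: eq_bigr => i _; rewrite !mxE.
Qed.

(** Up to the factor [1 / s], the prior precision [L] and the Gram matrix [K] add up to the
    posterior precision [M], whose blocks are [(1 + g_b) / g_b] times those of [K]. The determinants
    of [M] and [L] have as ratio the product of the [(1 + g_b)^(q_b)], and the value at the
    posterior mode shrinks each [Qblk b] by [g_b / (1 + g_b)]. *)
Lemma beta_integral (s al C : R) (g : 'cV[R]_k) : 0 < s -> 0 <= C -> (forall b, 0 < g b 0) ->
  iint (fun b : 'cV[R]_#|G| => (C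
      * mvn_pdf (al *: const_mx 1 + Xsub X G *m b) (s *: 1%:M) y
      * mvn_pdf 0 (s *: Acov blk X G g) b)%:E) =
  (C * ((2 * pi) `^ (- (n%:R / 2)) * (s ^+ n) `^ (- 1 / 2) *
   expR (- (dot (y - al *: one) (y - al *: one) / (2 * s)))) *
   \prod_b ((1 + g b 0) `^ (- ((blocksize blk G b)%:R / 2)) *
     expR (Qblk b / (2 * s) * (g b 0 / (1 + g b 0)))))%:E.
Proof.
move=> s0 C0 g0.
pose ginv b := (g b 0)^-1; pose L := blockdiag blk G ginv *m gram X G.
have pL : pd L by apply: pd_blockdiag_gram => // b; rewrite invr_gt0.
pose K := gram X G; pose v := (Xsub X G)^T *m y.
pose h b := g b 0 / (1 + g b 0).
have h0 b : 0 < h b by rewrite divr_gt0 ?addr_gt0.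
pose M := blockdiag blk G (fun b => (h b)^-1) *m K.
have pM : pd M by apply: pd_blockdiag_gram => // b; rewrite invr_gt0.
have ME : M = L + K.
  rewrite /M /L -[X in _ + X]mul1mx -(blockdiag1 R blk G) -mulmxDl; congr (_ *m _).
  apply/matrixP => i j; rewrite !mxE -mulrnDl; congr (_ *+ _).
  by rewrite /h /ginv; field; rewrite !gt_eqF// addr_gt0.
pose sM := s^-1 *: M.
have psM : pd sM.
  split; first by rewrite /sM linearZ /= pM.1.
  by move=> x x0; rewrite -scalemxAl dotZr mulr_gt0 ?invr_gt0// pM.2.
have uL := pd_unit pL.
have detL : 0 < \det L := pd_det_gt0 pL.
have pdf2 b : mvn_pdf 0 (s *: Acov blk X G g) b =
    (2 * pi) `^ (- (#|G|%:R / 2)) * (s ^+ #|G| / \det L) `^ (- 1 / 2) *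
      expR (- (dot b (L *m b) / (2 * s))).
  rewrite /mvn_pdf mulNr AcovE// -/ginv -/L detZ det_inv subr0; congr (_ * _ * expR _).
  rewrite invmxZ; last by rewrite unitmxZ ?unitmx_inv// unitfE gt_eqF.
  have -> : invmx (invmx L) = L by exact: invmxK.
  rewrite -scalemxAr -scalemxAl mxE -mulmxA -/(dot _ _).
  by field; rewrite gt_eqF.
pose z := invmx K *m (blockdiag blk G h *m v).
have sMz : sM *m z = s^-1 *: v.
  rewrite /sM /z -scalemxAl /M -(mulmxA _ K) mulKVmx// mulmxA blockdiagM.
  rewrite (_ : blockdiag _ _ _ = 1%:M) ?mul1mx// -(blockdiag1 R blk G).
  by apply: eq_blockdiag => b /=; rewrite mulVf// gt_eqF.
pose c1 := C * ((2 * pi) `^ (- (n%:R / 2)) * (s ^+ n) `^ (- 1 / 2) *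
   expR (- (dot (y - al *: one) (y - al *: one) / (2 * s)))) *
   ((2 * pi) `^ (- (#|G|%:R / 2)) * (s ^+ #|G| / \det L) `^ (- 1 / 2)).
have c10 : 0 <= c1 by rewrite !mulr_ge0 ?powR_ge0 ?expR_ge0.
transitivity (iint (fun b => c1%:E * (expR (gexp sM (s^-1 *: v) b))%:E)%E).
  apply: eq_iint => b; rewrite -EFinM; congr EFin.
  rewrite mvn_pdf_scalarE// pdf2 /c1.
  have E (x1 x2 x3 x4 x5 e1 e2 e3 e4 : R) : e1 * e2 = e3 * e4 ->
      x1 * (x2 * x3 * e1) * (x4 * x5 * e2) = x1 * (x2 * x3 * e3) * (x4 * x5) * e4.
    move=> e12; transitivity (x1 * x2 * x3 * x4 * x5 * (e1 * e2)); first by ring.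
    by rewrite e12; ring.
  apply: E; rewrite -!expRD; congr expR.
  rewrite opprD addrA; set u := y - al *: one.
  have uv : (Xsub X G)^T *m u = v.
    by rewrite /u mulmxBr -scalemxAr Xsub_one scaler0 subr0.
  clearbody u.
  rewrite /gexp /sM ME -!scalemxAl !dotZr dotZl mulmxDl.
  rewrite !(dotDl, dotDr, dotNl, dotNr) /K dot_gram (dotC _ u).
  have -> : dot u (Xsub X G *m b) = dot v b.
    by rewrite dotMr uv.
  by field; rewrite gt_eqF.
rewrite iintZl// (iint_gauss psM sMz) -EFinM; congr EFin.
have -> : 2^-1 * dot (s^-1 *: v) z = \sum_b Qblk b / (2 * s) * h b.
  have -> : dot (s^-1 *: v) z = s^-1 * dot y (blockproj blk X G h *m y).
    rewrite dotZl; congr (_ * _).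
    by rewrite /z /v dotMl trmxK /blockproj !mulmxA.
  rewrite blockproj_Qblk !mulr_sumr; apply: eq_bigr => b _.
  by field; rewrite gt_eqF.
rewrite big_split /= -expR_sum.
have -> : \prod_b (1 + g b 0) `^ (- ((blocksize blk G b)%:R / 2)) =
    (s ^+ #|G| / \det L) `^ (- 1 / 2) * (\det sM) `^ (- 1 / 2).
  have dM : 0 < \det M := pd_det_gt0 pM.
  rewrite -powRM ?divr_ge0 ?exprn_ge0 ?(ltW s0) ?(ltW detL)//; last first.
    by rewrite ltW// pd_det_gt0.
  have -> : s ^+ #|G| / \det L * \det sM = \prod_b (1 + g b 0) ^+ blocksize blk G b.
    have dK : 0 < \det K := pd_det_gt0 (gram_pd uG).
    rewrite /sM detZ /L /M !det_mulmx !det_blockdiag.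
    have -> : \prod_b (h b)^-1 ^+ blocksize blk G b =
        \prod_b ginv b ^+ blocksize blk G b * \prod_b (1 + g b 0) ^+ blocksize blk G b.
      rewrite -big_split /=; apply: eq_bigr => b _; rewrite -exprMn; congr (_ ^+ _).
      by rewrite /h /ginv; field; rewrite !gt_eqF// addr_gt0.
    have pg : \prod_b ginv b ^+ blocksize blk G b != 0.
      by rewrite gt_eqF// prodr_gt0// => b _; rewrite exprn_gt0// invr_gt0.
    rewrite exprVn; field.
    by rewrite pg !gt_eqF// exprn_gt0.
  rewrite powR_prod; last by move=> b; rewrite exprn_ge0// addr_ge0// ltW.
  apply: eq_bigr => b _; rewrite -powR_mulrn ?addr_ge0 ?(ltW (g0 b))// -powRrM.
  by congr (_ `^ _); ring.
rewrite /c1 (powRN (2 * pi) (#|G|%:R / 2)).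
have p0 : (2 * pi) `^ (#|G|%:R / 2) != 0 :> R.
  by rewrite gt_eqF// powR_gt0// mulr_gt0 ?pi_gt0.
by field.
Qed.

Lemma iint_zero m : iint (fun _ : 'cV[R]_m => 0%E) = 0%E :> \bar R.
Proof. by elim: m => //= m ->; exact: integral0. Qed.

(** Given the variance and the intercept, the integrand factors over the blocks, which turns the
    iterated integral over [g] into a product of values of [Psi]. *)
Lemma g_integral (s al : R) : 0 < s ->
  iint (fun g : 'cV[R]_k => iint (fun b : 'cV[R]_#|G| =>
    (if (0 < s) && [forall i, 0 < g i 0] then
       s^-1 * (\prod_i hyperg a (g i 0))
       * mvn_pdf (al *: const_mx 1 + Xsub X G *m b) (s *: 1%:M) y
       * mvn_pdf 0 (s *: Acov blk X G g) b
     else 0)%:E)) =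
  (s^-1 * ((2 * pi) `^ (- (n%:R / 2)) * (s ^+ n) `^ (- 1 / 2) *
     expR (- (dot (y - al *: one) (y - al *: one) / (2 * s)))) *
   \prod_b Psi a (blocksize blk G b) (Qblk b / (2 * s)))%:E.
Proof.
move=> s0; rewrite s0 /=.
set c := s^-1 * (_ * _).
have c0 : 0 <= c by rewrite !mulr_ge0 ?invr_ge0 ?powR_ge0 ?expR_ge0// ltW.
pose h b := hgker a (blocksize blk G b) (Qblk b / (2 * s)).
have Qs b : 0 <= Qblk b / (2 * s) by rewrite divr_ge0 ?Qblk_ge0// mulr_ge0// ltW.
transitivity (iint (fun g : 'cV[R]_k => c%:E * (\prod_b h b (g b 0))%:E))%E.
  apply: eq_iint => g; case: forallP => [g0|/forallP]; last first.
    rewrite negb_forall => /existsP[b]; rewrite -leNgt => gb0.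
    rewrite iint_zero (bigD1 b)//= /h hgker_eq0// mul0r.
    by rewrite mule0.
  have H0 : 0 <= s^-1 * \prod_i hyperg a (g i 0).
    by rewrite mulr_ge0 ?invr_ge0 ?(ltW s0)// prodr_ge0// => i _; exact: hyperg_ge0.
  rewrite beta_integral// -EFinM; congr EFin.
  rewrite (_ : \prod_b h b (g b 0) = (\prod_b hyperg a (g b 0)) *
      \prod_b ((1 + g b 0) `^ (- ((blocksize blk G b)%:R / 2)) *
      expR (Qblk b / (2 * s) * (g b 0 / (1 + g b 0))))); last first.
    rewrite -big_split /=; apply: eq_bigr => b _.
    by rewrite /h /hgker /hgpdf g0 [RHS]mulrA.
  by rewrite /c; ring.
rewrite iintZl//; last first.
  by move=> g; rewrite lee_fin prodr_ge0// => b _; exact: hgker_ge0.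
rewrite (@iint_prod _ _ h (fun b => Psi a (blocksize blk G b) (Qblk b / (2 * s))))//.
- by move=> b x; exact: hgker_ge0.
- by move=> b; exact: integral_hgker.
Qed.

Lemma invgammaker_ge0 m S s : 0 <= invgammaker m S s.
Proof. by rewrite /invgammaker; case: ifP => // _; exact: expR_ge0. Qed.

(** What remains is the integral over the intercept, Gaussian around the mean of [y] with precision
    [n / s]. *)
Lemma margE : marg blk a X G y = (\int[mu]_s
  (margc * (invgammaker n ctot s *
    \prod_b Psi a (blocksize blk G b) (Qblk b / (2 * s))))%:E)%E.
Proof.
apply: eq_integral => s _; rewrite /invgammaker; case: ifPn => [s0|s0]; last first.
  rewrite mul0r mulr0; apply: integral0_eq => al _.
  by rewrite (eq_iint (g := fun=> 0%E)) ?iint_zero// => g; exact: iint_zero.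
set P := \prod_b _.
have P0 : 0 <= P by rewrite prodr_ge0// => b _; exact: Psi_ge0.
have nR0 : 0 < n%:R :> R by rewrite ltr0n.
pose c := s^-1 * ((2 * pi) `^ (- (n%:R / 2)) * (s ^+ n) `^ (- 1 / 2)) * P.
have c0 : 0 <= c by rewrite !mulr_ge0 ?invr_ge0 ?powR_ge0// ltW.
transitivity (\int[mu]_al (c%:E * (expR (- (ctot / (2 * s)) -
   2^-1 * (n%:R / s) * (al - dot one y / n%:R) ^+ 2))%:E))%E.
  apply: eq_integral => al _; have := g_integral al s0; rewrite s0 /= => ->.
  rewrite -EFinM; congr EFin; rewrite dot_center -/P /c.
  rewrite [X in expR X](_ : _ = - (ctot / (2 * s)) -
     2^-1 * (n%:R / s) * (al - dot one y / n%:R) ^+ 2); last by field; rewrite !gt_eqF.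
  by ring.
rewrite lower_integralZl// integral_gauss1 ?divr_gt0// -EFinM; congr EFin.
have -> : expR (- (n.+1%:R / 2) * ln s - ctot / (2 * s)) =
    s^-1 * (s ^+ n) `^ (- 1 / 2) * s^-1 `^ (- 1 / 2) * expR (- (ctot / (2 * s))).
  rewrite expRD; congr (_ * _).
  rewrite -powR_mulrn ?(ltW s0)// -(powR_inv1 (ltW s0)) -!powRrM.
  rewrite /powR gt_eqF// -!expRD; congr expR; rewrite -natr1.
  by field.
have -> : (n%:R / s) `^ (- 1 / 2) = n%:R `^ (- 1 / 2) * s^-1 `^ (- 1 / 2) :> R.
  by rewrite powRM ?invr_ge0 ?(ltW s0).
by rewrite /margc /c; ring.
Qed.

End marginal_likelihood.

(** * Laplace estimates for the inverse-gamma kernel *)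

Section laplace.
Variables (R : realType) (a : R).
Local Notation mu := (@lebesgue_measure R).
Hypotheses (a2 : 2 < a) (a4 : a <= 4).

Let h4 : R -> R := hgpdf 4.
Let lt24 : 2 < 4 :> R. Proof. by rewrite ltr_nat. Qed.

Lemma ln_le_tangent (x y : R) : 0 < x -> 0 < y -> ln x <= ln y + (x - y) / y.
Proof.
move=> x0 y0; rewrite -lerBlDl -ln_div ?posrE//.
have xy : -1 < x / y - 1 by rewrite ltrBrDl subrr divr_gt0.
have := le_ln1Dx xy; rewrite addrCA subrr addr0 => /le_trans; apply.
by rewrite mulrBl divff// gt_eqF.
Qed.

Lemma invgamma_exponent_max (t s : R) : 0 < t -> 0 < s ->
  - ln s - t / s <= - (ln t + 1).
Proof.
move=> t0 s0; have := ln_le_tangent t0 s0.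
rewrite mulrBl divff ?gt_eqF// => H; rewrite opprD lerBlDl addrCA -lerBlDl.
by move: H; lra.
Qed.

Let ln_lt_sub1 (x : R) : 0 < x -> x != 1 -> 0 < x - 1 - ln x.
Proof.
move=> x0 x1; have := @expR_gt1Dx _ (ln x); rewrite lnK ?posrE// => H.
rewrite subr_gt0 ltrBrDl; apply: H; rewrite ln_eq0//.
Qed.

(** With [x = tau / s] the exponent is [ln x - k x - ln tau], maximal for [k = 1] at [x = 1]. The
    factor [k] slightly below 1 allows for a residual sum of squares a little smaller than
    [n tau]. *)
Lemma invgamma_exponent_away (tau dl : R) : 0 < tau -> 0 < dl -> dl < tau ->
  exists e k0 : R, [/\ 0 < e, 2^-1 <= k0, k0 < 1 &
    forall k s, k0 <= k -> k <= 1 -> 0 < s -> dl <= `|s - tau| ->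
    - ln s - k * tau / s <= - (ln tau + 1 + e)].
Proof.
move=> tau0 dl0 dltau.
pose x1 := tau / (tau + dl); pose x2 := tau / (tau - dl).
have td : 0 < tau - dl by rewrite subr_gt0.
have td' : 0 < tau + dl by rewrite addr_gt0.
have x10 : 0 < x1 by rewrite divr_gt0.
have x1lt : x1 < 1 by rewrite ltr_pdivrMr// mul1r ltrDl.
have x2gt : 1 < x2 by rewrite ltr_pdivlMr// mul1r ltrBlDr ltrDl.
have x20 : 0 < x2 by exact: lt_trans x2gt.
have e1 := ln_lt_sub1 x10 (negbT (lt_eqF x1lt)).
have e2 := ln_lt_sub1 x20 (negbT (gt_eqF x2gt)).
(* Half of the smaller gap at the two ends of the window; the other half pays for [k < 1]. *)
pose e := Num.min (x1 - 1 - ln x1) (x2 - 1 - ln x2) / 2.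
have e0 : 0 < e by rewrite divr_gt0// lt_min e1 e2.
have ee1 : e <= (x1 - 1 - ln x1) / 2 by rewrite ler_wpM2r// ge_min lexx.
have ee2 : e <= (x2 - 1 - ln x2) / 2 by rewrite ler_wpM2r// ge_min lexx orbT.
(* [x2^-1 <= k] makes [ln x - k x] nonincreasing beyond [x2], and [1 - e / x2 <= k] bounds the loss
   [(1 - k) x2] by [e]. *)
exists e, (Num.max 2^-1 (Num.max x2^-1 (1 - e / x2))); split => //.
- by rewrite le_max lexx.
- rewrite !gt_max; apply/and3P; split; first by rewrite invf_lt1// ltr1n.
    by rewrite invf_lt1.
  by rewrite ltrBlDr ltrDl divr_gt0.
move=> k s; rewrite !ge_max => /and3P[_ k1 k2] kle1 s0 dls.
pose x := tau / s; have x0 : 0 < x by rewrite divr_gt0.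
have k2' : (1 - k) * x2 <= e.
  by move: k2; rewrite lerBlDr -lerBlDl ler_pdivlMr.
suff : ln x - k * x <= - 1 - e.
  rewrite /x ln_div ?posrE//; rewrite -(mulrA k) => H; rewrite !opprD.
  by move: H; lra.
have [st|st] := lerP tau s.
  have xx1 : x <= x1.
    rewrite ler_pM2l// lef_pV2 ?posrE//.
    by move: dls; rewrite ger0_norm ?subr_ge0// lerBrDl.
  have := ln_le_tangent x0 x10; have : (x - x1) * (x1^-1 - k) <= 0.
    rewrite mulr_le0_ge0 ?subr_le0// subr_ge0 (le_trans kle1)//.
    by rewrite invf_ge1// ltW.
  have : (1 - k) * x1 <= e.
    apply: le_trans k2'; rewrite ler_wpM2l ?subr_ge0// (le_trans (ltW x1lt))//.
    exact: ltW.
  have : x1 * x1^-1 = 1 by rewrite divff// gt_eqF.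
  move: ee1; nra.
have xx2 : x2 <= x.
  rewrite ler_pM2l// lef_pV2 ?posrE//.
  by move: dls; rewrite ltr0_norm ?subr_lt0// opprB; lra.
have := ln_le_tangent x0 x20; have : (x - x2) * (x2^-1 - k) <= 0.
  by rewrite mulr_ge0_le0 ?subr_ge0// subr_le0.
have : x2 * x2^-1 = 1 by rewrite divff// gt_eqF.
move: ee2; nra.
Qed.

(** Of the [n + 1] half powers of [1 / s] four are kept back: the other [n - 3] give the uniform
    factor through [v], and [s^(-2) exp(- c / s)] is at most a multiple of the density [h4]. *)
Lemma invgammaker_ub (tau : R) : 0 < tau -> exists2 C, 0 < C &
  forall n k S s v, (4 <= n)%N -> 2^-1 <= k -> n%:R * (k * tau) <= S -> 0 < s ->
  - ln s - k * tau / s <= - v ->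
  invgammaker n S s <= C * expR (- ((n%:R - 3) / 2 * v)) * h4 s.
Proof.
(* Keeping back 3 of the [n] units of [k tau] leaves [3 k tau / 2 >= c], as [k >= 1 / 2]. *)
move=> tau0; pose c := 3 * tau / 4; have c0 : 0 < c by rewrite divr_gt0 ?mulr_gt0.
have c2 : 0 < 2 / c by rewrite divr_gt0.
pose C1 := 1 + 2 / c; have C10 : 0 < C1 by rewrite addr_gt0.
exists (C1 ^+ 2); first by rewrite exprn_gt0.
move=> n k S s v n4 k2 nS s0 sv; rewrite /invgammaker s0.
have h4E : h4 s = (1 + s) ^- 2.
  rewrite /h4 /hgpdf s0 /hyperg (_ : (4 - 2) / 2 = 1 :> R); last by field.
  rewrite (_ : - 4 / 2 = - 2%:R :> R); last by field.
  by rewrite mul1r powRN powR_mulrn// addr_ge0// ltW.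
have n3 : 0 <= (n%:R - 3) / 2 :> R by rewrite divr_ge0// subr_ge0 ler_nat ltnW.
have ks : 0 < k by exact: lt_le_trans k2.
apply: (@le_trans _ _ (expR ((n%:R - 3) / 2 * (- ln s - k * tau / s)) *
   expR (- 2 * ln s - c / s))).
  rewrite -expRD ler_expR -natr1.
  have H : n%:R * (k * tau) / (2 * s) <= S / (2 * s).
    by rewrite ler_wpM2r// invr_ge0 mulr_ge0// ltW.
  have H2 : 3 / 2 * (k * tau) / s >= c / s.
    rewrite ler_wpM2r ?invr_ge0 ?(ltW s0)// /c.
    have : 2^-1 * tau <= k * tau by rewrite ler_wpM2r// ltW.
    by lra.
  rewrite [leLHS](_ : _ = - ((n%:R + 1) / 2 * ln s) - S / (2 * s)); last by ring.
  have -> : (n%:R - 3) / 2 * (- ln s - k * tau / s) + (- 2 * ln s - c / s) =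
     - ((n%:R + 1) / 2 * ln s) - n%:R * (k * tau) / (2 * s) + (3 / 2 * (k * tau) / s - c / s).
    by field; rewrite gt_eqF.
  by move: H H2; lra.
rewrite [leRHS](_ : _ = expR (- ((n%:R - 3) / 2 * v)) * (C1 ^+ 2 * h4 s)); last by ring.
apply: ler_pM; rewrite ?expR_ge0//.
  rewrite ler_expR [leRHS](_ : _ = (n%:R - 3) / 2 * - v); last by ring.
  exact: ler_wpM2l.
rewrite h4E ler_pdivlMr ?exprn_gt0 ?addr_gt0//.
have -> : expR (- 2 * ln s - c / s) = (s ^+ 2)^-1 * expR (- (c / s)).
  rewrite expRD; congr (_ * _); have -> : - 2 * ln s = - (2%:R * ln s) by ring.
  by rewrite expRN expRM_natl lnK ?posrE.
rewrite expRN -invfM ler_pdivrMl ?mulr_gt0 ?exprn_gt0 ?expR_gt0//.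
have -> : expR (c / s) = expR (c / (2 * s)) ^+ 2.
  by rewrite -expRM_natr; congr expR; field; rewrite gt_eqF.
have C1ge := ltW C10; have s0' := ltW s0.
have A0 : 0 <= 1 + s by exact: addr_ge0.
have B0 : 0 <= s * expR (c / (2 * s)) * C1.
  by apply: mulr_ge0 => //; rewrite mulr_ge0 ?expR_ge0.
rewrite -!exprMn lerXn2r ?nnegrE//.
apply: (@le_trans _ _ (s * (1 + c / (2 * s)) * C1)).
  have -> : s * (1 + c / (2 * s)) * C1 = s + c / 2 + 2 * s / c + 1.
    by rewrite /C1; field; rewrite !gt_eqF.
  have : 0 <= c / 2 by rewrite divr_ge0// ltW.
  have : 0 <= 2 * s / c by rewrite !mulr_ge0 ?invr_ge0 ?(ltW c0) ?(ltW s0).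
  by lra.
by rewrite ler_wpM2r ?(ltW C10)// ler_wpM2l ?(ltW s0)// expR_ge1Dx.
Qed.

End laplace.

(** * Two-sided bounds for the integrand of a marginal likelihood *)

Section model_integrals.
Variables (R : realType) (a : R) (k : nat).
Local Notation mu := (@lebesgue_measure R).
Hypotheses (a2 : 2 < a) (a4 : a <= 4).
Implicit Types (q : 'I_k -> nat) (Q : 'I_k -> R).

Let lt24 : 2 < 4 :> R. Proof. by rewrite ltr_nat. Qed.

Definition modelker n tot q Q s : R :=
  invgammaker n tot s * \prod_b Psi a (q b) (Q b / (2 * s)).

Lemma modelker_ge0 n tot q Q s : 0 <= modelker n tot q Q s.
Proof.
by rewrite mulr_ge0 ?invgammaker_ge0// prodr_ge0// => b _; exact: Psi_ge0.
Qed.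

Lemma invgammaker_le0 n S (s : R) : s <= 0 -> invgammaker n S s = 0.
Proof. by rewrite /invgammaker leNgt; case: ltrP. Qed.

Lemma modelker_le0 n tot q Q s : s <= 0 -> modelker n tot q Q s = 0.
Proof. by move=> s0; rewrite /modelker invgammaker_le0// mul0r. Qed.

Lemma invgammaker_shift n S T (s : R) : 0 < s ->
  invgammaker n (S - T) s = invgammaker n S s * expR (T / (2 * s)).
Proof.
move=> s0; rewrite /invgammaker s0 -expRD; congr expR.
by field; rewrite gt_eqF.
Qed.

(** Replacing each [Psi] by [exp] moves the [Q b] into the inverse-gamma kernel, which becomes that
    of the residual sum of squares. *)
Lemma modelker_ub n tot q Q s : (forall b, 0 <= Q b) ->
  modelker n tot q Q s <= invgammaker n (tot - \sum_b Q b) s.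
Proof.
move=> Q0; have [s0|s0] := lerP s 0; first by rewrite modelker_le0 ?invgammaker_ge0.
rewrite invgammaker_shift// ler_wpM2l ?invgammaker_ge0//.
rewrite mulr_suml expR_sum; apply: ler_prod => b _.
by rewrite Psi_ge0//= Psi_le_expR// divr_ge0// mulr_ge0// ltW.
Qed.

(** A converse of [Psi_le_expR] up to a power of [n], uniform for [x] of order [n]. As [Psi_lb] asks
    for an argument at least 1, it is applied at [X], the top of the range plus one, and carried
    down to [x] by [Psi_shift]. *)
Lemma Psi_poly_lb (tau C0 : R) (p : nat) : 0 < tau -> 0 < C0 ->
  exists2 c, 0 < c & forall n (q0 : nat) x, (1 <= n)%N -> (q0 <= p)%N -> 0 <= x ->
  x <= C0 * n%:R / (2 * tau) -> expR x * (c / n%:R ^+ (p + 2)) <= Psi a q0 x.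
Proof.
move=> tau0 C00; pose C3 := 3 * (C0 / (2 * tau) + 1).
have Ct0 : 0 <= C0 / (2 * tau) by rewrite divr_ge0 ?mulr_ge0// ltW.
have C31 : 1 <= C3 by rewrite /C3; move: Ct0; lra.
have C30 : 0 < C3 by exact: lt_le_trans C31.
exists (expR (-1) * ((a - 2) / 2) * (C3 ^+ (p + 2))^-1).
  by rewrite !mulr_gt0 ?expR_gt0 ?invr_gt0 ?exprn_gt0 ?subr_gt0.
move=> n q x n1 qp x0 xC.
have nR : 1 <= n%:R :> R by rewrite ler1n.
have nR0 : 0 < n%:R :> R by exact: lt_le_trans nR.
pose X := C0 * n%:R / (2 * tau) + 1.
have X1 : 1 <= X by rewrite lerDr !mulr_ge0 ?invr_ge0 ?mulr_ge0 ?(ltW tau0) ?(ltW C00).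
have xX : x <= X by rewrite (le_trans xC)// lerDl.
have := Psi_shift a2 q x0 xX; have := Psi_lb a2 a4 q X1 => lb sh.
rewrite -(ler_pM2l (expR_gt0 (X - x))); apply: (le_trans _ (le_trans lb sh)).
rewrite [leLHS]mulrA -expRD subrK.
have XC3 : 3 * X <= C3 * n%:R.
  have -> : C3 * n%:R = 3 * (C0 * n%:R / (2 * tau) + n%:R) by rewrite /C3; field; rewrite gt_eqF.
  by rewrite ler_wpM2l// lerD2l.
have X30 : 0 < 3 * X by rewrite mulr_gt0// (lt_le_trans _ X1).
have X31 : 1 <= 3 * X by move: X1; lra.
rewrite [leLHS](_ : _ = expR (X - 1) * ((a - 2) / 2) * ((C3 * n%:R) ^+ (p + 2))^-1); last first.
  have -> : expR X = expR (X - 1) * expR 1 by rewrite -expRD subrK.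
  have P3 : 0 < C3 ^+ (p + 2) by rewrite exprn_gt0.
  have Pn : 0 < n%:R ^+ (p + 2) :> R by rewrite exprn_gt0.
  rewrite expRN [(C3 * _) ^+ _]exprMn; move: P3 Pn; move: (C3 ^+ _) (n%:R ^+ _) => P3 Pn P30 Pn0.
  by field; rewrite !gt_eqF ?expR_gt0.
rewrite ler_wpM2l ?mulr_ge0 ?expR_ge0 ?subr_ge0 ?(ltW a2)//.
have Cn0 : 0 < C3 * n%:R by rewrite mulr_gt0.
rewrite lef_pV2 ?posrE; last 2 first.
- exact: exprn_gt0.
- exact: exprn_gt0.
apply: (@le_trans _ _ ((3 * X) ^+ (p + 2))).
  by rewrite ler_weXn2l// leq_add2r.
by rewrite lerXn2r ?nnegrE ?(ltW X30) ?(ltW Cn0).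
Qed.

Lemma modelker_lb (tau C0 : R) (p : nat) : 0 < tau -> 0 < C0 ->
  exists2 c, 0 < c & forall n d tot q Q s, (1 <= n)%N -> 0 < d ->
  (forall b, (q b <= p)%N) -> (forall b, 0 <= Q b <= C0 * n%:R) ->
  tot - \sum_b Q b <= n%:R * (tau + d) -> tau <= s <= tau + d ->
  c / n%:R ^+ ((p + 2) * k) *
    expR (- (n.+1%:R / 2 * ln tau + n%:R / 2 + (2 * n%:R + 1) * d / (2 * tau)))
  <= modelker n tot q Q s.
Proof.
move=> tau0 C00; have [c c0 cP] := Psi_poly_lb p tau0 C00.
exists (c ^+ k); first by rewrite exprn_gt0.
move=> n d tot q Q s n1 d0 qp QC Sd /andP[ts st].
have s0 : 0 < s by exact: lt_le_trans ts.
have nR0 : 0 < n%:R :> R by rewrite ltr0n.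
have Q0 b : 0 <= Q b by have /andP[] := QC b.
apply: (@le_trans _ _ (invgammaker n tot s *
    \prod_b (expR (Q b / (2 * s)) * (c / n%:R ^+ (p + 2))))); last first.
  rewrite ler_wpM2l ?invgammaker_ge0//; apply: ler_prod => b _.
  rewrite mulr_ge0 ?expR_ge0 ?divr_ge0 ?exprn_ge0 ?(ltW c0)//=.
  apply: cP => //; first by rewrite divr_ge0// mulr_ge0// ltW.
  have /andP[_ QbC] := QC b.
  apply: ler_pM => //; first by rewrite invr_ge0 mulr_ge0// ltW.
  by rewrite lef_pV2 ?posrE ?mulr_gt0// ler_wpM2l.
rewrite big_split /= prodr_const card_ord -expR_sum -mulr_suml mulrA.
rewrite -invgammaker_shift// expr_div_n -exprM [leRHS]mulrC.
rewrite ler_wpM2l ?divr_ge0 ?exprn_ge0 ?(ltW c0)//.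
rewrite /invgammaker s0 ler_expR.
have lns : ln s <= ln tau + d / tau.
  apply: (le_trans (ln_le_tangent s0 tau0)); rewrite lerD2l ler_wpM2r ?invr_ge0 ?(ltW tau0)//.
  by rewrite lerBlDl.
have Ss : (tot - \sum_b Q b) / (2 * s) <= n%:R * (tau + d) / (2 * tau).
  apply: (@le_trans _ _ (n%:R * (tau + d) / (2 * s))).
    by rewrite ler_wpM2r// invr_ge0 mulr_ge0// ltW.
  rewrite ler_wpM2l ?mulr_ge0 ?addr_ge0 ?(ltW tau0) ?(ltW d0)//.
  by rewrite lef_pV2 ?posrE ?mulr_gt0// ler_wpM2l.
have : n.+1%:R / 2 * ln s <= n.+1%:R / 2 * (ln tau + d / tau).
  by rewrite ler_wpM2l.
move=> H.
have -> : - (n.+1%:R / 2 * ln tau + n%:R / 2 + (2 * n%:R + 1) * d / (2 * tau)) =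
   - (n.+1%:R / 2 * (ln tau + d / tau)) - n%:R * (tau + d) / (2 * tau).
  by rewrite -natr1; field; rewrite gt_eqF.
by rewrite mulNr lerB// lerN2.
Qed.

(** One constant [A] does two things: [A * hgpdf 4] dominates the kernels where the exponent is
    lower by [e] than its maximum at rate [tau], and [A] is at most [eps] times the integral of any
    model whose residual sum of squares is at most [n (tau + d)]. That integral is bounded below on
    [tau <= s <= tau + d]; [d <= e tau / 8] keeps the loss from the width of this interval below the
    gain of order [n e / 2]. *)
Lemma laplace_tail (tau e d C0 eps : R) (p : nat) : 0 < tau -> 0 < e -> 0 < d ->
  d <= e * tau / 8 -> 0 < C0 -> 0 < eps ->
  exists N, forall n, (N <= n)%N -> exists2 A, 0 < A &
    (forall r S s, 2^-1 <= r -> n%:R * (r * tau) <= S -> 0 < s ->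
      - ln s - r * tau / s <= - (ln tau + 1 + e) ->
      invgammaker n S s <= A * hgpdf 4 s) /\
    (forall tot q Q, (forall b, (q b <= p)%N) -> (forall b, 0 <= Q b <= C0 * n%:R) ->
      tot - \sum_b Q b <= n%:R * (tau + d) ->
      (A%:E <= eps%:E * \int[mu]_s (modelker n tot q Q s)%:E)%E).
Proof.
move=> tau0 e0 d0 det C00 eps0.
have [C Cp CP] := invgammaker_ub tau0.
have [c c0 cP] := modelker_lb p tau0 C00.
(* [K0] bounds the terms free of [n] in the difference of the two exponents; those that depend on
   [n] contribute at most [- e n / 4]. *)
pose m := ((p + 2) * k)%N; pose K0 := 2 * ln tau + 3 / 2 + 2 * e.
have e4 : 0 < e / 4 by rewrite divr_gt0.
have tgt : 0 < eps * (c * d) by rewrite !mulr_gt0.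
have [x0 x00 x0P] := poly_expRN_le m (C * expR K0) e4 tgt.
exists (maxn 4 (Num.truncn x0).+1) => n; rewrite geq_max => /andP[n4 nx0].
have n1 : (1 <= n)%N by exact: leq_trans n4.
have nR0 : 0 < n%:R :> R by rewrite ltr0n.
pose A := C * expR (- ((n%:R - 3) / 2 * (ln tau + 1 + e))).
have A0 : 0 < A by rewrite mulr_gt0 ?expR_gt0.
exists A => //; split; first by move=> r S s r2 nS s0 H; exact: (CP n r).
move=> tot q Q qp QC Sd.
pose B := c / n%:R ^+ m *
    expR (- (n.+1%:R / 2 * ln tau + n%:R / 2 + (2 * n%:R + 1) * d / (2 * tau))).
have B0 : 0 <= B by rewrite mulr_ge0 ?expR_ge0 ?divr_ge0 ?exprn_ge0 ?(ltW c0).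
apply: (@le_trans _ _ (eps%:E * (B * d)%:E)%E); last first.
  rewrite lee_pmul2l//.
  have -> : ((B * d)%:E = \int[mu]_s (B * \1_`[tau, tau + d] s)%:E)%E.
    under eq_integral do rewrite EFinM.
    rewrite lower_integralZl// integral_indic//= setIT.
    by rewrite lebesgue_measure_itv /= lte_fin ltrDl d0 -EFinB addrAC subrr add0r EFinM.
  apply: lower_integral_le => s; rewrite lee_fin; first by rewrite mulr_ge0// indicE.
  rewrite indicE; case: (boolP (s \in _)); last by rewrite mulr0 modelker_ge0.
  by rewrite inE /= in_itv /= mulr1 => sd; apply: cP.
rewrite -EFinM lee_fin.
have nx : x0 <= n%:R.
  by apply: le_trans (ltW (truncnS_gt x0)) _; rewrite ler_nat.
have := x0P _ nx; rewrite -ler_pdivlMr; last by rewrite expR_gt0.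
move=> H.
have : A * n%:R ^+ m <= eps * (c * d) *
   expR (- (n.+1%:R / 2 * ln tau + n%:R / 2 + (2 * n%:R + 1) * d / (2 * tau))).
  have nm0 : 0 <= n%:R ^+ m :> R by rewrite exprn_ge0.
  apply: (@le_trans _ _ (C * expR K0 * n%:R ^+ m * expR (- (e / 4 * n%:R)) *
     expR (- (n.+1%:R / 2 * ln tau + n%:R / 2 + (2 * n%:R + 1) * d / (2 * tau))))).
    rewrite [leRHS](_ : _ = C * (expR K0 * expR (- (e / 4 * n%:R)) *
      expR (- (n.+1%:R / 2 * ln tau + n%:R / 2 + (2 * n%:R + 1) * d / (2 * tau)))) *
      n%:R ^+ m); last by ring.
    rewrite /A ler_wpM2r// ler_wpM2l ?(ltW Cp)// -!expRD ler_expR.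
    have : (2 * n%:R + 1) * d / (2 * tau) <= (2 * n%:R + 1) * (e / 16).
      rewrite -mulrA ler_wpM2l ?addr_ge0 ?mulr_ge0// ler_pdivrMr ?mulr_gt0//.
      by rewrite (_ : e / 16 * (2 * tau) = e * tau / 8)//; field.
    rewrite /K0 (_ : n.+1%:R = n%:R + 1); last by rewrite natr1.
    have : 1 <= n%:R :> R by rewrite ler1n.
    move=> n1R; have := mulr_ge0 (ltW e0) (ltW nR0).
    move: (_ / (2 * tau)) (ln tau) => D L.
    by move: e0 n1R; nra.
  rewrite ler_wpM2r ?expR_ge0// -ler_pdivlMr ?expR_gt0//.
rewrite -ler_pdivlMr ?exprn_gt0// => /le_trans; apply.
rewrite /B le_eqVlt; apply/orP; left; apply/eqP; ring.
Qed.

End model_integrals.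

(** * Ratios of integrals compared pointwise up to a small tail *)

Section integral_ratio.
Variables (R : realType) (FT FG : R -> R) (c A eps : R).
Local Notation mu := (@lebesgue_measure R).
Local Notation h4 := (hgpdf 4).
Hypotheses (c0 : 0 < c) (A0 : 0 < A) (e0 : 0 <= eps).
Hypotheses (FT0 : forall s, 0 <= FT s) (FG0 : forall s, 0 <= FG s).
Hypothesis Ae : (A%:E <= eps%:E * \int[mu]_s (FT s)%:E)%E.
Hypothesis FTfin : (\int[mu]_s (FT s)%:E < +oo)%E.

Let lt24 : 2 < 4 :> R. Proof. by rewrite ltr_nat. Qed.

Definition integral_ratio : R :=
  fine (\int[mu]_s (c * FG s)%:E)%E / fine (\int[mu]_s (c * FT s)%:E)%E.

Let scale (F : R -> R) : (forall s, 0 <= F s) ->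
  (\int[mu]_s (c * F s)%:E = c%:E * \int[mu]_s (F s)%:E)%E.
Proof.
move=> F0; rewrite -lower_integralZl//; first exact: ltW.
Qed.

Let T : R := fine (\int[mu]_s (FT s)%:E).

Let TE : (\int[mu]_s (FT s)%:E = T%:E)%E.
Proof. by rewrite /T fineK// ge0_fin_numE// integral_ge0// => s _; rewrite lee_fin. Qed.

Let AT : A <= eps * T.
Proof. by rewrite -lee_fin EFinM -TE. Qed.

Let T0 : 0 < T.
Proof.
rewrite lt_def /T fine_ge0 ?andbT; last by apply: integral_ge0 => s _; rewrite lee_fin.
by apply/eqP => T0; have := lt_le_trans A0 AT; rewrite /T T0 mulr0 ltxx.
Qed.

Let tail : (\int[mu]_s (A * h4 s)%:E = A%:E)%E.
Proof.
under eq_integral do rewrite EFinM.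
rewrite lower_integralZl ?(ltW A0)//; last by move=> s; rewrite lee_fin hgpdf_ge0.
by rewrite integral_hgpdf// mule1.
Qed.

Let mtail : measurable_fun setT (fun s => A * h4 s).
Proof. by apply: measurable_funM => //; exact: measurable_hgpdf. Qed.

Let tail0 s : 0 <= A * h4 s.
Proof. by rewrite mulr_ge0 ?(ltW A0) ?hgpdf_ge0. Qed.

Lemma integral_ratio_ge0 : 0 <= integral_ratio.
Proof.
by rewrite divr_ge0// fine_ge0// integral_ge0// => s _; rewrite lee_fin mulr_ge0// ltW.
Qed.

Let ratioE (g : R) : (\int[mu]_s (FG s)%:E = g%:E)%E -> integral_ratio = g / T.
Proof.
move=> gE; rewrite /integral_ratio !scale// gE TE -!EFinM /=.
by field; rewrite !gt_eqF.
Qed.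

(** The additive term [A * h4] costs [A] after integration, which is at most [eps] times the
    denominator. Measurability of [h4] is what permits termwise integration. *)
Lemma integral_ratio_ub K : 0 <= K -> (forall s, FG s <= K * FT s + A * h4 s) ->
  integral_ratio <= K + eps.
Proof.
move=> K0 H.
have ub : (\int[mu]_s (FG s)%:E <= (K * T + A)%:E)%E.
  apply: (@le_trans _ _ (\int[mu]_s ((K * FT s)%:E + (A * h4 s)%:E))%E).
    by apply: lower_integral_le => s; rewrite -?EFinD lee_fin.
  rewrite lower_integralD//; last by move=> s; rewrite lee_fin mulr_ge0.
  rewrite tail EFinD leeD2r// EFinM -TE -lower_integralZl//.
have gE : (\int[mu]_s (FG s)%:E = (fine (\int[mu]_s (FG s)%:E))%:E)%E.
  rewrite fineK// ge0_fin_numE ?(le_lt_trans ub (ltry _))//.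
  by apply: integral_ge0 => s _; rewrite lee_fin.
rewrite (ratioE gE) ler_pdivrMr//; move: ub; rewrite gE lee_fin => /le_trans; apply.
by rewrite mulrDl lerD2l.
Qed.

Lemma integral_ratio_lb L : 0 <= L -> (forall s, L * FT s <= FG s + A * h4 s) ->
  (\int[mu]_s (FG s)%:E < +oo)%E -> L - eps <= integral_ratio.
Proof.
move=> L0 H Gfin.
have gE : (\int[mu]_s (FG s)%:E = (fine (\int[mu]_s (FG s)%:E))%:E)%E.
  by rewrite fineK// ge0_fin_numE// integral_ge0// => s _; rewrite lee_fin.
have : ((L * T)%:E <= \int[mu]_s (FG s)%:E + A%:E)%E.
  rewrite -tail -lower_integralD//.
  rewrite EFinM -TE -lower_integralZl//.
  by apply: lower_integral_le => s; rewrite -?EFinM -?EFinD lee_fin// mulr_ge0.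
rewrite (ratioE gE) ler_pdivlMr// {1}gE -EFinD lee_fin mulrBl.
by move: AT; lra.
Qed.

End integral_ratio.

(** * Bayes factors as functions of the sums of squares *)

Section bayes_factor_comparison.
Variables (R : realType) (a : R) (k : nat).
Local Notation mu := (@lebesgue_measure R).
Local Notation h4 := (hgpdf 4).
Hypotheses (a2 : 2 < a) (a4 : a <= 4).
Implicit Types (q qT qG : 'I_k -> nat) (Q QT QG : 'I_k -> R).
Local Notation modelker := (modelker a).

Let lt24 : 2 < 4 :> R. Proof. by rewrite ltr_nat. Qed.

Lemma modelker_fin (tau : R) n tot q Q : 0 < tau -> (4 <= n)%N ->
  (forall b, 0 <= Q b) -> n%:R * (2^-1 * tau) <= tot - \sum_b Q b ->
  (\int[mu]_s (modelker n tot q Q s)%:E < +oo)%E.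
Proof.
move=> tau0 n4 Q0 nS; have [C C0 CP] := invgammaker_ub tau0.
pose A := C * expR (- ((n%:R - 3) / 2 * (ln (2^-1 * tau) + 1))).
have A0 : 0 <= A by rewrite mulr_ge0 ?expR_ge0 ?(ltW C0).
apply: (@le_lt_trans _ _ (\int[mu]_s (A%:E * (h4 s)%:E))%E).
  apply: lower_integral_le => s; first by rewrite lee_fin modelker_ge0.
  rewrite -EFinM lee_fin; have [s0|s0] := lerP s 0.
    by rewrite modelker_le0// mulr_ge0// hgpdf_ge0.
  apply: (le_trans (modelker_ub a2 _ _ _ _ Q0)); apply: (CP n 2^-1) => //.
  by apply: invgamma_exponent_max => //; rewrite mulr_gt0.
rewrite lower_integralZl//; last by move=> s; rewrite lee_fin hgpdf_ge0.
by rewrite integral_hgpdf// mule1 ltry.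
Qed.

(** The best exponent at rate [tau + l] is lower than at rate [tau] by [e = ln (1 + l / tau)]. So
    for every [s] the integrand of the competing model lies below the tail majorant, and
    [integral_ratio_ub] applies with [K = 0]. *)
Lemma bayes_factor_missing (tau l C0 eps : R) (p : nat) : 0 < tau -> 0 < l ->
  0 < C0 -> 0 < eps ->
  exists2 d, 0 < d <= tau / 2 & exists N, forall n, (N <= n)%N -> forall tot qT QT qG QG c, 0 < c ->
  (forall b, (qT b <= p)%N) -> (forall b, 0 <= QT b <= C0 * n%:R) ->
  (forall b, 0 <= QG b) ->
  n%:R * (tau - d) <= tot - \sum_b QT b <= n%:R * (tau + d) ->
  n%:R * (tau + l) <= tot - \sum_b QG b ->
  0 <= integral_ratio (modelker n tot qT QT) (modelker n tot qG QG) c <= eps.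
Proof.
move=> tau0 l0 C00 eps0; pose r := 1 + l / tau.
have r1 : 1 < r by rewrite ltrDl divr_gt0.
have r0 : 0 < r by exact: lt_trans r1.
pose e := ln r; have e0 : 0 < e by rewrite ln_gt0.
pose d := Num.min (e * tau / 8) (tau / 2).
have d0 : 0 < d by rewrite lt_min !divr_gt0 ?mulr_gt0.
have de : d <= e * tau / 8 by rewrite ge_min lexx.
have dt : d <= tau / 2 by rewrite ge_min lexx orbT.
exists d; first by rewrite d0.
have [N NP] := laplace_tail k a2 a4 p tau0 e0 d0 de C00 eps0.
exists (maxn 4 N) => n; rewrite geq_max => /andP[n4 nN] tot qT QT qG QG c c0.
move=> qTp QTC QG0 /andP[Sl Su] SG.
have [A A0 [tailP lbP]] := NP n nN.
have QT0 b : 0 <= QT b by have /andP[] := QTC b.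
have MT s : 0 <= modelker n tot qT QT s by exact: modelker_ge0.
have MG s : 0 <= modelker n tot qG QG s by exact: modelker_ge0.
rewrite integral_ratio_ge0//= -[eps]add0r.
apply: (integral_ratio_ub c0 A0) => //.
- exact: (lbP tot qT QT).
- apply: (modelker_fin _ tau0) => //; apply: (le_trans _ Sl).
  by rewrite ler_wpM2l//; move: dt; lra.
move=> s; rewrite mul0r add0r; have [s0|s0] := lerP s 0.
  by rewrite modelker_le0// mulr_ge0 ?hgpdf_ge0 ?(ltW A0).
apply: (le_trans (modelker_ub a2 _ _ _ _ QG0)); apply: (tailP r) => //.
- by rewrite (le_trans _ (ltW r1))// invf_le1// ler1n.
- by rewrite (_ : r * tau = tau + l)//; rewrite /r; field; rewrite gt_eqF.
- have rt : 0 < r * tau by rewrite mulr_gt0.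
  have := invgamma_exponent_max rt s0; rewrite lnM ?posrE// => /le_trans; apply.
  by rewrite lerN2 /e; lra.
Qed.

Let inv_le (tau s M : R) : 0 < tau -> 0 <= M -> `|s - tau| < tau / 2 ->
  0 < s /\ M / (2 * s) <= M / tau.
Proof.
move=> tau0 M0; rewrite ltr_norml => /andP[H1 _].
have s0 : tau / 2 <= s by move: H1; lra.
have s00 : 0 < s by apply: lt_le_trans s0; rewrite divr_gt0.
split=> //; rewrite ler_wpM2l// lef_pV2 ?posrE ?mulr_gt0//.
by move: s0; lra.
Qed.

(** Outside [|s - tau| < tau / 2] the integrand belongs to the tail. Inside, the argument of [Psi]
    in the block with [qT b < qG b] is of order [n], so this block gains an arbitrarily small
    factor, while the bounded increases of all sums of squares together cost at most
    [K = exp(k M / tau)]. *)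
Lemma bayes_factor_extra (tau C0 c1 M eps : R) (p : nat) : 0 < tau ->
  0 < C0 -> 0 < c1 -> 0 <= M -> 0 < eps ->
  exists2 d, 0 < d <= tau / 2 & exists N, forall n, (N <= n)%N -> forall tot qT QT qG QG c, 0 < c ->
  (forall b, (qT b <= p)%N) -> (forall b, (qG b <= p)%N) ->
  (forall b, 0 <= QT b <= C0 * n%:R) ->
  n%:R * (tau - d) <= tot - \sum_b QT b <= n%:R * (tau + d) ->
  (forall b, (qT b <= qG b)%N) -> (forall b, QT b <= QG b <= QT b + M) ->
  (exists2 b, (qT b < qG b)%N & c1 * n%:R <= QT b) ->
  0 <= integral_ratio (modelker n tot qT QT) (modelker n tot qG QG) c <= eps.
Proof.
move=> tau0 C00 c10 M0 eps0.
have t20 : 0 < tau / 2 by rewrite divr_gt0.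
have t2t : tau / 2 < tau by move: tau0; lra.
have [e [r0 [e0 r02 r01 away]]] := invgamma_exponent_away tau0 t20 t2t.
pose d := Num.min (e * tau / 8) (Num.min (tau / 2) ((1 - r0) * tau / 2)).
have r0' : 0 < 1 - r0 by rewrite subr_gt0.
have d0 : 0 < d by rewrite !lt_min t20 !divr_gt0 ?mulr_gt0.
have de : d <= e * tau / 8 by rewrite ge_min lexx.
have dt : d <= tau / 2 by rewrite !ge_min lexx !orbT.
have dr : d <= (1 - r0) * tau / 2 by rewrite !ge_min lexx !orbT.
exists d; first by rewrite d0.
have eps2 : 0 < eps / 2 by rewrite divr_gt0.
have [N1 N1P] := laplace_tail k a2 a4 p tau0 e0 d0 de C00 eps2.
pose K := expR (k%:R * (M / tau)); have K0 : 0 < K by exact: expR_gt0.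
have epsK : 0 < eps / (2 * K) by rewrite divr_gt0 ?mulr_gt0.
(* The threshold of [Psi_size_small] depends on the two sizes; as both are at most [p], adding up
   finitely many thresholds makes it uniform. *)
have small : exists2 x0, 0 < x0 & forall (q q' : nat) x, (q < q')%N -> (q' <= p)%N ->
    x0 <= x -> Psi a q' x <= eps / (2 * K) * Psi a q x.
  have step (q q' : 'I_p.+1) : exists x0, 0 < x0 /\ forall x, (q < q')%N ->
      x0 <= x -> Psi a q' x <= eps / (2 * K) * Psi a q x.
    have [qq|qq] := ltnP q q'; last by exists 1; split.
    by have [x0 x00 H] := Psi_size_small a2 a4 qq epsK; exists x0; split => // x _; exact: H.
  have /choice[f fP] : forall ij : 'I_p.+1 * 'I_p.+1, exists x0, 0 < x0 /\ forall x,
      (ij.1 < ij.2)%N -> x0 <= x -> Psi a ij.2 x <= eps / (2 * K) * Psi a ij.1 x.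
    by move=> [q q']; exact: step.
  exists (1 + \sum_ij f ij).
    by rewrite ltr_pwDl// sumr_ge0// => ij _; rewrite ltW//; have [] := fP ij.
  move=> q q' x qq q'p xx.
  have q'p1 : (q' < p.+1)%N by [].
  have qp1 : (q < p.+1)%N by exact: ltn_trans qq q'p1.
  have [_ H] := fP (Ordinal qp1, Ordinal q'p1); apply: (H x qq).
  apply: (le_trans _ xx); rewrite (bigD1 (Ordinal qp1, Ordinal q'p1))//= addrCA lerDl.
  rewrite addr_ge0// sumr_ge0// => ij _; rewrite ltW//.
  by have [] := fP ij.
have [x0 x00 smallP] := small.
(* The first bound keeps the residual sum of squares of the larger model above [n (tau - 2 d)]; the
   second gives [x0 <= QT b0 / (2 s)] for [s < 3 tau / 2]. *)
pose y0 := Num.max (k%:R * M / d) (3 * tau * x0 / c1).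
exists (maxn (maxn 4 N1) (Num.truncn y0).+1) => n.
rewrite !geq_max => /andP[/andP[n4 nN1] ny0] tot qT QT qG QG c c0.
move=> qTp qGp QTC /andP[Sl Su] qq QQ [b0 qb0 Qb0].
have ny : y0 <= n%:R.
  by apply: (le_trans (ltW (truncnS_gt y0))); rewrite ler_nat.
have nM : k%:R * M <= n%:R * d.
  by rewrite -ler_pdivrMr//; apply: (le_trans _ ny); rewrite le_max lexx.
have nc : 3 * tau * x0 <= c1 * n%:R.
  by rewrite [leRHS]mulrC -ler_pdivrMr//; apply: (le_trans _ ny); rewrite le_max lexx orbT.
have [A A0 [tailP lbP]] := N1P n nN1.
have QT0 b : 0 <= QT b by have /andP[] := QTC b.
have QG0 b : 0 <= QG b by have /andP[H _] := QQ b; exact: le_trans H.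
have MT s : 0 <= modelker n tot qT QT s by exact: modelker_ge0.
have MG s : 0 <= modelker n tot qG QG s by exact: modelker_ge0.
rewrite integral_ratio_ge0//= [eps in leRHS](_ : _ = eps / 2 + eps / 2); last by field.
have e20 := ltW eps2.
apply: (integral_ratio_ub c0 A0) => //.
- exact: (lbP tot qT QT).
- apply: (modelker_fin _ tau0) => //; apply: (le_trans _ Sl).
  by rewrite ler_wpM2l//; move: dt; lra.
move=> s; have [s0|s0] := lerP s 0.
  by rewrite !modelker_le0// mulr0 add0r mulr_ge0 ?hgpdf_ge0 ?(ltW A0).
have [out|ins] := lerP (tau / 2) `|s - tau|.
  apply: (@le_trans _ _ (A * h4 s)); last by rewrite lerDr mulr_ge0.
  apply: (le_trans (modelker_ub a2 _ _ _ _ QG0)).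
  pose r := 1 - 2 * d / tau.
  have rr0 : r0 <= r.
    rewrite /r lerBrDl addrC -lerBrDl ler_pdivrMr//.
    by move: dr; lra.
  apply: (tailP r) => //; first exact: le_trans rr0.
    have -> : r * tau = tau - 2 * d by rewrite /r; field; rewrite gt_eqF.
    have : \sum_b QG b <= \sum_b QT b + k%:R * M.
      have -> : k%:R * M = \sum_(b < k) M by rewrite sumr_const card_ord mulr_natl.
      by rewrite -big_split /=; apply: ler_sum => b _; have /andP[] := QQ b.
    by move: nM Sl; lra.
  apply: away => //; rewrite /r gerBl// divr_ge0 ?mulr_ge0 ?(ltW d0) ?(ltW tau0)//.
have [_ Ms] := inv_le tau0 M0 ins.
have h40 : 0 <= A * h4 s by rewrite mulr_ge0 ?hgpdf_ge0 ?(ltW A0).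
apply: (@le_trans _ _ (eps / 2 * modelker n tot qT QT s)); last by rewrite lerDl.
rewrite /modelker mulrCA ler_wpM2l ?invgammaker_ge0//.
have fac b : Psi a (qG b) (QG b / (2 * s)) <= expR (M / tau) * Psi a (qG b) (QT b / (2 * s)).
  have /andP[Q1 Q2] := QQ b.
  have x0' : 0 <= QT b / (2 * s) by rewrite divr_ge0// mulr_ge0// ltW.
  have x01 : QT b / (2 * s) <= QG b / (2 * s) by rewrite ler_wpM2r// invr_ge0 mulr_ge0// ltW.
  apply: (le_trans (Psi_shift a2 _ x0' x01)).
  rewrite ler_wpM2r ?Psi_ge0// ler_expR (le_trans _ Ms)// -mulrBl.
  by rewrite ler_wpM2r ?invr_ge0 ?mulr_ge0 ?(ltW s0)// lerBlDl.
have QTs b : 0 <= QT b / (2 * s) by rewrite divr_ge0// mulr_ge0// ltW.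
apply: (@le_trans _ _ (\prod_b (expR (M / tau) * Psi a (qG b) (QT b / (2 * s))))).
  by apply: ler_prod => b _; rewrite Psi_ge0//= fac.
rewrite big_split /= prodr_const card_ord -expRM_natl -/K.
rewrite (bigD1 b0 isT) [in leRHS](bigD1 b0 isT) /=.
have xb : x0 <= QT b0 / (2 * s).
  rewrite ler_pdivlMr ?mulr_gt0//; apply: (le_trans _ Qb0); apply: (le_trans _ nc).
  rewrite mulrC ler_wpM2r ?(ltW x00)//.
  by move: ins; rewrite ltr_norml => /andP[_]; lra.
have H1 := smallP _ _ _ qb0 (qGp b0) xb.
have H2 : \prod_(b | b != b0) Psi a (qG b) (QT b / (2 * s)) <=
    \prod_(b | b != b0) Psi a (qT b) (QT b / (2 * s)).
  by apply: ler_prod => b _; rewrite Psi_ge0//= Psi_size_le.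
apply: (@le_trans _ _ (K * (eps / (2 * K) * Psi a (qT b0) (QT b0 / (2 * s)) *
    \prod_(b | b != b0) Psi a (qT b) (QT b / (2 * s))))).
  apply: ler_wpM2l; first exact: ltW.
  apply: ler_pM; [exact: Psi_ge0| |exact: H1|exact: H2].
  by apply: prodr_ge0 => b _; exact: Psi_ge0.
rewrite le_eqVlt; apply/orP; left; apply/eqP.
by field; rewrite gt_eqF.
Qed.

Let one_le_expR (x : R) : 0 <= x -> 1 <= expR x.
Proof. by move=> x0; rewrite -[leLHS]expR0 ler_expR. Qed.

Let Psi_dist (m : nat) (x y dd : R) : 0 <= x -> 0 <= y -> `|x - y| <= dd ->
  Psi a m x <= expR dd * Psi a m y.
Proof.
move=> x0 y0 xy; have dd0 : 0 <= dd by exact: le_trans xy.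
have [xley|/ltW ylex] := leP x y.
  rewrite (le_trans (Psi_le a2 _ x0 xley))// ler_peMl ?Psi_ge0//.
  exact: one_le_expR.
rewrite (le_trans (Psi_shift a2 _ y0 ylex))// ler_wpM2r ?Psi_ge0// ler_expR.
exact: le_trans (ler_norm _) xy.
Qed.

Let sub1_inv_le (u v : R) : 1 <= u -> 0 <= v -> v * u = 1 -> 1 - v <= u - 1.
Proof. by nra. Qed.

Let two_sided_close (r u v h m e1 e : R) : r <= u * h + e1 -> v * h - m * e1 <= r ->
  h * (u - 1) <= e / 2 -> h * (1 - v) <= h * (u - 1) ->
  (1 + m) * e1 = e / 2 -> 0 <= m * e1 -> 0 <= e1 -> `|r - h| <= e.
Proof.
by move=> *; rewrite ler_norml; apply/andP; split; lra.
Qed.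

(** The factors of the blocks outside [P] are common to both models, and on [P] the true model has
    the factor [Psi 0 0 = 1]. The quotient of the integrands is therefore [H s], nearly constant on
    a small window around [tau]; elsewhere both integrands belong to the tail. *)
Lemma bayes_factor_limit (tau C0 M eps : R) (p : nat) : 0 < tau ->
  0 < C0 -> 0 <= M -> 0 < eps ->
  exists2 d, 0 < d <= tau / 2 & exists N, forall n, (N <= n)%N -> forall (P : pred 'I_k) tot qT QT qG QG c, 0 < c ->
  (forall b, (qT b <= p)%N) ->
  (forall b, 0 <= QT b <= C0 * n%:R) ->
  n%:R * (tau - d) <= tot - \sum_b QT b <= n%:R * (tau + d) ->
  (forall b, ~~ P b -> qT b = qG b /\ QT b = QG b) ->
  (forall b, P b -> [/\ qT b = 0, QT b = 0 & 0 <= QG b <= M]) ->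
  `|integral_ratio (modelker n tot qT QT) (modelker n tot qG QG) c -
    \prod_(b | P b) Psi a (qG b) (QG b / (2 * tau))| <= eps.
Proof.
move=> tau0 C00 M0 eps0.
have t20 : 0 < tau / 2 by rewrite divr_gt0.
pose Hm := expR (k%:R * (M / (2 * tau))); have Hm0 : 0 < Hm by exact: expR_gt0.
(* On the window [H] varies by a factor at most [exp rho]; as [H tau <= Hm], the resulting error is
   at most [eps / 2]. *)
pose rho := ln (1 + eps / (2 * Hm)).
have eH0 : 0 < eps / (2 * Hm) by rewrite divr_gt0 ?mulr_gt0.
have rho0 : 0 < rho by rewrite ln_gt0// ltrDl.
have rhoE : Hm * (expR rho - 1) = eps / 2.
  by rewrite /rho lnK ?posrE ?addr_gt0//; field; rewrite gt_eqF.
have kM0 : 0 < k%:R * M + 1 by rewrite ltr_wpDl// mulr_ge0.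
(* Moving [s] by [dl] away from [tau] moves each [QG b / (2 s)] by at most [M dl / tau^2], hence the
   logarithm of [H] by at most [rho]. *)
pose dl := Num.min (tau / 2) (rho * tau ^+ 2 / (k%:R * M + 1)).
have dl0 : 0 < dl by rewrite lt_min t20 divr_gt0 ?mulr_gt0 ?exprn_gt0.
have dlt : dl <= tau / 2 by rewrite ge_min lexx.
have dlr : dl * (k%:R * M + 1) <= rho * tau ^+ 2.
  by rewrite -ler_pdivlMr// ge_min lexx orbT.
have dltau : dl < tau by apply: le_lt_trans dlt _; move: tau0; lra.
have [e [r0 [e0 r02 r01 away]]] := invgamma_exponent_away tau0 dl0 dltau.
pose d := Num.min (e * tau / 8) (Num.min (tau / 2) ((1 - r0) * tau / 2)).
have r0' : 0 < 1 - r0 by rewrite subr_gt0.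
have d0 : 0 < d by rewrite !lt_min t20 !divr_gt0 ?mulr_gt0.
have de : d <= e * tau / 8 by rewrite ge_min lexx.
have dt : d <= tau / 2 by rewrite !ge_min lexx !orbT.
have dr : d <= (1 - r0) * tau / 2 by rewrite !ge_min lexx !orbT.
exists d; first by rewrite d0.
have epsH : 0 < eps / (2 * (1 + Hm)) by rewrite divr_gt0 ?mulr_gt0 ?addr_gt0.
pose eps1 := eps / (2 * (1 + Hm)).
have eps1E : (1 + Hm) * eps1 = eps / 2.
  by rewrite /eps1; field; rewrite gt_eqF// addr_gt0.
have [N1 N1P] := laplace_tail k a2 a4 p tau0 e0 d0 de C00 epsH.
exists (maxn (maxn 4 N1) (Num.truncn (k%:R * M / d)).+1) => n.
rewrite !geq_max => /andP[/andP[n4 nN1] ny0] P tot qT QT qG QG c c0.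
move=> qTp QTC /andP[Sl Su] PF PT.
have ny : k%:R * M / d <= n%:R.
  by apply: le_trans (ltW (truncnS_gt _)) _; rewrite ler_nat.
have nM : k%:R * M <= n%:R * d by rewrite -ler_pdivrMr.
have [A A0 [tailP lbP]] := N1P n nN1.
have QT0 b : 0 <= QT b by have /andP[] := QTC b.
have QQ b : 0 <= QG b <= QT b + M.
  have [Pb|Pb] := boolP (P b); first by have [_ -> ?] := PT b Pb; rewrite add0r.
  by have [_ <-] := PF b Pb; rewrite QT0 lerDl.
have QG0 b : 0 <= QG b by have /andP[] := QQ b.
have MT s : 0 <= modelker n tot qT QT s by exact: modelker_ge0.
have MG s : 0 <= modelker n tot qG QG s by exact: modelker_ge0.
pose H s := \prod_(b | P b) Psi a (qG b) (QG b / (2 * s)).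
have H0 s : 0 <= H s by rewrite prodr_ge0// => b _; exact: Psi_ge0.
have GE s : modelker n tot qG QG s = H s * modelker n tot qT QT s.
  rewrite /modelker mulrCA; congr (_ * _); rewrite [LHS](bigID P) /=.
  rewrite -/(H s); congr (_ * _); rewrite [RHS](bigID P) /= [X in _ = X * _]big1.
    by rewrite mul1r; apply: eq_bigr => b Pb; have [-> ->] := PF b Pb.
  by move=> b Pb; have [-> -> _] := PT b Pb; rewrite mul0r Psi00.
have HHm : H tau <= Hm.
  rewrite /H big_mkcond /=; apply: (@le_trans _ _ (\prod_(b < k) expR (M / (2 * tau)))).
    apply: ler_prod => b _; have t2 : 0 < 2 * tau by rewrite mulr_gt0.
    case: ifP => [Pb|_]; last first.
      by rewrite ler01/= one_le_expR// divr_ge0// ltW.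
    have [_ _ /andP[Q1 Q2]] := PT b Pb.
    rewrite Psi_ge0//=; apply: (le_trans (Psi_le_expR a2 _ _)); first by rewrite divr_ge0// ltW.
    by rewrite ler_expR ler_wpM2r// invr_ge0 ltW.
  by rewrite prodr_const card_ord -expRM_natl.
have near_tau s : `|s - tau| < dl -> H s <= expR rho * H tau /\ H tau <= expR rho * H s.
  move=> ins; have sb : `|s - tau| < tau / 2 by exact: lt_le_trans dlt.
  have st : tau / 2 <= s by move: sb; rewrite ltr_norml => /andP[]; lra.
  have s0 : 0 < s by exact: lt_le_trans st.
  pose dd := M * (dl / tau ^+ 2).
  have dd0 : 0 <= dd by rewrite mulr_ge0// divr_ge0 ?exprn_ge0 ?(ltW dl0) ?(ltW tau0).
  have kdd : k%:R * dd <= rho.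
    rewrite /dd !mulrA ler_pdivrMr ?exprn_gt0//.
    by move: dlr dl0; lra.
  have key (x y : R) : 0 < x -> 0 < y -> tau ^+ 2 <= 2 * (x * y) -> `|x - y| <= dl ->
      H x <= expR rho * H y.
    move=> xp yp xy dxy; rewrite /H big_mkcond [in leRHS]big_mkcond /=.
    apply: (@le_trans _ _ (\prod_(b < k) (expR dd *
      (if P b then Psi a (qG b) (QG b / (2 * y)) else 1)))).
      apply: ler_prod => b _; case: ifP => [Pb|_]; last first.
        by rewrite ler01 mulr1 one_le_expR.
      have [_ _ /andP[Q1 Q2]] := PT b Pb.
      rewrite Psi_ge0//=; apply: Psi_dist; rewrite ?divr_ge0 ?mulr_ge0 ?(ltW xp) ?(ltW yp)//.
      have -> : QG b / (2 * x) - QG b / (2 * y) = QG b * ((y - x) / (2 * (x * y))).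
        by field; rewrite !gt_eqF.
      have xyp : 0 < 2 * (x * y) by rewrite !mulr_gt0.
      rewrite normrM (ger0_norm Q1) /dd ler_pM// normrM distrC.
      rewrite [X in _ * X]ger0_norm ?invr_ge0 ?(ltW xyp)//.
      by rewrite ler_pM ?invr_ge0 ?(ltW xyp)// lef_pV2 ?posrE ?exprn_gt0.
    rewrite big_split /= prodr_const card_ord -expRM_natl ler_wpM2r//.
      by rewrite prodr_ge0// => b _; case: ifP => // _; exact: Psi_ge0.
    by rewrite ler_expR.
  have st2 : tau ^+ 2 <= 2 * (s * tau).
    by rewrite expr2 mulrA ler_wpM2r ?(ltW tau0)//; move: st; lra.
  split; first by apply: key => //; exact: ltW.
  by apply: key => //; [rewrite (mulrC tau)|rewrite distrC ltW].
have sup0 : (A%:E <= eps1%:E * \int[mu]_s (modelker n tot qT QT s)%:E)%E.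
  exact: (lbP tot qT QT).
have finT : (\int[mu]_s (modelker n tot qT QT s)%:E < +oo)%E.
  apply: (modelker_fin _ tau0) => //; apply: (le_trans _ Sl).
  by rewrite ler_wpM2l//; move: dt; lra.
(* A rate that serves both models: one [n d] for the fluctuation of the residual sum of squares, one
   for the bounded amount [k M]. *)
pose r := 1 - 2 * d / tau.
have rr0 : r0 <= r.
  rewrite /r lerBrDl addrC -lerBrDl ler_pdivrMr//.
  by move: dr; lra.
have rtau : r * tau = tau - 2 * d by rewrite /r; field; rewrite gt_eqF.
have rle1 : r <= 1 by rewrite /r gerBl// divr_ge0 ?mulr_ge0 ?(ltW d0) ?(ltW tau0).
have QTG : \sum_b QG b <= \sum_b QT b + k%:R * M.
  have -> : k%:R * M = \sum_(b < k) M by rewrite sumr_const card_ord mulr_natl.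
  by rewrite -big_split /=; apply: ler_sum => b _; have /andP[] := QQ b.
have nrG : n%:R * (r * tau) <= tot - \sum_b QG b.
  by rewrite rtau; move: nM Sl QTG; lra.
have nrT : n%:R * (r * tau) <= tot - \sum_b QT b.
  have : 0 <= n%:R * d by rewrite mulr_ge0// ltW.
  by rewrite rtau; move: Sl; lra.
have r2 : 2^-1 <= r by exact: le_trans rr0.
have outG s : 0 < s -> dl <= `|s - tau| -> modelker n tot qG QG s <= A * h4 s.
  move=> s0 out; apply: (le_trans (modelker_ub a2 _ _ _ _ QG0)).
  by apply: (tailP r) => //; exact: away.
have outT s : 0 < s -> dl <= `|s - tau| -> modelker n tot qT QT s <= A * h4 s.
  move=> s0 out; apply: (le_trans (modelker_ub a2 _ _ _ _ QT0)).
  by apply: (tailP r) => //; exact: away.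
have e10 : 0 <= eps1 by exact: ltW.
have h40 s : 0 <= A * h4 s by rewrite mulr_ge0 ?hgpdf_ge0 ?(ltW A0).
rewrite -/(H tau).
have ub : integral_ratio (modelker n tot qT QT) (modelker n tot qG QG) c <= expR rho * H tau + eps1.
  apply: (integral_ratio_ub c0 A0) => //; first by rewrite mulr_ge0 ?expR_ge0.
  move=> s; have [s0|s0] := lerP s 0; first by rewrite !modelker_le0// mulr0 add0r.
  have [out|ins] := lerP dl `|s - tau|.
    apply: (@le_trans _ _ (A * h4 s)); first exact: outG.
    by rewrite lerDr mulr_ge0// mulr_ge0 ?expR_ge0.
  apply: (@le_trans _ _ (expR rho * H tau * modelker n tot qT QT s)); last by rewrite lerDl.
  rewrite GE; apply: ler_wpM2r; first exact: MT.
  exact: (near_tau s ins).1.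
have lb : expR (- rho) * H tau - Hm * eps1 <=
    integral_ratio (modelker n tot qT QT) (modelker n tot qG QG) c.
  (* Outside the window the left-hand side is at most [Hm] times the tail, so the tail constant is
     scaled by [Hm]. *)
  have HA : 0 < Hm * A by exact: mulr_gt0.
  have HAe : ((Hm * A)%:E <=
      (Hm * eps1)%:E * \int[mu]_s (modelker n tot qT QT s)%:E)%E.
    rewrite (EFinM Hm A) (EFinM Hm eps1) -muleA.
    by apply: lee_pmul => //; rewrite lee_fin ltW.
  have L0 : 0 <= expR (- rho) * H tau by apply: mulr_ge0 => //; exact: expR_ge0.
  have finG : (\int[mu]_s (modelker n tot qG QG s)%:E < +oo)%E.
    apply: (modelker_fin _ tau0 n4 QG0); apply: (le_trans _ nrG).
    by apply: ler_wpM2l => //; apply: ler_wpM2r => //; exact: ltW.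
  have HA40 s : 0 <= Hm * A * h4 s.
    by rewrite -mulrA; apply: mulr_ge0 => //; exact: ltW.
  apply: (integral_ratio_lb c0 HA MT MG HAe finT L0 _ finG) => s.
  have [s0|s0] := lerP s 0.
    by rewrite !modelker_le0// mulr0 add0r.
  have [out|ins] := lerP dl `|s - tau|.
    apply: (@le_trans _ _ (Hm * (A * h4 s))); last first.
      by rewrite [leLHS]mulrA lerDr; exact: MG.
    apply: ler_pM; [exact: L0|exact: MT| |exact: outT].
    apply: (le_trans _ HHm); apply: ler_piMl => //.
    by rewrite expRN invf_le1 ?expR_gt0// ltW// expR_gt1.
  apply: (@le_trans _ _ (modelker n tot qG QG s)); last by rewrite lerDl.
  rewrite GE; apply: ler_wpM2r; first exact: MT.
  rewrite expRN ler_pdivrMl; first exact: (near_tau s ins).2.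
  exact: expR_gt0.
have Htau0 := H0 tau.
have er1 : 1 <= expR rho by rewrite ltW// expR_gt1.
have eN : expR (- rho) * expR rho = 1 by rewrite -expRD addNr expR0.
have eN0 : 0 <= expR (- rho) by exact: expR_ge0.
have eps10 : 0 <= Hm * eps1 by rewrite mulr_ge0// ltW.
have up1 : H tau * (expR rho - 1) <= eps / 2 by rewrite -rhoE ler_wpM2r// subr_ge0.
have lo1 : H tau * (1 - expR (- rho)) <= H tau * (expR rho - 1).
  by apply: ler_wpM2l => //; exact: sub1_inv_le.
exact: (two_sided_close ub lb up1 lo1 eps1E eps10 e10).
Qed.

End bayes_factor_comparison.

(** * Projections for nested sets of predictors *)

Section nested_designs.
Variables (R : realType) (n p k : nat) (blk : 'I_p -> 'I_k) (X : 'M[R]_(n, p)).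
Implicit Types (G T : {set 'I_p}) (f g : 'I_k -> R) (b : 'I_k) (e : 'cV[R]_n).
Local Notation P := (blockproj blk X).
Local Notation delta := (fun b c : 'I_k => (c == b)%:R : R).
Local Notation one := (const_mx 1 : 'cV[R]_n).

Definition incl T G : 'M[R]_(#|G|, #|T|) :=
  \matrix_(i, j) (enum_val i == enum_val j)%:R.

Lemma sum_enum_val G (F : 'I_p -> R) l : l \in G ->
  \sum_(i < #|G|) F (enum_val i) * (enum_val i == l)%:R = F l.
Proof.
move=> lG; rewrite (bigD1 (enum_rank_in lG l))//= enum_rankK_in// eqxx mulr1.
rewrite big1 ?addr0// => i /eqP il.
case: eqP => [il'|_]; last by rewrite mulr0.
by case: il; apply/enum_val_inj; rewrite enum_rankK_in// il'.
Qed.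

Lemma Xsub_incl T G : T \subset G -> Xsub X G *m incl T G = Xsub X T.
Proof.
move=> TG; apply/matrixP => i j; rewrite !mxE.
under eq_bigr do rewrite !mxE.
rewrite (sum_enum_val (fun l => X i l))//.
by apply: (fintype.subsetP TG); exact: enum_valP.
Qed.

Lemma blockdiag_incl T G f :
  blockdiag blk G f *m incl T G = incl T G *m blockdiag blk T f.
Proof.
apply/matrixP => i j; rewrite mul_diag_mx mul_mx_diag !mxE.
by case: eqP => [->|_]; rewrite ?mulr1 ?mul1r ?mulr0 ?mul0r.
Qed.

Lemma gram_unitP G : (forall x : 'cV[R]_#|G|, Xsub X G *m x = 0 -> x = 0) -> gram X G \in unitmx.
Proof.
move=> inj; apply: pd_unit; split; first exact: gram_sym.
by move=> x x0; rewrite dot_gram dot_gt0//; apply: contra_neq x0 => /inj.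
Qed.

Lemma incl_inj T G (x : 'cV[R]_#|T|) : T \subset G -> incl T G *m x = 0 -> x = 0.
Proof.
move=> TG /colP x0; apply/colP => j; rewrite mxE.
have jG : enum_val j \in G by apply: (fintype.subsetP TG); exact: enum_valP.
have := x0 (enum_rank_in jG (enum_val j)); rewrite !mxE => <-.
rewrite (bigD1 j)//= !mxE enum_rankK_in// eqxx mul1r big1 ?addr0// => i /negPf ij.
rewrite !mxE enum_rankK_in//; case: eqP => [/enum_val_inj ji|_]; last by rewrite mul0r.
by rewrite ji eqxx in ij.
Qed.

Lemma gram_unit_sub T G : T \subset G -> gram X G \in unitmx -> gram X T \in unitmx.
Proof.
move=> TG uG; apply: gram_unitP => x; rewrite -(Xsub_incl TG) -mulmxA => Xx.
apply: (incl_inj TG); rewrite -[LHS]mul1mx -(mulVmx uG) -!mulmxA.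
by rewrite Xx !mulmx0.
Qed.

Hypothesis oX : forall j l : 'I_p, blk j != blk l -> \sum_i X i j * X i l = 0.

Lemma blockproj_nested T G f g : T \subset G -> gram X G \in unitmx ->
  P G f *m P T g = P T (f \* g).
Proof.
move=> TG uG; have uT := gram_unit_sub TG uG.
have PX : P G f *m Xsub X T = Xsub X T *m blockdiag blk T f.
  rewrite -(Xsub_incl TG) [LHS]mulmxA (blockproj_sub oX)//.
  by rewrite -mulmxA blockdiag_incl mulmxA.
rewrite {2}/blockproj -2!mulmxA [LHS]mulmxA PX.
rewrite -[LHS]mulmxA [X in _ *m X]mulmxA (blockdiag_invgramC oX)//.
by rewrite /blockproj -blockdiagM !mulmxA.
Qed.

Lemma blockproj_nestedC T G f g : T \subset G -> gram X G \in unitmx ->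
  P T g *m P G f = P T (f \* g).
Proof.
move=> TG uG; have uT := gram_unit_sub TG uG.
rewrite -[LHS]trmxK trmx_mul !(blockproj_tr oX)// blockproj_nested//.
by rewrite (blockproj_tr oX).
Qed.

(** As [f] takes the values 0 and 1 and vanishes on the blocks of the added predictors, the weighted
    columns of [G] are those of [T], padded with zero columns. *)
Lemma blockproj_eq T G f : T \subset G -> gram X G \in unitmx ->
  (forall j, j \in G :\: T -> f (blk j) = 0) -> (forall b, f b * f b = f b) ->
  P G f = P T f.
Proof.
move=> TG uG fG ff; have uT := gram_unit_sub TG uG.
have fE : f \* f = f by apply/funext.
have XG : Xsub X G *m blockdiag blk G f = Xsub X T *m blockdiag blk T f *m (incl T G)^T.
  apply/matrixP => i j; rewrite !mul_mx_diag !mxE.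
  under eq_bigr do rewrite !mxE.
  have [jT|jT] := boolP (enum_val j \in T); last first.
    rewrite fG ?mulr0; last by rewrite inE jT enum_valP.
    rewrite big1// => l _; case: eqP => [jl|_]; last by rewrite mulr0.
    by move: jT; rewrite jl enum_valP.
  under eq_bigr do rewrite eq_sym.
  by rewrite (sum_enum_val (fun l => X i l * f (blk l))).
have PTG : P T f *m P G f = P G f.
  have -> : P G f = Xsub X G *m blockdiag blk G f *m invmx (gram X G) *m (Xsub X G)^T.
    by rewrite /blockproj -[_ *m invmx _ *m _]mulmxA -(blockdiag_invgramC oX)// mulmxA.
  rewrite !mulmxA; congr (_ *m _ *m _).
  by rewrite -[LHS]mulmxA XG !mulmxA (blockproj_sub oX)// -(mulmxA (Xsub X T) (blockdiag blk T f) (blockdiag blk T f)) blockdiagM fE.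
by rewrite -PTG blockproj_nestedC// fE.
Qed.

Lemma idem_dot (A : 'M[R]_n) e : A^T = A -> A *m A = A ->
  dot e (A *m e) = dot (A *m e) (A *m e).
Proof. by move=> sA iA; rewrite [RHS]dotMl sA mulmxA iA. Qed.

(** Pythagoras: for nested orthogonal projections [B - A] is again an orthogonal projection. *)
Lemma idem_le (A B : 'M[R]_n) e : A^T = A -> A *m A = A -> B^T = B -> B *m B = B ->
  B *m A = A -> dot e (B *m e) - dot e (A *m e) = dot ((B - A) *m e) ((B - A) *m e) .
Proof.
move=> sA iA sB iB BA; rewrite -idem_dot.
- by rewrite mulmxBl dotDr dotNr.
- by rewrite linearB /= sA sB.
have AB : A *m B = A by rewrite -[LHS]trmxK trmx_mul sA sB BA sA.
by rewrite mulmxBl !mulmxBr iA iB BA AB subrr subr0.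
Qed.

Lemma idem_dot_le (A B : 'M[R]_n) e : A^T = A -> A *m A = A -> B^T = B -> B *m B = B ->
  B *m A = A -> dot e (A *m e) <= dot e (B *m e).
Proof.
by move=> sA iA sB iB BA; rewrite -subr_ge0 idem_le// dot_ge0.
Qed.

Lemma delta_idem b : delta b \* delta b = delta b.
Proof. by apply/funext => c /=; case: eqP; rewrite ?mulr1 ?mulr0. Qed.

Lemma blockproj_idem G f : gram X G \in unitmx -> f \* f = f -> P G f *m P G f = P G f.
Proof. by move=> uG ff; rewrite (blockprojM oX)// ff. Qed.

End nested_designs.

(** * Sums of squares split into signal and noise *)

Section regression_decomposition.
Variables (R : realType) (n p k : nat) (blk : 'I_p -> 'I_k) (X : 'M[R]_(n, p)).
Variables (al : R) (beta : 'cV[R]_p).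
Implicit Types (G : {set 'I_p}) (f g : 'I_k -> R) (b : 'I_k) (e : 'cV[R]_n).
Local Notation P := (blockproj blk X).
Local Notation delta := (fun b c : 'I_k => (c == b)%:R : R).
Local Notation one := (const_mx 1 : 'cV[R]_n).
Local Notation full := [set: 'I_p]%SET.
Local Notation cst1 := (fun=> 1 : R).
Local Notation T := [set j | beta j 0 != 0]%SET.
Hypothesis n0 : (0 < n)%N.
Hypothesis cX : forall j : 'I_p, \sum_i X i j = 0.
Hypothesis oX : forall j l : 'I_p, blk j != blk l -> \sum_i X i j * X i l = 0.
Hypothesis uF : gram X full \in unitmx.

Let m := X *m beta.
Let y e : 'cV[R]_n := al *: one + m + e.

Definition masked f : 'cV[R]_n := X *m (\col_j (f (blk j) * beta j 0)).
(** [Rspan] and [Rmean] are the squared lengths of the projections of the noise onto the span of all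
    columns and onto the constants. Unlike [dot e e] they stay bounded in probability. *)
Definition Rspan e : R := dot e (P full cst1 *m e).
Definition Rmean e : R := dot one e ^+ 2 / n%:R.

Let uG G : gram X G \in unitmx.
Proof. by apply: (gram_unit_sub _ uF); apply/fintype.subsetP => j _; rewrite inE. Qed.

Let sub_full G : G \subset full.
Proof. by apply/fintype.subsetP => j _; rewrite inE. Qed.

Let sP G f : (P G f)^T = P G f. Proof. exact: (blockproj_tr oX). Qed.

Let iP G f : f \* f = f -> P G f *m P G f = P G f.
Proof. exact: (blockproj_idem oX). Qed.

Let i1 : cst1 \* cst1 = cst1 :> ('I_k -> R).
Proof. by apply/funext => c /=; rewrite mulr1. Qed.

Lemma masked_sub G f : T \subset G ->
  masked f = Xsub X G *m (blockdiag blk G f *m \col_j beta (enum_val j) 0).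
Proof.
move=> TG; apply/colP => i; rewrite mul_diag_mx !mxE.
under [RHS]eq_bigr do rewrite !mxE.
rewrite -(big_enum_val (fun j => X i j * (f (blk j) * beta j 0))) /=.
rewrite (bigID (fun j => j \in G)) /= [X in _ + X = _]big1 ?addr0.
  by apply: eq_bigr => j _; rewrite !mxE.
move=> j jG; rewrite mxE; have [->|bj] := eqVneq (beta j 0) 0; first by rewrite !mulr0.
by move: jG; rewrite (fintype.subsetP TG)// inE.
Qed.

Lemma masked1 : masked cst1 = m.
Proof. by congr (_ *m _); apply/colP => j; rewrite !mxE mul1r. Qed.

Lemma blockproj_masked G f g : T \subset G -> P G f *m masked g = masked (f \* g).
Proof.
move=> TG; rewrite !(masked_sub _ TG) mulmxA (blockproj_sub oX)//.
by rewrite -mulmxA [blockdiag _ _ f *m _]mulmxA blockdiagM.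
Qed.

Let P1 G f : P G f *m one = 0. Proof. exact: blockproj_one. Qed.

Let dot_one_m : dot one m = 0.
Proof.
rewrite dotMr (_ : X^T *m one = 0) ?dot0l//.
apply/colP => j; rewrite !mxE -[RHS](cX j); apply: eq_bigr => i _.
by rewrite !mxE mulr1.
Qed.

Let Py G f e : P G f *m y e = P G f *m m + P G f *m e.
Proof. by rewrite /y !mulmxDr -scalemxAr P1 scaler0 add0r. Qed.

Let dot_one_P G f e : dot one (P G f *m e) = 0.
Proof. by rewrite dotMr sP P1 dot0l. Qed.

Lemma dot_blockproj_y G f e :
  dot (y e) (P G f *m y e) = dot (m + e) (P G f *m (m + e)).
Proof. by rewrite Py -mulmxDr /y -addrA dotDl dotZl dot_one_P mulr0 add0r. Qed.

Definition resid G : 'cV[R]_n := m - P G cst1 *m m.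

Lemma rss_expand G e : ctot (y e) - \sum_b Qblk blk X G (y e) b =
  dot (resid G) (resid G) + 2 * dot (resid G) e + ctot e - dot e (P G cst1 *m e).
Proof.
have <- : dot (y e) (P G cst1 *m y e) = \sum_b Qblk blk X G (y e) b.
  by rewrite (blockproj_Qblk _ _ _ _ cst1); apply: eq_bigr => b _; rewrite mul1r.
have nR : n%:R != 0 :> R by rewrite pnatr_eq0 -lt0n.
rewrite dot_blockproj_y /ctot /resid /y.
rewrite mulmxDr !(dotDl, dotDr, dotNl, dotNr, dotZl, dotZr).
rewrite (dotC m one) (dotC e one) dot_one_m (dotC e m) dot_one.
rewrite -(idem_dot m (sP G cst1) (iP _ i1)).
have -> : dot (P G cst1 *m m) m = dot m (P G cst1 *m m) by rewrite dotC.
have -> : dot (P G cst1 *m m) e = dot e (P G cst1 *m m) by rewrite dotC.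
have -> : dot m (P G cst1 *m e) = dot e (P G cst1 *m m).
  by rewrite dotMr sP dotC.
by field.
Qed.

Lemma blockproj_le_Rspan G f e : f \* f = f -> dot e (P G f *m e) <= Rspan e.
Proof.
move=> ff; apply: idem_dot_le => //; rewrite ?iP//.
rewrite (blockproj_nested oX)//; congr (P G _).
by apply/funext => c /=; rewrite mul1r.
Qed.

Lemma blockproj_dot_ge0 G f e : f \* f = f -> 0 <= dot e (P G f *m e).
Proof. by move=> ff; rewrite (idem_dot _ (sP G f))// ?dot_ge0// iP. Qed.

Lemma rss_true e : ctot (y e) - \sum_b Qblk blk X T (y e) b =
  dot e e - Rmean e - dot e (P T cst1 *m e).
Proof.
rewrite rss_expand (_ : resid T = 0); first by rewrite !dot0l /ctot /Rmean; ring.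
by rewrite /resid -masked1 blockproj_masked// i1 subrr.
Qed.

Lemma rss_true_bounds e :
  dot e e - Rmean e - Rspan e <= ctot (y e) - \sum_b Qblk blk X T (y e) b <= dot e e.
Proof.
rewrite rss_true lerB ?blockproj_le_Rspan//=.
have := blockproj_dot_ge0 T e i1.
have : 0 <= Rmean e by rewrite divr_ge0// sqr_ge0.
by lra.
Qed.

(** The residual signal lies in the span of all columns, so its scalar product with [e] sees only
    the projected noise. The square of [w + 2 v] absorbs the cross term at the price of half the
    signal and two [Rspan]; the third pays for the projection of the noise onto [G]. *)
Lemma rss_missing_lb G e : 2^-1 * dot (resid G) (resid G) + dot e e - Rmean e - 3 * Rspan e
  <= ctot (y e) - \sum_b Qblk blk X G (y e) b.
Proof.
rewrite rss_expand; have H1 := blockproj_le_Rspan G e i1.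
have mfull : P full cst1 *m m = m.
  by rewrite -masked1 blockproj_masked// i1.
have wfull : P full cst1 *m resid G = resid G.
  rewrite /resid mulmxBr mfull mulmxA (blockproj_nested oX)//.
  by rewrite (_ : cst1 \* cst1 = cst1).
have wE : dot (resid G) e = dot (resid G) (P full cst1 *m e).
  by rewrite dotMr sP wfull.
have key (w v : 'cV[R]_n) : 0 <= dot w w + 4 * dot w v + 4 * dot v v.
  have := dot_ge0 (w + 2 *: v).
  by rewrite !(dotDl, dotDr, dotZl, dotZr) (dotC v w); lra.
have := key (resid G) (P full cst1 *m e).
have Re : Rspan e = dot (P full cst1 *m e) (P full cst1 *m e).
  by rewrite /Rspan (idem_dot _ (sP full cst1) (iP _ i1)).
rewrite -Re -wE.
move: H1; rewrite /ctot -/(Rmean e); lra.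
Qed.

(** [Qblk] is the squared length of block signal plus projected noise, and [|u|^2 / 2 - |v|^2 <= |u
    + v|^2 <= 2 |u|^2 + 2 |v|^2]. *)
Lemma Qblk_true_bounds b e :
  2^-1 * dot (masked (delta b)) (masked (delta b)) - Rspan e <= Qblk blk X T (y e) b /\
  Qblk blk X T (y e) b <= 2 * dot (masked (delta b)) (masked (delta b)) + 2 * Rspan e.
Proof.
have dd := delta_idem R b.
have -> : Qblk blk X T (y e) b =
    dot (masked (delta b) + P T (delta b) *m e) (masked (delta b) + P T (delta b) *m e).
  rewrite /Qblk (idem_dot _ (sP T _) (iP _ dd)) Py -masked1 !blockproj_masked//.
  by rewrite (_ : delta b \* cst1 = delta b)//; apply/funext => c /=; rewrite mulr1.
have H := blockproj_le_Rspan T e dd; move: H.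
rewrite (idem_dot _ (sP T _) (iP _ dd)).
move: (masked _) (P T _ *m e) => u v.
have := dot_ge0 (u - v); have := dot_ge0 (u + 2 *: v).
rewrite !(dotDl, dotDr, dotZl, dotZr, dotNl, dotNr) (dotC v u); lra.
Qed.

(** Both projections reproduce the block signal, so the difference of the two sums of squares
    depends on the noise only. *)
Lemma Qblk_nested b e G : T \subset G ->
  Qblk blk X T (y e) b <= Qblk blk X G (y e) b <= Qblk blk X T (y e) b + Rspan e.
Proof.
move=> TG; have dd := delta_idem R b.
have PGT : P G (delta b) *m P T (delta b) = P T (delta b).
  by rewrite (blockproj_nested oX)// dd.
have D : Qblk blk X G (y e) b - Qblk blk X T (y e) b =
    dot e (P G (delta b) *m e) - dot e (P T (delta b) *m e).
  rewrite /Qblk !(idem_le _ (sP T _) (iP _ dd) (sP G _) (iP _ dd) PGT).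
  have -> : (P G (delta b) - P T (delta b)) *m y e = (P G (delta b) - P T (delta b)) *m e.
    rewrite !mulmxBl !Py -masked1 !blockproj_masked//.
    by rewrite opprD addrACA subrr add0r.
  by [].
have D0 : 0 <= Qblk blk X G (y e) b - Qblk blk X T (y e) b.
  by rewrite /Qblk (idem_le _ (sP T _) (iP _ dd) (sP G _) (iP _ dd) PGT) dot_ge0.
have := blockproj_dot_ge0 T e dd; have := blockproj_le_Rspan G e dd.
by move: D D0; lra.
Qed.

Lemma Qblk_outside b e G : T \subset G -> b \notin blk @: T ->
  Qblk blk X T (y e) b = 0 /\ Qblk blk X G (y e) b = dot e (P G (delta b) *m e).
Proof.
move=> TG bT; have nT j : j \in T -> (blk j == b) = false.
  by move=> jT; apply: contraNF bT => /eqP <-; exact: imset_f.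
have m0 : masked (delta b) = 0.
  rewrite /masked (_ : \col__ _ = 0) ?mulmx0//; apply/colP => j; rewrite !mxE.
  have [->|bj] := eqVneq (beta j 0) 0; first by rewrite mulr0.
  by rewrite nT ?mul0r// inE.
have d0 : blockdiag blk T (delta b) = 0.
  apply/matrixP => i j; rewrite !mxE nT ?mul0rn//; exact: enum_valP.
split; first by rewrite /Qblk /blockproj d0 mulmx0 mul0mx mul0mx dot0r.
rewrite /Qblk dot_blockproj_y.
have Pm : P G (delta b) *m m = 0.
  rewrite -masked1 blockproj_masked// -m0; congr masked.
  by apply/funext => c /=; rewrite mulr1.
by rewrite mulmxDr Pm add0r dotDl dotMr sP Pm dot0l add0r.
Qed.

Lemma Qblk_same b e G : T \subset G -> (forall j, j \in G :\: T -> blk j != b) ->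
  Qblk blk X G (y e) b = Qblk blk X T (y e) b /\
  blocksize blk G b = blocksize blk T b.
Proof.
move=> TG GT; split.
  rewrite /Qblk (blockproj_eq oX TG)// => [j jGT|c].
    by rewrite (negPf (GT j jGT)).
  by case: eqP; rewrite ?mulr1 ?mulr0.
apply: eq_card => j; rewrite [in LHS]inE [in RHS]inE.
have [jb|] := eqVneq (blk j) b; rewrite ?andbF// !andbT.
apply/idP/idP => [jG|jT]; last exact: (fintype.subsetP TG).
by apply/negPn/negP => jT; have := GT j; rewrite [in X in X -> _]inE jT jG jb eqxx => /(_ isT).
Qed.

Lemma blocksize_outside b : b \notin blk @: T -> blocksize blk T b = 0.
Proof.
move=> bT; apply/eqP; rewrite cards_eq0; apply/eqP/setP => j; rewrite [LHS]inE [RHS]inE.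
by apply/negP => /andP[jT /eqP jb]; move: bT; rewrite -jb imset_f.
Qed.

End regression_decomposition.

(** * Concentration of the noise by Gaussian tests *)

Section concentration.
Variable R : realType.

(** Two factorisations of one block matrix. It reduces determinants of size [n] to determinants
    whose size is the number of predictors. *)
Lemma det_sylvester m n (A : 'M[R]_(m, n)) (B : 'M[R]_(n, m)) :
  \det (1%:M + A *m B) = \det (1%:M + B *m A).
Proof.
have E1 : block_mx 1%:M (- A) B 1%:M =
    block_mx 1%:M 0 B 1%:M *m block_mx 1%:M (- A) 0 (1%:M + B *m A).
  rewrite mulmx_block !mul1mx !mul0mx !addr0 mulmx1 mulmxN addrCA.
  by rewrite addNr addr0.
have E2 : block_mx 1%:M (- A) B 1%:M =
    block_mx (1%:M + A *m B) (- A) 0 1%:M *m block_mx 1%:M 0 B 1%:M.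
  by rewrite mulmx_block !mulmx1 !mulmx0 !mul1mx !add0r mulNmx addrK.
have := congr1 determinant E1; rewrite E2 !det_mulmx !det_lblock !det_ublock.
by rewrite !det1 !mul1r !mulr1.
Qed.

Variables (n p k : nat) (blk : 'I_p -> 'I_k) (X : 'M[R]_(n, p)).
Implicit Types (G : {set 'I_p}) (f : 'I_k -> R) (e : 'cV[R]_n).
Local Notation P := (blockproj blk X).
Local Notation delta := (fun b c : 'I_k => (c == b)%:R : R).
Local Notation one := (const_mx 1 : 'cV[R]_n).
Local Notation full := [set: 'I_p]%SET.
Hypothesis n0 : (0 < n)%N.
Hypothesis oX : forall j l : 'I_p, blk j != blk l -> \sum_i X i j * X i l = 0.

Lemma det_1_blockproj G f : gram X G \in unitmx ->
  \det (1%:M + P G f) = \prod_b (1 + f b) ^+ blocksize blk G b.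
Proof.
move=> uG; rewrite /blockproj det_sylvester.
have -> : (Xsub X G)^T *m (Xsub X G *m invmx (gram X G) *m blockdiag blk G f) =
    blockdiag blk G f.
  by rewrite !mulmxA -/(gram X G) mulmxV// mul1mx.
rewrite -det_blockdiag; congr (\det _); apply/matrixP => i j; rewrite !mxE.
by rewrite mulrnDl.
Qed.

Lemma dot_blockproj_sum G f e :
  dot e (P G f *m e) = \sum_b f b * dot e (P G (delta b) *m e).
Proof. exact: blockproj_Qblk. Qed.

Lemma idem_dot_le1 (A : 'M[R]_n) e : A^T = A -> A *m A = A ->
  dot e (A *m e) <= dot e e.
Proof.
move=> sA iA; have := @idem_dot_le _ _ A 1%:M e sA iA.
by rewrite !mul1mx trmx1; exact.
Qed.

(** The eigenvalues of [P G f] lie among 0 and the [f b], all at least [- r > - 1]. *)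
Lemma pd_1_blockproj G f (r : R) : gram X G \in unitmx -> 0 <= r -> r < 1 ->
  (forall b, - r <= f b) -> pd (1%:M + P G f).
Proof.
move=> uG r0 r1 fr; split; first by rewrite linearD /= trmx1 (blockproj_tr oX).
move=> x x0; rewrite mulmxDl mul1mx dotDr dot_blockproj_sum.
have sP h : (P G h)^T = P G h by exact: (blockproj_tr oX).
have P0 b : 0 <= dot x (P G (delta b) *m x).
  rewrite (idem_dot _ (sP _)) ?dot_ge0// (blockproj_idem oX)//; exact: delta_idem.
have H1 : - r * dot x (P G (fun=> 1) *m x) <= \sum_b f b * dot x (P G (delta b) *m x).
  rewrite dot_blockproj_sum mulr_sumr; apply: ler_sum => b _; rewrite mul1r.
  exact: ler_wpM2r.
have H2 : dot x (P G (fun=> 1) *m x) <= dot x x.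
  apply: idem_dot_le1 => //; rewrite (blockproj_idem oX)//.
  by apply/funext => c /=; rewrite mulr1.
have xx := dot_gt0 x0; have H3 := ler_wpM2l r0 H2.
have : 0 < (1 - r) * dot x x by rewrite mulr_gt0// subr_gt0.
by move: H1 H3; lra.
Qed.

Definition meanproj : 'M[R]_n := n%:R^-1 *: (one *m one^T).

Lemma meanproj_dot e : dot e (meanproj *m e) = dot one e ^+ 2 / n%:R.
Proof.
rewrite /meanproj -scalemxAl dotZr -mulmxA trmx_mulE mul_mx_scalar dotZr (dotC e).
by rewrite mulrC expr2.
Qed.

Lemma meanproj_tr : meanproj^T = meanproj.
Proof. by rewrite /meanproj linearZ /= trmx_mul trmxK. Qed.

Lemma meanproj_idem : meanproj *m meanproj = meanproj.
Proof.
rewrite /meanproj -scalemxAl -scalemxAr -mulmxA (mulmxA one^T) trmx_mulE.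
rewrite mul_scalar_mx -!scalemxAr dot_one scalerA mulVf ?scale1r//.
by rewrite pnatr_eq0 -lt0n.
Qed.

Lemma pd_1_meanproj : pd (1%:M + (- 2^-1) *: meanproj).
Proof.
split; first by rewrite linearD linearZ /= trmx1 meanproj_tr.
move=> x x0; rewrite mulmxDl mul1mx -scalemxAl dotDr dotZr.
have := idem_dot_le1 x meanproj_tr meanproj_idem; have := dot_gt0 x0.
by lra.
Qed.

Lemma det_1_meanproj : \det (1%:M + (- 2^-1) *: meanproj) = 2^-1.
Proof.
rewrite /meanproj scalerA scalemxAl det_sylvester -scalemxAr trmx_mulE det_mx11 !mxE.
rewrite eqxx mulr1n dot_one mulr1n.
by field; rewrite pnatr_eq0 -lt0n.
Qed.

Variable tau : R.
Hypothesis tau0 : 0 < tau.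
Hypothesis uF : gram X full \in unitmx.

(** The later estimates of the sums of squares use these three bounds and nothing else about the
    noise. *)
Definition good_noise (d M : R) e :=
  [&& `|dot e e - n%:R * tau| <= n%:R * d, Rmean e <= M & Rspan blk X e <= M].

(** Exponential Markov bound for [dot e e] at the optimal parameter. For [x > 0] the term reaches 1
    exactly when [dot e e >= n tau (1 + x)]; for [- 1 < x < 0] it bounds the lower tail in the same
    way. *)
Let sphere_term (x : R) : R * 'M[R]_n :=
  (expR (- (n%:R * x / 2)), (- (x / (1 + x))) *: 1%:M).

(** The matrix [- 1/2] times a projection yields [exp(r / (4 tau))] with [r] the squared projection,
    so the term reaches 1 as soon as [r] reaches [M]. The same holds for [span_term]. *)
Let mean_term (M : R) : R * 'M[R]_n := (expR (- (M / (4 * tau))), (- 2^-1) *: meanproj).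

Let span_term (M : R) : R * 'M[R]_n := (expR (- (M / (4 * tau))), P full (fun=> - 2^-1)).

Let sphere_pd x : -1 < x -> pd (1%:M + (sphere_term x).2).
Proof.
move=> x1; have x10 : 0 < 1 + x by move: x1; lra.
rewrite /= -{1}[1%:M]scale1r -scalerDl (_ : 1 + _ = (1 + x)^-1); last first.
  by field; rewrite gt_eqF.
split; first by rewrite linearZ /= trmx1.
by move=> y y0; rewrite -scalemxAl mul1mx dotZr mulr_gt0 ?invr_gt0// dot_gt0.
Qed.

Let sphere_val x : -1 < x ->
  (sphere_term x).1 * \det (1%:M + (sphere_term x).2) `^ (- 1 / 2) =
  expR (n%:R / 2 * (ln (1 + x) - x)).
Proof.
move=> x1; have x10 : 0 < 1 + x by move: x1; lra.
rewrite /= -{1}[1%:M]scale1r -scalerDl (_ : 1 + _ = (1 + x)^-1); last first.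
  by field; rewrite gt_eqF.
rewrite scalemx1 det_scalar -powR_mulrn ?invr_ge0 ?(ltW x10)// -powRrM.
rewrite /powR gt_eqF ?invr_gt0// -expRD lnV ?posrE//; congr expR.
by field.
Qed.

Let span_pd M : pd (1%:M + (span_term M).2).
Proof.
apply: (@pd_1_blockproj _ _ 2^-1) => //; first by rewrite invf_lt1// ltr1n.
Qed.

(* Chernoff bounds: both deviations of the chi-square variable [dot e e / tau]
   and the two projected chi-square variables. *)
Lemma bad_noise_test (d M : R) : 0 < d -> d < tau -> exists s : seq (R * 'M[R]_n),
  [/\ twf s, (forall e, 0 <= tev tau s e),
    (forall e, ~~ good_noise d M e -> 1 <= tev tau s e) &
    tval s = expR (n%:R / 2 * (ln (1 + d / tau) - d / tau)) +
      expR (n%:R / 2 * (ln (1 - d / tau) + d / tau)) +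
      expR (- (M / (4 * tau))) * (2^-1 `^ (- 1 / 2) + (2^-1 ^+ p) `^ (- 1 / 2))].
Proof.
move=> d0 dtau; pose x := d / tau.
have x0 : 0 < x by rewrite divr_gt0.
have x1 : x < 1 by rewrite ltr_pdivrMr// mul1r.
have xm1 : -1 < x by exact: lt_trans x0.
have mx1 : -1 < - x by rewrite ltrN2.
pose s := [:: sphere_term x; sphere_term (- x); mean_term M; span_term M].
have s0 i : i \in s -> 0 <= i.1.
  by rewrite !inE => /or4P[] /eqP ->; exact: expR_ge0.
have t0 i e : i \in s -> 0 <= i.1 * expR (- (dot e (i.2 *m e) / (2 * tau))).
  by move=> si; rewrite mulr_ge0 ?expR_ge0 ?s0.
exists s; split.
- move=> i; rewrite !inE => /or4P[] /eqP ->; [exact: sphere_pd|exact: sphere_pd| |exact: span_pd].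
  exact: pd_1_meanproj.
- by move=> e; rewrite /tev big_seq sumr_ge0// => i si; exact: t0.
- move=> e bad.
  suff [i si i1] : exists2 i, i \in s & 1 <= i.1 * expR (- (dot e (i.2 *m e) / (2 * tau))).
    pose v i : R := i.1 * expR (- (dot e (i.2 *m e) / (2 * tau))).
    have -> : tev tau s e = v (sphere_term x) + (v (sphere_term (- x)) +
        (v (mean_term M) + v (span_term M))).
      by rewrite /tev !big_cons big_nil addr0.
    have q j (sj : j \in s) : 0 <= v j := t0 j e sj.
    have q1 : 0 <= v (sphere_term x) by apply: q; rewrite inE eqxx.
    have q2 : 0 <= v (sphere_term (- x)) by apply: q; rewrite !inE eqxx orbT.
    have q3 : 0 <= v (mean_term M) by apply: q; rewrite !inE eqxx !orbT.
    have q4 : 0 <= v (span_term M) by apply: q; rewrite !inE eqxx !orbT.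
    move: si i1; rewrite -/(v i) !inE => /or4P[] /eqP ->; move: q1 q2 q3 q4;
      move: (v _) (v _) (v _) (v _) => v1 v2 v3 v4 *; lra.
  have e1 (z : R) : 0 <= z -> 1 <= expR z by move=> z0; rewrite -[leLHS]expR0 ler_expR.
  move: bad; rewrite /good_noise !negb_and -!ltNge => /or3P[].
  + rewrite ltr_normr => /orP[H|H].
    * exists (sphere_term x); first by rewrite mem_head.
      rewrite /= -scalemxAl mul1mx dotZr -expRD; apply: e1.
      have -> : - (n%:R * x / 2) - - (x / (1 + x)) * dot e e / (2 * tau) =
         x / (1 + x) / (2 * tau) * (dot e e - n%:R * tau - n%:R * d).
        by rewrite /x; field; rewrite !gt_eqF// addr_gt0.
      by rewrite mulr_ge0 ?subr_ge0 ?(ltW H)// !divr_ge0 ?mulr_ge0 ?addr_ge0 ?(ltW x0)// ltW.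
    * exists (sphere_term (- x)); first by rewrite !inE eqxx orbT.
      rewrite /= -scalemxAl mul1mx dotZr -expRD; apply: e1.
      have xp : 0 < 1 - x by rewrite subr_gt0.
      have td : 0 < tau - d by rewrite subr_gt0.
      have -> : - (n%:R * - x / 2) - - (- x / (1 - x)) * dot e e / (2 * tau) =
         x / (1 - x) / (2 * tau) * (- (dot e e - n%:R * tau) - n%:R * d).
        by rewrite /x; field; rewrite !gt_eqF.
      by rewrite mulr_ge0 ?subr_ge0 ?(ltW H)// !divr_ge0 ?mulr_ge0 ?(ltW xp) ?(ltW x0)// ltW.
  + move=> H; exists (mean_term M); first by rewrite !inE eqxx !orbT.
    rewrite /= -scalemxAl dotZr meanproj_dot -/(Rmean e) -expRD; apply: e1.
    have -> : - (M / (4 * tau)) - - 2^-1 * Rmean e / (2 * tau) = (Rmean e - M) / (4 * tau).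
      by field; rewrite gt_eqF.
    by rewrite divr_ge0 ?subr_ge0 ?(ltW H)// mulr_ge0// ltW.
  move=> H; exists (span_term M); first by rewrite !inE eqxx !orbT.
  rewrite /= -expRD; apply: e1.
  have -> : dot e (P full (fun=> - 2^-1) *m e) = - 2^-1 * Rspan blk X e.
    rewrite /Rspan !dot_blockproj_sum mulr_sumr; apply: eq_bigr => b _.
    by rewrite mul1r.
  have -> : - (M / (4 * tau)) - - 2^-1 * Rspan blk X e / (2 * tau) = (Rspan blk X e - M) / (4 * tau).
    by field; rewrite gt_eqF.
  by rewrite divr_ge0 ?subr_ge0 ?(ltW H)// mulr_ge0// ltW.
pose v (i : R * 'M[R]_n) : R := i.1 * \det (1%:M + i.2) `^ (- 1 / 2).
have -> : tval s = v (sphere_term x) + (v (sphere_term (- x)) +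
    (v (mean_term M) + v (span_term M))).
  rewrite -[tval s]/(\sum_(i <- s) v i); move: v => v.
  by rewrite !big_cons big_nil addr0.
have v3 : v (mean_term M) = expR (- (M / (4 * tau))) * 2^-1 `^ (- 1 / 2).
  by rewrite /v [X in \det X]/= det_1_meanproj.
have v4 : v (span_term M) = expR (- (M / (4 * tau))) * (2^-1 ^+ p) `^ (- 1 / 2).
  rewrite /v [X in \det X]/= (det_1_blockproj _ uF).
  have -> : 1 - 2^-1 = 2^-1 :> R by field.
  rewrite -(@prod_blockE R p k blk full (fun=> 2^-1)) prodr_const card_ord.
  by rewrite cardsT card_ord.
have v1 : v (sphere_term x) = expR (n%:R / 2 * (ln (1 + x) - x)) := sphere_val xm1.
have v2 : v (sphere_term (- x)) = expR (n%:R / 2 * (ln (1 - x) + x)).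
  by rewrite -[X in _ + X]opprK; exact: sphere_val mx1.
rewrite v1 v2 v3 v4 -/x; move: (expR _) (expR _) (expR _) => A B C.
by rewrite mulrDr !addrA.
Qed.

End concentration.

(** * Bernstein polynomials in several variables *)

Section polynomial_approximation.
Variables (R : realType) (k : nat).
Implicit Types (u v : 'I_k -> R) (s : seq (R * ('I_k -> nat))) (m : 'I_k -> nat).

(** Polynomials as lists of coefficients and exponent vectors: in the variables [exp(- x_b)] each
    monomial will become one Gaussian kernel. *)
Definition peval s u : R := \sum_(i <- s) i.1 * \prod_b u b ^+ i.2 b.

Definition polyfun (F : ('I_k -> R) -> R) := exists s, F = peval s.

Lemma polyfun_cst (c : R) : polyfun (fun=> c).
Proof.
exists [:: (c, fun=> 0%N)]; apply/funext => u; rewrite /peval big_seq1 /=.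
by rewrite big1 ?mulr1.
Qed.

Lemma polyfun_var b : polyfun (fun u => u b).
Proof.
exists [:: (1, fun c => (c == b) : nat)]; apply/funext => u; rewrite /peval big_seq1 /= mul1r.
rewrite (bigD1 b)//= eqxx expr1 big1 ?mulr1// => c /negPf cb.
by rewrite cb.
Qed.

Lemma polyfunD F1 F2 : polyfun F1 -> polyfun F2 -> polyfun (fun u => F1 u + F2 u).
Proof.
move=> [s1 ->] [s2 ->]; exists (s1 ++ s2); apply/funext => u.
by rewrite /peval big_cat.
Qed.

Lemma polyfunM F1 F2 : polyfun F1 -> polyfun F2 -> polyfun (fun u => F1 u * F2 u).
Proof.
move=> [s1 ->] [s2 ->].
exists [seq (i.1 * j.1, fun b => (i.2 b + j.2 b)%N) | i <- s1, j <- s2].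
apply/funext => u; rewrite /peval big_allpairs_dep /= mulr_suml.
apply: eq_bigr => i _; rewrite mulr_sumr; apply: eq_bigr => j _ /=.
under [in RHS]eq_bigr do rewrite exprD.
by rewrite big_split /= mulrACA.
Qed.

(* Expectation of [F] at the end of a random walk started at [m]: the walk
   visits the coordinates listed in [l] and at each visit of [b] adds one to
   the coordinate [b] with probability [u b]. *)
Fixpoint walk (l : seq 'I_k) (F : ('I_k -> nat) -> R) (m : 'I_k -> nat) u : R :=
  if l is b :: l' then
    u b * walk l' F (fun c => (m c + (c == b))%N) u + (1 - u b) * walk l' F m u
  else F m.

Lemma polyfun_walk l F m : polyfun (walk l F m).
Proof.
elim: l m => [|b l IH] m /=; first exact: polyfun_cst.
apply: polyfunD; apply: polyfunM => //; first exact: polyfun_var.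
have [s sE] := polyfunM (polyfun_cst (-1)) (polyfun_var b).
have [s' s'E] := polyfunD (polyfun_cst 1) (polyfunM (polyfun_cst (-1)) (polyfun_var b)).
by exists s'; rewrite -s'E; apply/funext => u; rewrite mulN1r.
Qed.

Definition cube u := forall b, 0 <= u b <= 1.

Lemma walk_le l F1 F2 m u : cube u -> (forall m, F1 m <= F2 m) ->
  walk l F1 m u <= walk l F2 m u.
Proof.
move=> uc F12; elim: l m => [|b l IH] m /=; first exact: F12.
have /andP[u0 u1] := uc b.
by apply: lerD; apply: ler_wpM2l => //; rewrite subr_ge0.
Qed.

Lemma walkD l F1 F2 m u :
  walk l (fun m => F1 m + F2 m) m u = walk l F1 m u + walk l F2 m u.
Proof. by elim: l m => [//|b l IH] m /=; rewrite !IH; ring. Qed.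

Lemma walkZ l F (c : R) m u : walk l (fun m => c * F m) m u = c * walk l F m u.
Proof. by elim: l m => [//|b l IH] m /=; rewrite !IH; ring. Qed.

Lemma walk_cst l (c : R) m u : walk l (fun=> c) m u = c.
Proof. by elim: l m => [//|b l IH] m /=; rewrite !IH; ring. Qed.

Lemma walk_sum l (I : Type) (r : seq I) (F : I -> ('I_k -> nat) -> R) m u :
  walk l (fun m => \sum_(i <- r) F i m) m u = \sum_(i <- r) walk l (F i) m u.
Proof.
elim: r => [|i r IH].
  rewrite big_nil (_ : (fun _ => _) = fun=> 0) ?walk_cst//.
  by apply/funext => m'; rewrite big_nil.
rewrite big_cons -IH -walkD; congr walk; apply/funext => m'.
by rewrite big_cons.
Qed.

(** The number of steps in coordinate [b] is binomial: squared bias plus variance. *)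
Lemma walk_sqr l b (x : R) m u : walk l (fun m => ((m b)%:R - x) ^+ 2) m u =
  ((m b)%:R + (count_mem b l)%:R * u b - x) ^+ 2 + (count_mem b l)%:R * (u b * (1 - u b)).
Proof.
elim: l m => [|c l IH] m /=; first by rewrite !mul0r !addr0.
rewrite !IH eq_sym; have [->|_] := eqVneq b c; rewrite ?addn0 ?add0n ?natrD /=; ring.
Qed.

(** The [walk] with [N] visits to each coordinate produces the Bernstein polynomial of [phi]; the
    Lipschitz bound reduces its error to the variances of binomial proportions. *)
Lemma polynomial_approximation (phi : ('I_k -> R) -> R) (L eps : R) :
  0 <= L -> 0 < eps ->
  (forall u v, `|phi u - phi v| <= L * \sum_b `|u b - v b|) ->
  exists s, forall u, cube u -> `|peval s u - phi u| <= eps.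
Proof.
move=> L0 e0 lip; pose eta := eps / (2 * (L * k%:R + 1)).
have Lk0 : 0 <= L * k%:R by rewrite mulr_ge0.
have Lk1 : 0 < L * k%:R + 1 by rewrite ltr_wpDl.
have eta0 : 0 < eta by rewrite divr_gt0// mulr_gt0.
(* Makes the variance term [1 / (N eta)] at most [eta]. *)
pose N := (Num.truncn (eta ^- 2)).+1.
have N0 : 0 < N%:R :> R by rewrite ltr0n.
have Neta : N%:R^-1 / eta <= eta.
  rewrite ler_pdivrMr// -expr2 -[leRHS]invrK lef_pV2 ?posrE ?invr_gt0 ?exprn_gt0//.
  exact/ltW/truncnS_gt.
pose l := flatten [seq nseq N b | b <- enum 'I_k].
have cl b : count_mem b l = N.
  rewrite count_flatten -map_comp sumnE big_map.
  rewrite big_enum /= (bigD1 b)//= count_nseq /= eqxx mul1n big1 ?addn0// => c /negPf cb.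
  by rewrite count_nseq /= cb mul0n.
pose F m := phi (fun b => (m b)%:R / N%:R).
have [s sE] := polyfun_walk l F (fun=> 0%N).
exists s => u uc; rewrite -sE.
(* [|x| <= eta + x^2 / eta] bounds the first moment by the second, which [walk_sqr] evaluates. *)
pose D m : R := L * \sum_b (eta + ((m b)%:R - N%:R * u b) ^+ 2 * (N%:R ^- 2 / eta)).
have DP m : `|F m - phi u| <= D m.
  apply: (le_trans (lip _ _)); rewrite ler_wpM2l//; apply: ler_sum => b _.
  set x := _ - _; have -> : ((m b)%:R - N%:R * u b) ^+ 2 * (N%:R ^- 2 / eta) = x ^+ 2 / eta.
    by rewrite /x; field; rewrite !gt_eqF.
  have [xe|xe] := lerP `|x| eta.
    by rewrite (le_trans xe)// lerDl divr_ge0 ?sqr_ge0// ltW.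
  rewrite -[leLHS]add0r lerD// ?(ltW eta0)// ler_pdivlMr//.
  have -> : x ^+ 2 = `|x| * `|x| by rewrite -normrM -expr2 ger0_norm ?sqr_ge0.
  by rewrite ler_wpM2l// ltW.
have wD : walk l D (fun=> 0%N) u <= eps.
  rewrite /D walkZ walk_sum.
  apply: (@le_trans _ _ (L * \sum_(b < k) (eta + eta))).
    rewrite ler_wpM2l//; apply: ler_sum => b _.
    rewrite walkD walk_cst lerD2l.
    rewrite (_ : (fun _ => _) = fun m => N%:R ^- 2 / eta * ((m b)%:R - N%:R * u b) ^+ 2); last first.
      by apply/funext => m; rewrite mulrC.
    rewrite walkZ walk_sqr cl add0r subrr expr0n add0r.
    apply: le_trans Neta; have /andP[u0 u1] := uc b.
    have -> : N%:R ^- 2 / eta * (N%:R * (u b * (1 - u b))) =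
       N%:R^-1 / eta * (u b * (1 - u b)) by field; rewrite !gt_eqF.
    apply: ler_piMr; first by rewrite divr_ge0 ?invr_ge0 ?(ltW eta0).
    by apply: mulr_ile1; rewrite ?subr_ge0// gerBl.
  rewrite sumr_const card_ord -mulr_natr mulrA [L * _]mulrC -mulrA.
  have -> : (eta + eta) * (L * k%:R) = eps * (L * k%:R / (L * k%:R + 1)).
    by rewrite /eta; field; rewrite gt_eqF.
  by rewrite ler_piMr ?(ltW e0)// ler_pdivrMr// mul1r lerDl.
rewrite ler_norml; apply/andP; split.
  rewrite -subr_ge0 opprK; have := @walk_le l (fun m => phi u) (fun m => F m + D m) (fun=> 0%N) u uc.
  rewrite walk_cst walkD => H; suff : phi u <= walk l F (fun=> 0%N) u + walk l D (fun=> 0%N) u.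
    by move: wD; lra.
  apply: H => m; have := DP m; rewrite ler_norml => /andP[+ _]; lra.
have := @walk_le l F (fun m => phi u + D m) (fun=> 0%N) u uc.
rewrite walkD walk_cst => H; suff : walk l F (fun=> 0%N) u <= phi u + walk l D (fun=> 0%N) u.
  by move: wD; lra.
by apply: H => m; have := DP m; rewrite ler_norml => /andP[_]; lra.
Qed.

End polynomial_approximation.

(** * Integration against the standard normal law *)

Section normal_integral.
Variable R : realType.
Local Open Scope ereal_scope.
Local Notation mu := (@lebesgue_measure R).
Local Notation nu := (@normal_prob R 0 1).
Local Notation pdf := (@normal_pdf R 0 1).

Let pdf0 x : (0 <= pdf x)%R. Proof. exact: normal_pdf_ge0. Qed.

Let mpdf : measurable_fun setT (EFin \o pdf).
Proof. by apply/measurable_EFinP; exact: measurable_normal_pdf. Qed.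

Import HBNNSimple.

Let integral_normal_prob_indic (E : set R) : measurable E ->
  \int[nu]_x (\1_E x)%:E = \int[mu]_x ((\1_E x)%:E * (pdf x)%:E).
Proof.
move=> mE; rewrite integral_indic//= setIT /normal_prob integral_mkcond.
apply: eq_integral => x _; rewrite patchE indicE.
by case: ifPn => xE; rewrite ?mul1e// mul0e.
Qed.

Let integral_normal_prob_nnsfun (h : {nnsfun (measurableTypeR R) >-> R}) :
  \int[nu]_x (h x)%:E = \int[mu]_x ((h x)%:E * (pdf x)%:E).
Proof.
under [LHS]eq_integral do rewrite fimfunE -fsumEFin//.
rewrite [LHS]ge0_integral_fsum//; last 2 first.
- by move=> r; exact/measurable_EFinP/measurableT_comp.
- by move=> r x _; rewrite EFinM nnfun_muleindic_ge0.
under [RHS]eq_integral.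
  move=> x _; rewrite fimfunE -fsumEFin// ge0_mule_fsuml; last first.
    by move=> r; rewrite EFinM nnfun_muleindic_ge0.
  over.
rewrite [RHS]ge0_integral_fsum//; last 2 first.
- move=> r; apply: emeasurable_funM => //.
  by apply/measurable_EFinP; exact: measurableT_comp.
- move=> r x _; apply: mule_ge0; last by rewrite lee_fin.
  by rewrite EFinM nnfun_muleindic_ge0.
apply: eq_fsbigr => r _.
have [r0|r0] := ltP r 0%R.
  have E x : (r * \1_(h @^-1` [set r]) x = 0)%R.
    have : 0 <= r%:E * (\1_(h @^-1` [set r]) x)%:E by exact: nnfun_muleindic_ge0.
    rewrite -EFinM lee_fin indicE.
    by case: (_ \in _); rewrite ?mulr0// mulr1 => /(lt_le_trans r0); rewrite ltxx.
  rewrite !integral0_eq// => x _; first by rewrite E mul0e.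
  by rewrite E.
under eq_integral do rewrite EFinM.
have mh : measurable (h @^-1` [set r]) by exact: measurable_funPTI.
rewrite lower_integralZl// integral_normal_prob_indic//.
rewrite -lower_integralZl//; last first.
  by move=> x; apply: mule_ge0; rewrite lee_fin// indicE.
by apply: eq_integral => x _; rewrite EFinM muleA.
Qed.

(** Passage from indicators through simple functions to monotone limits. *)
Lemma integral_normal_prob (f : measurableTypeR R -> \bar R) : measurable_fun setT f ->
  (forall x, 0 <= f x) -> \int[nu]_x f x = \int[mu]_x (f x * (pdf x)%:E).
Proof.
move=> mf f0; pose g := nnsfun_approx measurableT mf.
transitivity (lim (\int[nu]_x (g n x)%:E @[n --> \oo])).
  rewrite -monotone_convergence//=.
  - by apply: eq_integral => x _; apply/esym/cvg_lim => //; apply: cvg_nnsfun_approx => //= z _; exact: f0.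
  - by move=> n; apply/measurable_EFinP; first [exact: measurable_funP|exact: (@measurable_funPT _ _ (measurableTypeR R) (measurableTypeR R) (g n))|apply: (measurable_funS measurableT) => //; exact: (@measurable_funPT _ _ _ _ (g n))|apply: measurable_funPTI].
  - by move=> n x _; rewrite lee_fin.
  - by move=> x _ m n mn; rewrite lee_fin; exact/lefP/nd_nnsfun_approx.
transitivity (lim (\int[mu]_x ((g n x)%:E * (pdf x)%:E) @[n --> \oo])).
  by apply: congr_lim; apply/funext => n; exact: integral_normal_prob_nnsfun.
rewrite -monotone_convergence//=.
- apply: eq_integral => x _; apply/cvg_lim => //.
  by apply: cvgeZr => //; apply: cvg_nnsfun_approx => //= z _; exact: f0.
- move=> n; apply: emeasurable_funM => //.
  by apply/measurable_EFinP; exact: measurable_funPT.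
- by move=> n x _; rewrite mule_ge0 ?lee_fin.
- move=> x _ m n mn; rewrite lee_wpmul2r ?lee_fin//.
  exact/lefP/nd_nnsfun_approx.
Qed.

Lemma integral_normal_expR (c : R) : (-1 < c)%R ->
  \int[nu]_x (expR (- (c * x ^+ 2 / 2)))%:E = ((1 + c) `^ (- 1 / 2))%:E.
Proof.
move=> c0; have c1 : (0 < 1 + c)%R by rewrite -ltrBlDl sub0r.
have mf : measurable_fun setT (fun x : R => expR (- (c * x ^+ 2 / 2))).
  apply: measurableT_comp => //; apply: measurableT_comp => //.
  by do 2 apply: measurable_funM => //; exact: measurable_funX.
rewrite integral_normal_prob; [|exact/measurable_EFinP|by move=> x; rewrite lee_fin expR_ge0].
pose pk := @normal_peak R 1.
have pk0 : (0 <= pk)%R by exact: normal_peak_ge0.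
transitivity (\int[mu]_x (pk%:E * (expR (0 - 2^-1 * (1 + c) * (x - 0) ^+ 2))%:E)).
  apply: eq_integral => x _; rewrite -!EFinM normal_pdfE ?oner_eq0//= /normal_fun.
  rewrite mulrCA; congr (_ * _)%:E; rewrite -expRD; congr expR.
  by field.
rewrite lower_integralZl// integral_gauss1//.
(* The product of the peak and the root of [2 pi] is read off from the total mass 1 of the
   density. *)
have := @integral_normal_pdf R 0 1.
have -> : \int[mu]_x (pdf x)%:E = \int[mu]_x (pk%:E * (expR (0 - 2^-1 * 1 * (x - 0) ^+ 2))%:E).
  apply: eq_integral => x _; rewrite normal_pdfE ?oner_eq0//= /normal_fun -EFinM.
  by congr (_ * expR _)%:E; field.
rewrite lower_integralZl// integral_gauss1// powR1 mulr1 -!EFinM => -[H].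
by congr EFin; rewrite mulrA H mul1r.
Qed.

Let opp_sqr_le (x y z : R) : (x <= z <= y -> - (x ^+ 2 + y ^+ 2) / 2 <= - z ^+ 2 / 2)%R.
Proof.
move=> /andP[xz zy]; have : (z ^+ 2 <= x ^+ 2 + y ^+ 2)%R by have [z0|z0] := leP 0%R z; nra.
lra.
Qed.

Lemma normal_prob_itv_gt0 (x y : R) : (x < y)%R -> 0 < nu `[x, y]%classic.
Proof.
move=> xy.
pose c := (@normal_peak R 1 * expR (- (x ^+ 2 + y ^+ 2) / 2))%R.
have c0 : (0 < c)%R by rewrite mulr_gt0 ?expR_gt0 ?normal_peak_gt0 ?oner_eq0.
apply: (@lt_le_trans _ _ (\int[mu]_z (c * \1_`[x, y] z)%:E)).
  under eq_integral do rewrite EFinM.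
  rewrite lower_integralZl ?(ltW c0)//.
  rewrite integral_indic//= setIT lebesgue_measure_itv /= lte_fin xy.
  by rewrite -EFinB -EFinM lte_fin mulr_gt0 ?subr_gt0.
rewrite /normal_prob [leRHS]integral_mkcond; apply: lower_integral_le => z.
  by rewrite lee_fin mulr_ge0 ?(ltW c0)// indicE.
rewrite patchE indicE; case: ifPn => zxy; last by rewrite mulr0.
move: zxy; rewrite inE /= in_itv /= => /andP[xz zy].
rewrite mulr1 lee_fin normal_pdfE ?oner_eq0//= /normal_fun /c.
rewrite ler_wpM2l ?normal_peak_ge0// ler_expR subr0 expr1n.
by apply: opp_sqr_le; rewrite xz.
Qed.

End normal_integral.

(** * Independent copies on a product space *)

Section independent_copies.
Variables (R : realType) (nu : probability (measurableTypeR R) R).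
Local Open Scope ereal_scope.

(** Independence is recorded as the product formula for nonnegative functions of single coordinates,
    the form in which it is applied; the induction adds one factor by Tonelli. *)
Lemma independent_copies (n : nat) : exists (d : measure_display)
  (Om : measurableType d) (P : probability Om R) (Z : 'I_n -> Om -> measurableTypeR R),
  (forall j, measurable_fun setT (Z j)) /\
  (forall (f : 'I_n -> R -> R) (c : 'I_n -> R),
    (forall j, measurable_fun setT (f j : measurableTypeR R -> R)) -> (forall j x, (0 <= f j x)%R) ->
    (forall j, \int[nu]_x (f j x)%:E = (c j)%:E) ->
    \int[P]_w (\prod_j f j (Z j w))%:E = (\prod_j c j)%:E).
Proof.
elim: n => [|n [d [Om [P [Z [mZ PZ]]]]]].
  exists _, (measurableTypeR R), nu, (fun _ x => x); split => [[]//|f c mf f0 fc].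
  under eq_integral do rewrite big_ord0.
  by rewrite integral_cst// mul1e big_ord0; exact: probability_setT.
exists _, (measurableTypeR R * Om)%type, (nu \x P)%E.
exists (fun j w => if unlift ord0 j is Some j' then Z j' w.2 else w.1); split.
  move=> j; case: unliftP => [j' _|_]; last exact: measurable_fst.
  exact: measurableT_comp (mZ j') measurable_snd.
move=> f c mf f0 fc.
have c0 j : (0 <= c j)%R.
  by rewrite -lee_fin -fc integral_ge0// => x _; rewrite lee_fin.
have FE (w : measurableTypeR R * Om) :
   (\prod_j f j (if unlift ord0 j is Some j' then Z j' w.2 else w.1))%R =
   (f ord0 w.1 * \prod_j f (lift ord0 j) (Z j w.2))%R.
  rewrite big_ord_recl unlift_none; congr (_ * _)%R.
  by apply: eq_bigr => j _; rewrite liftK.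
under eq_integral do rewrite FE.
have mprod : measurable_fun setT (fun w => \prod_j f (lift ord0 j) (Z j w))%R.
  by apply: measurable_prod => j _; exact: measurableT_comp (mf _) (mZ j).
have mF : measurable_fun setT (fun w : measurableTypeR R * Om =>
    (f ord0 w.1 * \prod_j f (lift ord0 j) (Z j w.2))%:E).
  apply/measurable_EFinP; apply: measurable_funM.
    exact: measurableT_comp (mf _) measurable_fst.
  exact: measurableT_comp mprod measurable_snd.
rewrite fubini_tonelli1//; last first.
  by move=> w; rewrite lee_fin mulr_ge0// prodr_ge0.
rewrite /fubini_F /=.
transitivity (\int[nu]_x ((\prod_j c (lift ord0 j))%:E * (f ord0 x)%:E)).
  apply: eq_integral => x _.
  under eq_integral do rewrite EFinM.
  rewrite lower_integralZl//; last by move=> w; rewrite lee_fin prodr_ge0.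
  by rewrite (PZ (fun j => f (lift ord0 j)) (fun j => c (lift ord0 j)))// muleC.
rewrite lower_integralZl ?prodr_ge0//; last by move=> x; rewrite lee_fin.
by rewrite fc -EFinM big_ord_recl mulrC.
Qed.

End independent_copies.

(** * Lipschitz cut-offs of the limit variable *)

Section truncated_product.
Variables (R : realType) (a : R).
Hypotheses (a2 : 2 < a) (a4 : a <= 4).
Local Notation Psi := (Psi a).

Lemma prod_lipschitz (I : eqType) (r : seq I) (p : pred I) (A B : I -> R) (K : R) :
  1 <= K -> (forall i, 0 <= A i <= K) -> (forall i, 0 <= B i <= K) ->
  `|\prod_(i <- r | p i) A i - \prod_(i <- r | p i) B i| <=
    K ^+ size r * \sum_(i <- r) `|A i - B i|.
Proof.
move=> K1 AK BK; have K0 : 0 <= K by exact: le_trans K1.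
have prodK : forall s, 0 <= \prod_(i <- s | p i) B i <= K ^+ size s.
  elim=> [|i s /andP[IH1 IH2]]; first by rewrite big_nil ler01 expr0 lexx.
  rewrite big_cons /= exprS; have /andP[B0 B1] := BK i.
  case: ifP => _; first by rewrite mulr_ge0//= ler_pM.
  by rewrite IH1/= (le_trans IH2)// ler_peMl// exprn_ge0.
elim: r => [|i s IH]; first by rewrite !big_nil subrr normr0 mulr0.
rewrite !big_cons /= exprS mulrDr.
have sum0 : 0 <= \sum_(j <- s) `|A j - B j| by exact: sumr_ge0.
have Ks0 : 0 <= K ^+ size s by exact: exprn_ge0.
have /andP[A0 A1] := AK i; have /andP[B0 B1] := prodK s.
case: ifP => _; last first.
  apply: (le_trans IH); rewrite -[leLHS]add0r lerD ?mulr_ge0//.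
  by rewrite -mulrA ler_peMl// mulr_ge0.
set pA := \prod_(j <- s | p j) A j in IH *; set pB := \prod_(j <- s | p j) B j in IH B0 B1 *.
have -> : A i * pA - B i * pB = (A i - B i) * pB + A i * (pA - pB) by ring.
apply: (le_trans (ler_normD _ _)); rewrite !normrM lerD//.
  rewrite [leRHS]mulrC ler_wpM2l// ger0_norm// (le_trans B1)//.
  by rewrite ler_peMl.
by rewrite (ger0_norm A0) -mulrA ler_pM.
Qed.

Let max_lip (c x y : R) : `|Num.max c x - Num.max c y| <= `|x - y|.
Proof.
have := ler_norm (x - y); have := ler_norm (y - x); rewrite distrC.
have := normr_ge0 (x - y); move: `|x - y| => N N0 N1 N2; rewrite ler_norml.
by rewrite /Num.max; case: (ltP c x) => ?; case: (ltP c y) => ?; apply/andP; split; lra.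
Qed.

Let min_lip (c x y : R) : `|Num.min c x - Num.min c y| <= `|x - y|.
Proof.
have := ler_norm (x - y); have := ler_norm (y - x); rewrite distrC.
have := normr_ge0 (x - y); move: `|x - y| => N N0 N1 N2; rewrite ler_norml.
by rewrite /Num.min; case: (ltP c x) => ?; case: (ltP c y) => ?; apply/andP; split; lra.
Qed.

(** [Psi] as a function of [u = exp(- x)] with [x] cut off to [[0, M]], which makes it bounded and
    Lipschitz on the whole line, as the Bernstein approximation requires. *)
Definition clampPsi q M (u : R) := Psi q (- ln (Num.max (expR (- M)) (Num.min 1 u))).

Lemma clampPsiE q M x : 0 <= M -> 0 <= x -> clampPsi q M (expR (- x)) = Psi q (Num.min x M).
Proof.
move=> M0 x0; rewrite /clampPsi; congr Psi.
have -> : Num.min 1 (expR (- x)) = expR (- x).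
  by apply/min_idPr; rewrite -[leRHS]expR0 ler_expR oppr_le0.
by rewrite /Num.max ltr_expR ltrN2 /Num.min; case: ifP => _; rewrite expRK opprK.
Qed.

Let clamp (M u : R) := Num.max (expR (- M)) (Num.min 1 u).

Let clamp_bounds M (u : R) : 0 <= M -> expR (- M) <= clamp M u <= 1.
Proof.
move=> M0; rewrite /clamp le_max lexx /= ge_max ge_min lexx /= andbT.
by rewrite -[leRHS]expR0 ler_expR oppr_le0.
Qed.

Let clamp_lip M (u v : R) : `|clamp M u - clamp M v| <= `|u - v|.
Proof.
by rewrite /clamp; apply: (le_trans (max_lip _ _ _)); exact: min_lip.
Qed.

Lemma clampPsi_bounds q M u : 0 <= M -> 0 <= clampPsi q M u <= expR M.
Proof.
move=> M0; have /andP[c1 c2] := clamp_bounds u M0.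
have l0 : 0 <= - ln (clamp M u) by rewrite oppr_ge0 ln_le0.
rewrite /clampPsi Psi_ge0//= (le_trans (Psi_le_expR _ _ _))// ler_expR lerNl.
by rewrite -[leLHS](expRK (R := R)) ler_ln// ?posrE ?expR_gt0// (lt_le_trans _ c1)// expR_gt0.
Qed.

Let clampPsi_lip1 q M u v : 0 <= M -> clamp M u <= clamp M v ->
  `|clampPsi q M u - clampPsi q M v| <= expR M * expR M * (clamp M v - clamp M u).
Proof.
move=> M0 uv.
have /andP[u1 u2] := clamp_bounds u M0; have /andP[v1 v2] := clamp_bounds v M0.
have e0 : 0 < expR (- M) := expR_gt0 _.
have u0 := lt_le_trans e0 u1; have v0 := lt_le_trans e0 v1.
have lv0 : 0 <= - ln (clamp M v) by rewrite oppr_ge0 ln_le0.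
have luv : - ln (clamp M v) <= - ln (clamp M u) by rewrite lerN2 ler_ln.
have up := Psi_le a2 q lv0 luv; have sh := Psi_shift a2 q lv0 luv.
rewrite opprK expRD [expR (- ln _)]expRN !lnK ?posrE// in sh.
have /andP[_ vM] := clampPsi_bounds q v M0.
have iu : (clamp M u)^-1 <= expR M.
  by rewrite -[leRHS]invrK -expRN lef_pV2 ?posrE.
rewrite /clampPsi in vM *; rewrite -/(clamp M u) -/(clamp M v) in vM *.
move: (Psi q _) (Psi q _) up sh vM (Psi_ge0 a2 q (- ln (clamp M v))) => A B BA AB BM B0.
rewrite ger0_norm ?subr_ge0//.
apply: (@le_trans _ _ ((clamp M u)^-1 * B * (clamp M v - clamp M u))).
  have -> : (clamp M u)^-1 * B * (clamp M v - clamp M u) = (clamp M u)^-1 * clamp M v * B - B.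
    by field; rewrite gt_eqF.
  by rewrite lerB.
rewrite ler_wpM2r ?subr_ge0// ler_pM ?invr_ge0 ?(ltW u0)//.
Qed.

(** One factor [exp M] bounds [Psi], the other the slope of [- ln u] on the clamped range
    [u >= exp(- M)]. *)
Lemma clampPsi_lipschitz q M u v : 0 <= M ->
  `|clampPsi q M u - clampPsi q M v| <= expR M * expR M * `|u - v|.
Proof.
move=> M0; have ee : 0 <= expR M * expR M :> R by rewrite mulr_ge0 ?expR_ge0.
apply: (@le_trans _ _ (expR M * expR M * `|clamp M u - clamp M v|)); last first.
  by rewrite ler_wpM2l.
case: (leP (clamp M u) (clamp M v)) => [uv|/ltW vu].
  by rewrite [in leRHS]distrC [in leRHS]ger0_norm ?subr_ge0// clampPsi_lip1.
by rewrite distrC [in leRHS]ger0_norm ?subr_ge0// clampPsi_lip1.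
Qed.

(** Lipschitz substitute for the indicator of [x <= s], descending linearly from 1 to 0 over a
    length [d]. *)
Definition ramp (s d x : R) := Num.max 0 (Num.min 1 ((s + d - x) / d)).

Lemma ramp_bounds s d x : 0 <= ramp s d x <= 1.
Proof. by rewrite /ramp le_max lexx /= ge_max ler01 ge_min lexx. Qed.

Lemma ramp_eq1 s d x : 0 < d -> x <= s -> ramp s d x = 1.
Proof.
move=> d0 xs; rewrite /ramp.
have -> : Num.min 1 ((s + d - x) / d) = 1.
  by apply/min_idPl; rewrite ler_pdivlMr// mul1r; lra.
by apply/max_idPr.
Qed.

Lemma ramp_eq0 s d x : 0 < d -> s + d <= x -> ramp s d x = 0.
Proof.
move=> d0 xs; rewrite /ramp; apply/max_idPl; rewrite ge_min.
by rewrite ler_pdivrMr// mul0r subr_le0 xs orbT.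
Qed.

Lemma ramp_lipschitz s d x y : 0 < d -> `|ramp s d x - ramp s d y| <= d^-1 * `|x - y|.
Proof.
move=> d0; set A := (s + d - x) / d; set B := (s + d - y) / d.
have -> : d^-1 * `|x - y| = `|A - B|.
  rewrite -[X in X * _]gtr0_norm ?invr_gt0// -normrM distrC; congr `|_|.
  by rewrite /A /B; field; rewrite gt_eqF.
by rewrite /ramp; apply: (le_trans (max_lip _ _ _)); exact: min_lip.
Qed.

Lemma ramp_polynomial k (p : pred 'I_k) (q : 'I_k -> nat) M s d eps :
  0 <= M -> 0 < d -> 0 < eps ->
  exists l, forall u, cube u ->
    `|peval l u - ramp s d (\prod_(b | p b) clampPsi (q b) M (u b))| <= eps.
Proof.
move=> M0 d0 e0.
have K1 : 1 <= expR M :> R by rewrite -[leLHS]expR0 ler_expR.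
pose L := d^-1 * (expR M ^+ size (index_enum 'I_k) * (expR M * expR M)).
apply: (@polynomial_approximation _ _ _ L) => // [|u v].
  by rewrite !mulr_ge0 ?exprn_ge0 ?expR_ge0 ?invr_ge0 ?(ltW d0).
apply: (le_trans (ramp_lipschitz _ _ _ d0)); rewrite /L -!mulrA ler_wpM2l ?invr_ge0 ?(ltW d0)//.
apply: (le_trans (prod_lipschitz _ _ K1 _ _)); try by move=> b; exact: clampPsi_bounds.
rewrite ler_wpM2l ?exprn_ge0 ?expR_ge0// !mulr_sumr.
by apply: ler_sum => b _; rewrite mulrA clampPsi_lipschitz.
Qed.

End truncated_product.

(** * Moments and nondegeneracy of the limit variable *)

Section limit_law.
Variables (R : realType) (a : R) (p k : nat) (blk : 'I_p -> 'I_k).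
Variables (G : {set 'I_p}) (Pb : pred 'I_k).
Hypotheses (a2 : 2 < a) (a4 : a <= 4).
Local Notation q b := (blocksize blk G b).
Local Notation mterm := (R * ('I_k -> nat))%type.

Let lt_double_succ (m : nat) : m%:R < 2 * m.+1%:R :> R.
Proof. by rewrite -natrM ltr_nat; lia. Qed.

Let half_mul_le (y B : R) : 0 <= y -> B <= 1 -> y * B / 2 <= y.
Proof. by move=> *; nra. Qed.

Let half_sqr_ge (z S : R) : 2 <= z -> 0 <= S -> 1 <= 2^-1 * (z ^+ 2 + S).
Proof. by move=> *; nra. Qed.

(** Blocks outside [Pb] get the neutral value 1, so that polynomials keep all [k] variables. *)
Definition usub (x : 'I_k -> R) b := if Pb b then expR (- x b) else 1.

(** Mean of [peval s (usub x)] when the [2 x_b] are independent chi-square variables with [q b]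
    degrees of freedom, since then [exp(- m x_b)] has mean [(1 + m)^(- q_b / 2)]. *)
Definition pval (s : seq mterm) : R :=
  \sum_(i <- s) i.1 * (\prod_(b | Pb b) (1 + (i.2 b)%:R) ^+ q b) `^ (- 1 / 2).

Lemma usub_cube x : (forall b, 0 <= x b) -> cube (usub x).
Proof.
move=> x0 b; rewrite /usub; case: ifP => _; last by rewrite ler01 lexx.
by rewrite expR_ge0 -[leRHS]expR0 ler_expR oppr_le0 x0.
Qed.

Lemma prod_block (g : 'I_p -> R) :
  \prod_(j in G) g j = \prod_b \prod_(j in [set j in G | blk j == b]) g j.
Proof.
rewrite (partition_big blk predT)//=; apply: eq_bigr => b _.
by apply: eq_bigl => j; rewrite inE.
Qed.

Variables (d : measure_display) (Om : measurableType d) (P : probability Om R).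
Variable Z : 'I_p -> Om -> measurableTypeR R.
Hypothesis mZ : forall j, measurable_fun setT (Z j).
Hypothesis PZ : forall (f : 'I_p -> R -> R) (c : 'I_p -> R),
  (forall j, measurable_fun setT (f j : measurableTypeR R -> R)) ->
  (forall j x, 0 <= f j x) ->
  (forall j, (\int[@normal_prob R 0 1]_x (f j x)%:E = (c j)%:E)%E) ->
  (\int[P]_w (\prod_j f j (Z j w))%:E = (\prod_j c j)%:E)%E.

Let x w b : R := 2^-1 * \sum_(j in [set j in G | blk j == b]) Z j w ^+ 2.
Let H w : R := \prod_(b | Pb b) Psi a (q b) (x w b).

Let x0 w b : 0 <= x w b.
Proof. by rewrite mulr_ge0// sumr_ge0// => j _; exact: sqr_ge0. Qed.

Let mx_ b : measurable_fun setT (fun w => x w b).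
Proof.
apply: measurable_funM => //; under eq_fun do rewrite big_mkcond.
apply: measurable_sum => j; case: (j \in _) => //.
by apply: measurable_funX; exact: mZ.
Qed.

Let mPsi r : measurable_fun setT (fun z : R => Psi a r (Num.max 0 z)).
Proof.
apply: nondecreasing_measurable => // z1 z2 z12.
have m1 : 0 <= Num.max 0 z1 by rewrite le_max lexx.
have m12 : Num.max 0 z1 <= Num.max 0 z2 by rewrite ge_max !le_max lexx z12 orbT.
exact: (Psi_le a2 r m1 m12).
Qed.

Let mH : measurable_fun setT H.
Proof.
rewrite (_ : H = fun w => \prod_(b <- index_enum 'I_k)
   (if Pb b then Psi a (q b) (Num.max 0 (x w b)) else 1)); last first.
  apply/funext => w; rewrite /H big_mkcond; apply: eq_bigr => b _.
  by case: ifP => // _; congr Psi; apply/esym/max_idPr.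
apply: measurable_prod => b _; case: (Pb b) => //.
exact: (measurableT_comp (mPsi _) (mx_ b)).
Qed.

Let monomial (m : 'I_k -> nat) w := \prod_b usub (x w) b ^+ m b.

Let monomialE m w : monomial m w = \prod_j
  expR (- ((if (j \in G) && Pb (blk j) then (m (blk j))%:R else 0) * Z j w ^+ 2 / 2)).
Proof.
rewrite (bigID (fun j => j \in G)) /= [X in _ * X]big1 ?mulr1; last first.
  by move=> j /negbTE ->; rewrite /= !mul0r oppr0 expR0.
rewrite prod_block; apply: eq_bigr => b _; rewrite /usub.
rewrite -expR_sum; case: ifP => Pbb; last first.
  rewrite expr1n -[LHS]expR0; congr expR; rewrite big1// => j.
  by rewrite inE => /andP[jG /eqP ->]; rewrite jG Pbb !mul0r oppr0.
rewrite -expRM_natl; congr expR; rewrite /x sumrN mulrN mulrA mulr_sumr; congr (- _).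
by apply: eq_bigr => j; rewrite inE => /andP[-> /eqP ->]; rewrite Pbb/=; ring.
Qed.

Let mmonomial m : measurable_fun setT (monomial m).
Proof.
rewrite (_ : monomial m = fun w => \prod_(b <- index_enum 'I_k) usub (x w) b ^+ m b)//.
apply: measurable_prod => b _; apply: measurable_funX; rewrite /usub.
case: (Pb b) => //; apply: measurableT_comp => //.
by apply: measurableT_comp => //; exact: mx_.
Qed.

Let monomial_ge0 m w : 0 <= monomial m w.
Proof. by apply: prodr_ge0 => b _; rewrite exprn_ge0//; case/andP: (usub_cube (x0 w) b). Qed.

Let integral_monomial m : (\int[P]_w (monomial m w)%:E =
  ((\prod_(b | Pb b) (1 + (m b)%:R) ^+ q b) `^ (- 1 / 2))%:E)%E.
Proof.
pose f j : R := if (j \in G) && Pb (blk j) then (m (blk j))%:R else 0.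
have f0 j : 0 <= f j by rewrite /f; case: ifP.
under eq_integral do rewrite monomialE.
rewrite (PZ (f := fun j z => expR (- (f j * z ^+ 2 / 2))) (c := fun j => (1 + f j) `^ (- 1 / 2))).
- congr EFin; rewrite [in RHS]big_mkcond powR_prod; last first.
    by move=> b; case: ifP => _ //; apply: exprn_ge0; exact: addr_ge0.
  rewrite (bigID (fun j => j \in G)) /= [X in _ * X]big1 ?mulr1; last first.
    by move=> j /negbTE jG; rewrite /f jG /= addr0 powR1.
  rewrite prod_block; apply: eq_bigr => b _.
  transitivity (\prod_(j in [set j in G | blk j == b])
      (1 + (if Pb b then (m b)%:R else 0) : R) `^ (- 1 / 2)).
    by apply: eq_bigr => j; rewrite inE /f => /andP[-> /eqP ->].
  rewrite prodr_const -/(blocksize blk G b).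
  case: ifP => _; last by rewrite addr0 powR1 expr1n.
  rewrite -powR_mulrn ?powR_ge0// -[in RHS]powR_mulrn; last exact: addr_ge0.
  by rewrite -!powRrM mulrC.
- move=> j; apply: measurableT_comp => //; apply: measurableT_comp => //.
  by do 2 apply: measurable_funM => //; exact: measurable_funX.
- by move=> j z; exact: expR_ge0.
- by move=> j; apply: integral_normal_expR; rewrite (lt_le_trans _ (f0 j))// ltrN10.
Qed.

Let integrable_monomial m : P.-integrable setT (EFin \o monomial m).
Proof.
apply/integrableP; split; first exact/measurable_EFinP.
under eq_integral => w _ do rewrite /= ger0_norm//.
by rewrite integral_monomial ltry.
Qed.

Let integral_peval s : P.-integrable setT (fun w => (peval s (usub (x w)))%:E) /\
  (\int[P]_w (peval s (usub (x w)))%:E = (pval s)%:E)%E.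
Proof.
elim: s => [|i s [IH1 IH2]].
  have E : (fun w => (peval [::] (usub (x w)))%:E) = (fun=> 0%E) :> (Om -> \bar R).
    by apply/funext => w; rewrite /peval big_nil.
  by rewrite E /pval big_nil; split; [exact: integrable0|exact: integral0].
have E : (fun w => (peval (i :: s) (usub (x w)))%:E) =
    (fun w => i.1%:E * (monomial i.2 w)%:E + (peval s (usub (x w)))%:E)%E.
  by apply/funext => w; rewrite /peval big_cons EFinD EFinM.
have I1 : P.-integrable setT (fun w => i.1%:E * (monomial i.2 w)%:E)%E.
  by apply: integrableZl => //; exact: integrable_monomial.
rewrite E; split; first exact: integrableD.
rewrite integralD// integralZl//; last exact: integrable_monomial.
by rewrite IH2 integral_monomial -EFinM -EFinD /pval big_cons.
Qed.




Let PE (A : set Om) : measurable A -> P A = (\int[P]_w (\1_A w)%:E)%E.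
Proof. by move=> mA; rewrite integral_indic// setIT. Qed.

Let preimageM (Y : Om -> R) (B : set R) : measurable_fun setT Y -> measurable B ->
  measurable (Y @^-1` B).
Proof. by move=> mY mB; rewrite -[X in measurable X]setTI; exact: mY. Qed.

(** By independence the box has as probability the [p]-th power of a positive number, whatever [A]
    is. *)
Let prob_box lo hi : lo < hi -> exists2 e, 0 < e &
  forall A, measurable A -> (forall w, (forall j, lo <= Z j w <= hi) -> A w) -> (e%:E <= P A)%E.
Proof.
move=> lohi; pose I := [set` `[lo, hi]%R] : set (measurableTypeR R).
have mI : measurable I by exact: measurable_itv.
have I0 : (0 < @normal_prob R 0 1 I)%E by exact: normal_prob_itv_gt0.
pose c := fine (@normal_prob R 0 1 I).
have cE : @normal_prob R 0 1 I = c%:E.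
  by rewrite /c fineK//; exact: fin_num_measure.
have c0 : 0 < c by rewrite -lte_fin -cE.
exists (\prod_(j < p) c); first by apply: prodr_gt0.
move=> A mA IA; rewrite -(PZ (f := fun _ => \1_I)).
- rewrite PE//; apply: lower_integral_le => w.
    by rewrite lee_fin; apply: prodr_ge0 => j _; rewrite indicE.
  rewrite lee_fin; have [wI|] := pselect (forall j, lo <= Z j w <= hi).
    rewrite [leRHS]indicE (mem_set (IA w wI)).
    apply: Num.Theory.prodr_ile1 => j _; rewrite indicE.
    by case: (_ \in _); rewrite ?lexx ler01.
  move/existsNP => [j /negP wj].
  rewrite (bigD1 j)//= indicE memNset ?mul0r ?indicE//.
  by rewrite /I /= in_itv /=; exact/negP.
- by move=> j; exact: measurable_indic.
- by move=> j z; rewrite indicE.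
- by move=> j; rewrite integral_indic// setIT.
Qed.

Let H0 := \prod_(b | Pb b) Psi a (q b) 0.

Let H0_gt0 : 0 < H0.
Proof. by apply: prodr_gt0 => b _; exact: Psi_gt0. Qed.

(** If [H] were almost surely [c], it would take the value [c] somewhere in every box. Large
    coordinates force [H >= kap * H0] and small ones [H < kap * H0], so one of the two boxes misses
    [c]. *)
Let H_nondegenerate j0 : j0 \in G -> Pb (blk j0) -> forall c, P (H @^-1` [set c]) != 1%E.
Proof.
move=> jG Pj c; apply/eqP => P1.
have mc : measurable (H @^-1` [set c]) by apply: preimageM.
have key lo hi : lo < hi -> (forall w, (forall j, lo <= Z j w <= hi) -> H w != c) -> False.
  move=> lohi Hc; have [e e0 eA] := prob_box lohi.
  have /eA : measurable (~` (H @^-1` [set c])) by exact: measurableC.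
  rewrite probability_setC// P1 subee// lee_fin leNgt e0.
  by move=> /(_ (fun w ww => elimN eqP (Hc w ww))).
pose b0 := blk j0; pose q0 := q b0.
have Psi0 : 0 < Psi a q0 0 by exact: Psi_gt0.
pose kap := Psi a q0 1 / Psi a q0 0.
have kap1 : 1 < kap by rewrite /kap ltr_pdivlMr// mul1r Psi_lt01.
have lk0 : 0 < ln kap by exact: ln_gt0.
have kH : kap * H0 = Psi a q0 1 * \prod_(b | Pb b && (b != b0)) Psi a (q b) 0.
  by rewrite /H0 (bigD1 b0)//= mulrA /kap divfK// gt_eqF.
have [cs|cb] := ltP c (kap * H0).
  (* A value [Z j0 >= 2] makes [x w b0] at least 1, which raises that factor to at least
     [Psi q0 1]. *)
  apply: (@key 2 3); first by rewrite ltr_nat.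
  move=> w Zw; apply: negbT; apply: gt_eqF; apply: (lt_le_trans cs); rewrite kH /H.
  rewrite [leRHS](bigD1 b0 Pj) /=; apply: ler_pM.
  - exact: Psi_ge0.
  - by apply: prodr_ge0 => b _; exact: Psi_ge0.
  - apply: (Psi_le a2) => //; rewrite /x (bigD1 j0) ?inE ?jG ?eqxx//=.
    have /andP[z2 _] := Zw j0.
    have : 0 <= \sum_(i in [set j in G | blk j == b0] | i != j0) Z i w ^+ 2.
      by apply: sumr_ge0 => i _; exact: sqr_ge0.
    move: (\sum_(i in _ | _) _) => S S0; exact: half_sqr_ge.
  - by apply: ler_prod => b _; rewrite Psi_ge0//= Psi_le.
(* If all coordinates [x w b] are at most [y], then [H] is at most [exp(k y) * H0], and
   [k y < ln kap]. *)
pose y := ln kap / (2 * k.+1%:R); have y0 : 0 < y by rewrite divr_gt0// mulr_gt0.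
pose r := Num.sqrt (y / p.+1%:R).
have r0 : 0 < r by rewrite sqrtr_gt0 divr_gt0.
apply: (@key 0 r r0) => w Zw; rewrite lt_eqF//; apply: lt_le_trans cb.
have xy b : x w b <= y.
  apply: (@le_trans _ _ (2^-1 * \sum_(j in [set j in G | blk j == b]) y / p.+1%:R)).
    rewrite ler_wpM2l//; apply: ler_sum => j _; have /andP[z0 zr] := Zw j.
    rewrite -[leRHS]sqr_sqrtr; last by rewrite divr_ge0// ltW.
    by rewrite lerXn2r ?nnegrE// ltW.
  rewrite sumr_const -[X in _ * X]mulr_natr.
  have : #|[set j in G | blk j == b]|%:R <= p.+1%:R :> R.
    by rewrite ler_nat ltnW// ltnS -[leqRHS]card_ord max_card.
  move: (#|_|%:R : R) => N Np.
  have p0 : 0 < p.+1%:R :> R by rewrite ltr0n.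
  have -> : 2^-1 * (y / p.+1%:R * N) = y * (N / p.+1%:R) / 2 by field; rewrite gt_eqF.
  have : N / p.+1%:R <= 1 by rewrite ler_pdivrMr// mul1r.
  exact: half_mul_le (ltW y0).
apply: (@le_lt_trans _ _ (expR (k%:R * y) * H0)).
  apply: (@le_trans _ _ (\prod_(b | Pb b) (expR y * Psi a (q b) 0))).
    apply: ler_prod => b _; rewrite Psi_ge0//=.
    apply: (le_trans (Psi_shift a2 (q b) (lexx 0) (x0 w b))).
    by rewrite subr0 ler_wpM2r ?Psi_ge0// ler_expR.
  rewrite big_split /= ler_wpM2r ?(ltW H0_gt0)// prodr_const expRM_natl.
  rewrite ler_weXn2l ?(max_card, card_ord)//.
    by rewrite -[leLHS]expR0 ler_expR ltW.
  by rewrite -[leqRHS]card_ord max_card.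
rewrite ltr_pM2r// -[ltRHS]lnK ?posrE ?(lt_trans _ kap1)// ltr_expR /y.
have k0 : 0 < k.+1%:R :> R by rewrite ltr0n.
rewrite mulrA ltr_pdivrMr ?mulr_gt0// [ltLHS]mulrC ltr_pM2l//; exact: lt_double_succ.
Qed.

Let pval_le s (A : set Om) r : measurable A ->
  (forall w, peval s (usub (x w)) <= \1_A w + r) -> pval s <= fine (P A) + r.
Proof.
move=> mA sA; have [I1 I2] := integral_peval s.
have IA : P.-integrable setT (EFin \o (\1_A : Om -> R)) by exact: integrable_indic.
have Ir : P.-integrable setT (EFin \o cst r) by apply: finite_measure_integrable_cst.
rewrite -lee_fin -I2 EFinD fineK ?fin_num_measure// PE//.
have -> : r%:E = (\int[P]_w (EFin \o cst r) w)%E.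
  rewrite /comp /= integral_cst// -[LHS]mule1; congr (_ * _)%E.
  by apply/esym; exact: probability_setT.
rewrite -integralD//; apply: le_integral => //; first exact: integrableD.
by move=> w _; rewrite /= -EFinD lee_fin.
Qed.

Let pval_ge s (A : set Om) r : measurable A ->
  (forall w, \1_A w - r <= peval s (usub (x w))) -> fine (P A) - r <= pval s.
Proof.
move=> mA sA; have [I1 I2] := integral_peval s.
have IA : P.-integrable setT (EFin \o (\1_A : Om -> R)) by exact: integrable_indic.
have Ir : P.-integrable setT (EFin \o cst (- r)) by apply: finite_measure_integrable_cst.
rewrite -lee_fin -I2 EFinD fineK ?fin_num_measure// PE//.
have -> : (- r)%:E = (\int[P]_w (EFin \o cst (- r)%R) w)%E.
  rewrite /comp /= integral_cst// -[LHS]mule1; congr (_ * _)%E.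
  by apply/esym; exact: probability_setT.
rewrite -integralD//; apply: le_integral => //; first exact: integrableD.
by move=> w _; rewrite /= -EFinD lee_fin.
Qed.

Lemma limit_variables_of_copies j0 : j0 \in G -> Pb (blk j0) ->
  exists x : Om -> 'I_k -> R,
  [/\ (forall w b, 0 <= x w b), (forall b, measurable_fun setT (fun w => x w b)),
      measurable_fun setT (fun w => \prod_(b | Pb b) Psi a (q b) (x w b)),
      (forall c, P ((fun w => \prod_(b | Pb b) Psi a (q b) (x w b)) @^-1` [set c]) != 1%E) &
  forall s (A : set Om) r, measurable A ->
   ((forall w, peval s (usub (x w)) <= \1_A w + r) -> pval s <= fine (P A) + r) /\
   ((forall w, \1_A w - r <= peval s (usub (x w))) -> fine (P A) - r <= pval s)].
Proof.
move=> jG Pj; exists x; split => //; first exact: (H_nondegenerate jG Pj).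
by move=> s A r mA; split; [exact: pval_le|exact: pval_ge].
Qed.

End limit_law.

(** * Approximation of the distribution function of the limit *)

Section limit_law_approximation.
Variables (R : realType) (a : R) (p k : nat) (blk : 'I_p -> 'I_k).
Variables (G : {set 'I_p}) (Pb : pred 'I_k).
Hypotheses (a2 : 2 < a) (a4 : a <= 4).
Local Notation q b := (blocksize blk G b).
Local Notation usub := (usub Pb).
Local Notation pval := (pval blk G Pb).

Let clampE y M : 0 <= M -> (forall b, 0 <= y b) ->
  \prod_(b | Pb b) clampPsi a (q b) M (usub y b) =
  \prod_(b | Pb b) Psi a (q b) (Num.min (y b) M).
Proof.
by move=> M0 y0; apply: eq_bigr => b Pbb; rewrite /usub Pbb clampPsiE.
Qed.

(** Shifting an approximation within [e] upwards by [e] makes it one-sided; [polynomial_lower]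
    shifts it downwards. *)
Let polynomial_upper M s d' e : 0 <= M -> 0 < d' -> 0 < e -> exists l, forall u, cube u ->
  let r := ramp s d' (\prod_(b | Pb b) clampPsi a (q b) M (u b)) in
  r <= peval l u <= r + 2 * e.
Proof.
move=> M0 d0 e0.
have [l lP] := ramp_polynomial a2 Pb (fun b => q b) s M0 d0 e0.
exists ((e, fun=> 0%N) :: l) => u /lP.
have -> : peval ((e, fun=> 0%N) :: l) u = e + peval l u.
  by rewrite /peval big_cons /= big1 ?mulr1.
move: (peval l u) (ramp _ _ _) => A B /=.
by rewrite ler_norml => /andP[H1 H2]; apply/andP; split; lra.
Qed.

Let polynomial_lower M s d' e : 0 <= M -> 0 < d' -> 0 < e -> exists l, forall u, cube u ->
  let r := ramp s d' (\prod_(b | Pb b) clampPsi a (q b) M (u b)) in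
  r - 2 * e <= peval l u <= r.
Proof.
move=> M0 d0 e0.
have [l lP] := ramp_polynomial a2 Pb (fun b => q b) s M0 d0 e0.
exists ((- e, fun=> 0%N) :: l) => u /lP.
have -> : peval ((- e, fun=> 0%N) :: l) u = - e + peval l u.
  by rewrite /peval big_cons /= big1 ?mulr1.
move: (peval l u) (ramp _ _ _) => A B /=.
by rewrite ler_norml => /andP[H1 H2]; apply/andP; split; lra.
Qed.

Let harmonic_le (m n : nat) : (m <= n)%N -> 2 / n.+1%:R <= 2 / m.+1%:R :> R.
Proof. by move=> mn; rewrite ler_wpM2l// lef_pV2 ?posrE ?ltr0n// ler_nat. Qed.

Let harmonic_small (r : R) : 0 < r -> exists n : nat, 2 / n.+1%:R <= r.
Proof.
move=> r0; have r2 : 0 <= 2 / r by rewrite divr_ge0// ltW.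
exists (Num.bound (2 / r)); have := archi_boundP r2; move: (Num.bound _) => n.
rewrite ltr_pdivrMr// => n2; rewrite ler_pdivrMr ?ltr0n//.
apply/ltW/(lt_le_trans n2); rewrite mulrC; apply: ler_wpM2l; first exact: ltW.
by rewrite ler_nat.
Qed.

Let sub_double (t del : R) : t - 2 * del + del <= t - del.
Proof. by lra. Qed.

Let double_del (m : nat) : m%:R^-1 + m%:R^-1 = 2 / m%:R :> R.
Proof. by rewrite mulrDl mul1r. Qed.

Let half_gt0 (y z : R) : y < z -> 0 < (z - y) / 2.
Proof. by move=> *; lra. Qed.

Variables (d : measure_display) (Om : measurableType d) (P : probability Om R).

Lemma small_tail (F : (set Om)^nat) (e : R) : (forall n, measurable (F n)) ->
  nonincreasing_seq F -> P (\bigcap_n F n) = 0%E -> 0 < e ->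
  exists n, (P (F n) <= e%:E)%E.
Proof.
move=> mF dF F0 e0.
have mI : measurable (\bigcap_n F n) by exact: bigcapT_measurable.
have cF := nonincreasing_cvg_mu (le_lt_trans (probability_le1 P (mF 0%N)) (ltry 1)) mF mI dF.
have {}cF : P \o F @ \oo --> 0%:E by rewrite -[0%:E]F0.
have {}cF : fine \o (P \o F) @ \oo --> 0 by exact: fine_cvg.
have /cvgrPdist_le /(_ e e0) [N _ /(_ N (leqnn N))] := cF.
rewrite /=.
rewrite sub0r normrN ger0_norm ?fine_ge0// => FN; exists N.
by rewrite -(fineK (fin_num_measure P _ (mF N))) lee_fin.
Qed.

Variable x : Om -> 'I_k -> R.
Hypothesis x0 : forall w b, 0 <= x w b.
Hypothesis mx_ : forall b, measurable_fun setT (fun w => x w b).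
Let H w : R := \prod_(b | Pb b) Psi a (q b) (x w b).
Hypothesis mH : measurable_fun setT H.
Hypothesis Hc : forall c, P (H @^-1` [set c]) != 1%E.
Hypothesis pvalP : forall s (A : set Om) r, measurable A ->
   ((forall w, peval s (usub (x w)) <= \1_A w + r) -> pval s <= fine (P A) + r) /\
   ((forall w, \1_A w - r <= peval s (usub (x w))) -> fine (P A) - r <= pval s).

Let W0 : probability R R := distribution P (mfun_Sub (mem_set mH)).

Let preimageM (Y : Om -> R) (B : set R) : measurable_fun setT Y -> measurable B ->
  measurable (Y @^-1` B).
Proof. by move=> mY mB; rewrite -[X in measurable X]setTI; exact: mY. Qed.

Let S w : R := \sum_b x w b.

Let x_le_S w b : x w b <= S w.
Proof. by rewrite /S (bigD1 b)//= lerDl sumr_ge0. Qed.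

Let mS : measurable_fun setT S.
Proof. exact: measurable_sum. Qed.

(** For coordinates at most [M], [s1] lies above the indicator of [H <= t + del] and [s2] below that
    of [H < t - del], while their means overshoot and undershoot the distribution function at [t] by
    at most [eps]. The margin [del] will absorb the distance between the Bayes factor and [H]. *)
Lemma limit_law_of_variables : exists W : probability R R, (forall c, W [set c] != 1%E) /\
  forall t, W [set t] = 0%E -> forall eps, 0 < eps ->
  exists M0 del, [/\ 0 <= M0, 0 < del & forall M, M0 <= M -> exists s1 s2,
  [/\ forall y, (forall b, 0 <= y b) -> 0 <= peval s1 (usub y) /\ peval s2 (usub y) <= 1,
      forall y, (forall b, 0 <= y b <= M) ->
        (\prod_(b | Pb b) Psi a (q b) (y b) <= t + del -> 1 <= peval s1 (usub y)) /\
        (t - del <= \prod_(b | Pb b) Psi a (q b) (y b) -> peval s2 (usub y) <= 0),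
      pval s1 <= fine (W `]-oo, t]) + eps & fine (W `]-oo, t]) - eps <= pval s2]].
Proof.
exists W0; split; first exact: Hc.
move=> t Wt eps eps0.
have {}Wt : P (H @^-1` [set t]) = 0%E by exact: Wt.
have -> : W0 `]-oo, t] = P (H @^-1` `]-oo, t]) by [].
pose e := eps / 4; have e0 : 0 < e by rewrite divr_gt0.
(* Events to be made small: [H] just above [t], [H] equal to [t] or just below, and a large
   coordinate. The second decreases to [H = t], a null event by the choice of [t]. *)
pose F1 n := H @^-1` `]t, t + 2 / n.+1%:R].
pose F2 n := H @^-1` `]t - 2 / n.+1%:R, t].
pose F3 n := S @^-1` `]n%:R, +oo[.
have mF1 n : measurable (F1 n) by apply: preimageM.
have mF2 n : measurable (F2 n) by apply: preimageM.
have mF3 n : measurable (F3 n) by apply: preimageM.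
have dF1 : nonincreasing_seq F1.
  move=> m n mn; apply/subsetPset => w; rewrite /F1 /= !in_itv /= => /andP[-> /=].
  by move/le_trans; apply; rewrite lerD2l harmonic_le.
have dF2 : nonincreasing_seq F2.
  move=> m n mn; apply/subsetPset => w; rewrite /F2 /= !in_itv /= => /andP[h1 ->].
  by rewrite andbT (le_lt_trans _ h1)// lerD2l lerN2 harmonic_le.
have dF3 : nonincreasing_seq F3.
  move=> m n mn; apply/subsetPset => w; rewrite /F3 /= !in_itv /= !andbT.
  by apply: le_lt_trans; rewrite ler_nat.
have [n1 n1P] : exists n, (P (F1 n) <= e%:E)%E.
  apply: small_tail => //; rewrite -[RHS](measure0 P); congr (P _).
  rewrite -subset0 => w Fw; have := Fw 0%N I; rewrite /F1 /= in_itv /= => /andP[Ht _].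
  have [n nH] := harmonic_small (half_gt0 Ht).
  have := Fw n I; rewrite /F1 /= in_itv /= => /andP[_]; move: nH Ht.
  by move: (2 / _) => r r1 r2 r3; lra.
have [n2 n2P] : exists n, (P (F2 n) <= e%:E)%E.
  apply: small_tail => //; apply/eqP; rewrite eq_le measure_ge0 andbT -Wt.
  apply: le_measure; rewrite ?inE; [exact: bigcapT_measurable|exact: preimageM|].
  move=> w Fw; rewrite /= ; apply/eqP; rewrite eq_le.
  have := Fw 0%N I; rewrite /F2 /= in_itv /= => /andP[_ ->] /=.
  rewrite leNgt; apply/negP => Ht.
  have [n nH] := harmonic_small (half_gt0 Ht).
  have := Fw n I; rewrite /F2 /= in_itv /= => /andP[+ _]; move: nH Ht.
  by move: (2 / _) => r r1 r2 r3; lra.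
have [n3 n3P] : exists n, (P (F3 n) <= e%:E)%E.
  apply: small_tail => //; rewrite -[RHS](measure0 P); congr (P _); rewrite -subset0 => w Fw.
  have := Fw (Num.bound (S w)) I; rewrite /F3 /= in_itv /= andbT ltNge => /negP; apply.
  by rewrite ltW//; apply: archi_boundP; apply: sumr_ge0.
pose N := (n1 + n2)%N; pose del : R := N.+1%:R^-1.
have del0 : 0 < del by rewrite invr_gt0 ltr0n.
exists n3%:R, del; split => // M nM.
have M0 : 0 <= M by exact: le_trans nM.
(* The ramps descend from [t + del] to [t + 2 del] for [s1] and from [t - 2 del] to [t - del] for
   [s2]. *)
have [s1 s1P] := polynomial_upper (t + del) M0 del0 e0.
have [s2 s2P] := polynomial_lower (t - 2 * del) M0 del0 e0.
exists s1, s2; split.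
- move=> y y0; have uc := usub_cube Pb y0; split.
    by have /andP[+ _] := s1P _ uc; apply: le_trans; case/andP: (ramp_bounds (t + del) del
      (\prod_(b | Pb b) clampPsi a (q b) M (usub y b))).
  have /andP[_ +] := s2P _ uc; move/le_trans; apply.
  by case/andP: (ramp_bounds (t - 2 * del) del
      (\prod_(b | Pb b) clampPsi a (q b) M (usub y b))).
- move=> y yM; have y0 b : 0 <= y b by case/andP: (yM b).
  have uc := usub_cube Pb y0.
  have HE : \prod_(b | Pb b) clampPsi a (q b) M (usub y b) =
      \prod_(b | Pb b) Psi a (q b) (y b).
    rewrite clampE//; apply: eq_bigr => b _; congr Psi; apply/min_idPl.
    by case/andP: (yM b).
  split => Hy.
    by have /andP[+ _] := s1P _ uc; rewrite /= HE ramp_eq1.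
  have /andP[_] := s2P _ uc; rewrite /= HE ramp_eq0//.
  by apply: le_trans Hy; rewrite sub_double.
- pose A := H @^-1` `]-oo, t] `|` (F1 N `|` F3 n3).
  have mHt : measurable (H @^-1` `]-oo, t]) by exact: preimageM.
  have mA : measurable A by do 2 apply: measurableU => //.
  have : pval s1 <= fine (P A) + 2 * e.
    apply: (pvalP _ _ mA).1 => w; have uc := usub_cube Pb (x0 w).
    have /andP[_ +] := s1P _ uc; move/le_trans; apply; rewrite lerD2r indicE.
    have [_|] := boolP (w \in A); first by case/andP: (ramp_bounds (t + del) del
      (\prod_(b | Pb b) clampPsi a (q b) M (usub (x w) b))).
    rewrite notin_setE => wA; rewrite ramp_eq0// clampE//.
    have Sn : S w <= n3%:R.
      rewrite leNgt; apply/negP => nS; apply: wA; right; right.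
      by rewrite /F3 /= in_itv /= andbT.
    have -> : \prod_(b | Pb b) Psi a (q b) (Num.min (x w b) M) = H w.
      apply: eq_bigr => b _; congr Psi; apply/min_idPl.
      by rewrite (le_trans (x_le_S w b))// (le_trans Sn).
    rewrite leNgt; apply/negP => Ht; apply: wA.
    have [Ht'|Ht'] := leP (H w) t; first by left; rewrite /= in_itv.
    right; left; rewrite /F1 /= in_itv /= Ht' /=.
    by move: (ltW Ht); rewrite -addrA /del double_del.
  move/le_trans; apply.
  have : (P A <= P (H @^-1` `]-oo, t]) + (e%:E + e%:E))%E.
    apply: (le_trans (measureU2 _ _ _)) => //; first exact: measurableU.
    rewrite leeD2l//; apply: (le_trans (measureU2 _ _ _)) => //.
    apply: leeD => //; apply: le_trans n1P; apply: le_measure; rewrite ?inE//.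
    by apply/subsetPset/dF1; rewrite leq_addr.
  rewrite -(fineK (fin_num_measure P _ mHt)) -(fineK (fin_num_measure P _ mA)).
  rewrite -!EFinD lee_fin /=; move: (fine _) (fine _) => A1 A2.
  by rewrite /e; lra.
- pose A := H @^-1` `]-oo, t - 2 * del].
  have mHt : measurable (H @^-1` `]-oo, t]) by exact: preimageM.
  have mA : measurable A by exact: preimageM.
  have : fine (P A) - 2 * e <= pval s2.
    apply: (pvalP _ _ mA).2 => w; have uc := usub_cube Pb (x0 w).
    have /andP[+ _] := s2P _ uc; apply: le_trans; rewrite lerD2r indicE.
    have [wA|_] := boolP (w \in A); last by case/andP: (ramp_bounds (t - 2 * del) del
      (\prod_(b | Pb b) clampPsi a (q b) M (usub (x w) b))).
    rewrite ramp_eq1// clampE//; move: wA; rewrite inE /A /= in_itv /=.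
    apply: le_trans; apply: ler_prod => b _.
    by rewrite Psi_ge0//= Psi_le// ?le_min ?x0// ge_min lexx.
  apply: le_trans.
  have : (P (H @^-1` `]-oo, t]) <= P A + e%:E)%E.
    apply: (@le_trans _ _ (P (A `|` F2 N))).
      apply: le_measure; rewrite ?inE//; first exact: measurableU.
      move=> w; rewrite /= in_itv /= => Ht.
      have [Ht'|Ht'] := leP (H w) (t - 2 * del); first by left; rewrite /A /= in_itv.
      by right; rewrite /F2 /= in_itv /= Ht Ht'.
    apply: (le_trans (measureU2 _ _ _)) => //; rewrite leeD2l//.
    apply: le_trans n2P; apply: le_measure; rewrite ?inE//.
    by apply/subsetPset/dF2; rewrite leq_addl.
  rewrite -(fineK (fin_num_measure P _ mHt)) -(fineK (fin_num_measure P _ mA)).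
  rewrite -!EFinD lee_fin /=; move: (fine _) (fine _) => A1 A2.
  by rewrite /e; lra.
Qed.

End limit_law_approximation.

(** One standard normal copy per predictor carries all the coordinates. The sample size does not
    occur, so a single [W] serves every [n]. *)
Lemma limit_law (R : realType) (a : R) (p k : nat) (blk : 'I_p -> 'I_k)
  (G : {set 'I_p}) (Pb : pred 'I_k) j0 : 2 < a -> a <= 4 -> j0 \in G -> Pb (blk j0) ->
  exists W : probability R R, (forall c, W [set c] != 1%E) /\
  forall t, W [set t] = 0%E -> forall eps, 0 < eps ->
  exists M0 del, [/\ 0 <= M0, 0 < del & forall M, M0 <= M -> exists s1 s2,
  [/\ forall y, (forall b, 0 <= y b) -> 0 <= peval s1 (usub Pb y) /\ peval s2 (usub Pb y) <= 1,
      forall y, (forall b, 0 <= y b <= M) ->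
        (\prod_(b | Pb b) Psi a (blocksize blk G b) (y b) <= t + del ->
          1 <= peval s1 (usub Pb y)) /\
        (t - del <= \prod_(b | Pb b) Psi a (blocksize blk G b) (y b) ->
          peval s2 (usub Pb y) <= 0),
      pval blk G Pb s1 <= fine (W `]-oo, t]) + eps &
      fine (W `]-oo, t]) - eps <= pval blk G Pb s2]].
Proof.
move=> a2 a4 jG Pj.
have [d [Om [P [Z [mZ PZ]]]]] := independent_copies (@normal_prob R 0 1) p.
have [x [x0 mx mH Hc pvalP]] :=
  @limit_variables_of_copies R a p k blk G Pb a2 a4 d Om P Z mZ PZ j0 jG Pj.
exact: (limit_law_of_variables a2 x0 mx mH Hc pvalP).
Qed.

(** * Probability of bad noise *)

Section noise_bound.
Variables (R : realType) (tau : R).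
Hypothesis tau0 : 0 < tau.

(** The mean of the test constructed in [bad_noise_test]. *)
Definition badval (n p : nat) (d M : R) : R :=
  expR (n%:R / 2 * (ln (1 + d / tau) - d / tau)) +
  expR (n%:R / 2 * (ln (1 - d / tau) + d / tau)) +
  expR (- (M / (4 * tau))) * (2^-1 `^ (- 1 / 2) + (2^-1 ^+ p) `^ (- 1 / 2)).

Let expRN_small (kap eps : R) : 0 < kap -> 0 < eps ->
  exists z0, 0 < z0 /\ forall z, z0 <= z -> expR (- (kap * z)) <= eps.
Proof.
move=> k0 e0; exists (kap^-1 * eps^-1); split; first by rewrite mulr_gt0 ?invr_gt0.
move=> z zz; rewrite expRN -[leRHS]invrK lef_pV2 ?posrE ?expR_gt0 ?invr_gt0//.
rewrite (le_trans _ (expR_ge1Dx _))// -[leLHS]add0r lerD// mulrC -ler_pdivrMr//.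
by rewrite mulrC.
Qed.

Let ln_lt_id (x : R) : -1 < x -> x != 0 -> ln (1 + x) < x.
Proof.
move=> x1 x0; have x10 : 0 < 1 + x by rewrite -ltrBlDl sub0r.
rewrite -[ltRHS]expRK ltr_ln ?posrE ?expR_gt0//; exact: expR_gt1Dx.
Qed.

Let expRN_nat_small (u eps : R) : u < 0 -> 0 < eps ->
  exists N : nat, forall n, (N <= n)%N -> expR (n%:R / 2 * u) <= eps.
Proof.
move=> u0 e0; have k0 : 0 < - u / 2 by rewrite divr_gt0// oppr_gt0.
have [z0 [z00 zP]] := expRN_small k0 e0.
exists (Num.bound z0) => n nz.
have -> : n%:R / 2 * u = - ((- u / 2) * n%:R) by ring.
by apply: zP; rewrite (le_trans (ltW (archi_boundP (ltW z00))))// ler_nat.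
Qed.

(** The order of the quantifiers matters: [M] is fixed by [eps] alone, then [d], whose size depends
    on [M] in the comparison of Bayes factors, and [n] comes last. The two spherical terms decay
    since [ln (1 + x) < x] for nonzero [x]. *)
Lemma badval_small p eps : 0 < eps -> exists2 M0, 0 < M0 & forall M, M0 <= M ->
  forall d, 0 < d < tau -> exists N : nat, forall n, (N <= n)%N -> badval n p d M <= eps.
Proof.
move=> e0; pose K : R := 2^-1 `^ (- 1 / 2) + (2^-1 ^+ p) `^ (- 1 / 2).
have K0 : 0 < K by rewrite addr_gt0// powR_gt0// ?exprn_gt0// invr_gt0.
have k0 : 0 < (4 * tau)^-1 by rewrite invr_gt0 mulr_gt0.
have e3 : 0 < eps / 3 by rewrite divr_gt0.
have [z0 [z00 zP]] := expRN_small k0 (divr_gt0 e3 K0).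
exists z0 => // M zM d /andP[d0 dt].
have x0 : 0 < d / tau by rewrite divr_gt0.
have x1 : d / tau < 1 by rewrite ltr_pdivrMr// mul1r.
have u1 : ln (1 + d / tau) - d / tau < 0.
  by rewrite subr_lt0 ln_lt_id ?gt_eqF// (lt_trans _ x0)// ltrN10.
have u2 : ln (1 - d / tau) + d / tau < 0.
  by rewrite -ltrBrDr sub0r ln_lt_id ?oppr_eq0 ?gt_eqF// ltrN2.
have [N1 N1P] := expRN_nat_small u1 e3.
have [N2 N2P] := expRN_nat_small u2 e3.
exists (maxn N1 N2) => n; rewrite geq_max => /andP[/N1P A /N2P B].
have : expR (- (M / (4 * tau))) * K <= eps / 3.
  by rewrite -ler_pdivlMr// mulrC; exact: zP.
rewrite /badval -/K; move: A B; move: (expR _) (expR _) (expR _ * K) => A B C; lra.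
Qed.

End noise_bound.

(** * From polynomials in the noise coordinates to bounds for [gprob] *)

Section model_comparison.
Variables (R : realType) (a : R) (n p k : nat) (blk : 'I_p -> 'I_k) (X : 'M[R]_(n, p)).
Variables (al : R) (beta : 'cV[R]_p) (tau : R) (G : {set 'I_p}) (Pb : pred 'I_k).
Local Notation P := (blockproj blk X).
Local Notation delta := (fun b c : 'I_k => (c == b)%:R : R).
Local Notation one := (const_mx 1 : 'cV[R]_n).
Local Notation full := [set: 'I_p]%SET.
Local Notation T := [set j | beta j 0 != 0]%SET.
Local Notation mean := (al *: one + X *m beta).
Hypotheses (a2 : 2 < a) (n0 : (0 < n)%N).
Hypothesis cX : forall j : 'I_p, \sum_i X i j = 0.
Hypothesis oX : forall j l : 'I_p, blk j != blk l -> \sum_i X i j * X i l = 0.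
Hypothesis uF : gram X full \in unitmx.
Hypothesis tau0 : 0 < tau.

Let uG H : gram X H \in unitmx.
Proof. by apply: (gram_unit_sub _ uF); apply/fintype.subsetP => j _; rewrite inE. Qed.

Lemma margc_gt0 : 0 < margc R n.
Proof.
have pi2 : 0 < 2 * pi :> R by rewrite mulr_gt0// pi_gt0.
by rewrite /margc !mulr_gt0 ?powR_gt0 ?ltr0n.
Qed.

Lemma BF_integral_ratio H y : BF blk a X G H y =
  integral_ratio (modelker a n (ctot y) (fun b => blocksize blk H b) (Qblk blk X H y))
    (modelker a n (ctot y) (fun b => blocksize blk G b) (Qblk blk X G y)) (margc R n).
Proof. by rewrite /BF !margE. Qed.

Definition noise_coord e b : R := dot e (P G (delta b) *m e) / (2 * tau).

Lemma noise_coord_ge0 e b : 0 <= noise_coord e b.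
Proof.
rewrite divr_ge0 ?mulr_ge0 ?(ltW tau0)//.
by apply: blockproj_dot_ge0 => //; exact: delta_idem.
Qed.

Let exponent (m : 'I_k -> nat) b : R := if Pb b then (m b)%:R else 0.

Let exponent_ge0 m b : 0 <= exponent m b.
Proof. by rewrite /exponent; case: ifP. Qed.

(** A monomial in the [exp(- x_b)] with [b] in [Pb] is the Gaussian kernel whose matrix is the
    [blockproj] of its exponents. *)
Definition noise_test (s : seq (R * ('I_k -> nat))) :=
  [seq (i.1, P G (exponent i.2)) | i <- s].

Lemma tev_noise_test s e : tev tau (noise_test s) e = peval s (usub Pb (noise_coord e)).
Proof.
rewrite /tev big_map /peval; apply: eq_bigr => i _ /=; congr (_ * _).
rewrite dot_blockproj_sum mulr_suml -sumrN expR_sum; apply: eq_bigr => b _.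
rewrite /usub /exponent /noise_coord; case: ifP => _; last by rewrite !mul0r oppr0 expR0 expr1n.
by rewrite -expRM_natl mulrN mulrA.
Qed.

Lemma tval_noise_test s : tval (noise_test s) = pval blk G Pb s.
Proof.
rewrite /tval big_map /pval; apply: eq_bigr => i _ /=; congr (_ * _ `^ _).
rewrite det_1_blockproj// [RHS]big_mkcond; apply: eq_bigr => b _.
by rewrite /exponent; case: ifP => // _; rewrite addr0 expr1n.
Qed.

Lemma twf_noise_test s : twf (noise_test s).
Proof.
move=> i /mapP[j _ ->] /=.
by apply: (pd_1_blockproj oX (uG G) (r := 0)) => // b; rewrite oppr0.
Qed.

Lemma twf_cat s1 s2 : twf s1 -> twf s2 -> twf (s1 ++ s2 : seq (R * 'M[R]_n)).
Proof. by move=> w1 w2 i; rewrite mem_cat => /orP[/w1|/w2]. Qed.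

(** On good noise the polynomial dominates the indicator of [E], on bad noise the test of
    [bad_noise_test] does; both are nonnegative everywhere, so their sum dominates throughout. *)
Lemma gprob_upper (E : 'cV[R]_n -> bool) d M s : 0 < d < tau ->
  (forall y, (forall b, 0 <= y b) -> 0 <= peval s (usub Pb y)) ->
  (forall e, good_noise blk X tau d M e -> E (mean + e) ->
    1 <= peval s (usub Pb (noise_coord e))) ->
  gprob mean tau E <= pval blk G Pb s + badval tau n p d M.
Proof.
move=> /andP[d0 dt] s0 sE.
have [t [wt t0 t1 tv]] := bad_noise_test n0 oX tau0 uF M d0 dt.
rewrite -tval_noise_test /badval -tv.
have -> : tval (noise_test s) + tval t = tval (noise_test s ++ t) by rewrite /tval big_cat.
apply: gprob_le_tval => //; first by apply: twf_cat => //; exact: twf_noise_test.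
move=> y; have -> : tev tau (noise_test s ++ t) (y - mean) =
   tev tau (noise_test s) (y - mean) + tev tau t (y - mean) by rewrite /tev big_cat.
rewrite tev_noise_test.
have s0' := s0 _ (noise_coord_ge0 (y - mean)).
case: ifP => Ey; last by rewrite addr_ge0.
have [gy|/t1 by1] := boolP (good_noise blk X tau d M (y - mean)); last by rewrite ler_wpDl.
by rewrite ler_wpDr// sE//; move: Ey; rewrite addrC subrK.
Qed.

Lemma gprob_lower (E : 'cV[R]_n -> bool) d M s : 0 < d < tau ->
  (forall y, (forall b, 0 <= y b) -> peval s (usub Pb y) <= 1) ->
  (forall e, good_noise blk X tau d M e -> ~~ E (mean + e) ->
    peval s (usub Pb (noise_coord e)) <= 0) ->
  pval blk G Pb s - badval tau n p d M <= gprob mean tau E.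
Proof.
move=> /andP[d0 dt] s0 sE.
have [t [wt t0 t1 tv]] := bad_noise_test n0 oX tau0 uF M d0 dt.
pose t' := [seq (- i.1, i.2) | i <- t].
have t'v : tval t' = - tval t.
  by rewrite /tval /t' big_map -sumrN; apply: eq_bigr => i _ /=; exact: mulNr.
have t'e e : tev tau t' e = - tev tau t e.
  by rewrite /tev /t' big_map -sumrN; apply: eq_bigr => i _ /=; exact: mulNr.
rewrite -tval_noise_test /badval -tv -t'v.
have -> : tval (noise_test s) + tval t' = tval (noise_test s ++ t') by rewrite /tval big_cat.
apply: gprob_ge_tval => //.
  apply: twf_cat; first exact: twf_noise_test.
  by move=> i /mapP[j jt ->]; exact: (wt j jt).
move=> y; have -> : tev tau (noise_test s ++ t') (y - mean) =
   tev tau (noise_test s) (y - mean) + tev tau t' (y - mean) by rewrite /tev big_cat.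
rewrite tev_noise_test t'e lerBlDr.
have s0' := s0 _ (noise_coord_ge0 (y - mean)).
case: ifP => Ey; first by rewrite ler_wpDr.
rewrite add0r; have [gy|/t1 by1] := boolP (good_noise blk X tau d M (y - mean)).
  by apply: le_trans (t0 _); apply: sE => //; rewrite addrC subrK Ey.
exact: le_trans by1.
Qed.

(** The projections of the noise are below [n d] in total, so the sums of squares of the true model
    meet the hypotheses of the Bayes factor comparisons with [2 d] in place of [d]. *)
Lemma good_noise_true d M C e : good_noise blk X tau d M e ->
  2 * M <= n%:R * d -> 2 * M <= n%:R ->
  (forall b, dot (masked blk X beta (delta b)) (masked blk X beta (delta b)) <= C * n%:R) ->
  (forall b, 0 <= Qblk blk X T (mean + e) b <= (2 * C + 1) * n%:R) /\
  n%:R * (tau - 2 * d) <= ctot (mean + e) - \sum_b Qblk blk X T (mean + e) b <=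
    n%:R * (tau + 2 * d).
Proof.
move=> /and3P[ge g1 gX] Md Mn bC; split.
  move=> b; have [_ Qu] := Qblk_true_bounds al beta cX oX uF b e.
  rewrite Qblk_ge0//= (le_trans Qu)//; move: (bC b) gX; set u := dot _ _; set v := Rspan _ _ _.
  by clearbody u v; move=> *; lra.
have /andP[] := rss_true_bounds al beta n0 cX oX uF e.
move: (ctot _ - _) => S; move: ge g1 gX Md; rewrite ler_norml.
set u := dot _ _; set v := Rspan _ _ _; set w := Rmean e.
clearbody u v w; rewrite !mulrBr !mulrDr mulrCA.
move: (n%:R * tau) (n%:R * d) => A B /andP[e1 e2] *; apply/andP; split; lra.
Qed.

End model_comparison.

(** * Limits as the sample size grows *)

Section asymptotics.
Variables (R : realType) (p k : nat) (blk : 'I_p -> 'I_k).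
Variables (X : forall n : nat, 'M[R]_(n, p)) (D : 'M[R]_p) (a alphaT sigma2 : R).
Variable betaT : 'cV[R]_p.
Hypothesis cX : forall n (j : 'I_p), \sum_(i < n) X n i j = 0.
Hypothesis oX : forall n (j l : 'I_p), blk j != blk l -> \sum_(i < n) X n i j * X n i l = 0.
Hypothesis XD : forall i j : 'I_p,
  (fun n : nat => ((X n)^T *m X n) i j / n%:R) @ \oo --> D i j.
Hypothesis Dpos : forall x : 'cV[R]_p, x != 0 -> 0 < (x^T *m D *m x) 0 0.
Hypotheses (a2 : 2 < a) (a4 : a <= 4) (tau0 : 0 < sigma2).
Local Notation T := [set j | betaT j 0 != 0]%SET.
Local Notation delta := (fun b c : 'I_k => (c == b)%:R : R).
Local Notation full := [set: 'I_p]%SET.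
Local Notation signal n b := (masked blk (X n) betaT (delta b)).
Local Notation mean n := (alphaT *: const_mx 1 + X n *m betaT).

Let cvg_sumr (I : Type) (r : seq I) (Q : pred I) (f : I -> nat -> R) (l : I -> R) :
  (forall i, f i @ \oo --> l i) ->
  (fun n => \sum_(i <- r | Q i) f i n) @ \oo --> \sum_(i <- r | Q i) l i.
Proof.
move=> fl; elim: r => [|i r IH].
  rewrite big_nil; under eq_fun do rewrite big_nil; exact: cvg_cst.
rewrite big_cons; under eq_fun do rewrite big_cons.
by case: ifP => // _; apply: cvgD.
Qed.

Let cvg_prodr (I : Type) (r : seq I) (Q : pred I) (f : I -> nat -> R) (l : I -> R) :
  (forall i, f i @ \oo --> l i) ->
  (fun n => \prod_(i <- r | Q i) f i n) @ \oo --> \prod_(i <- r | Q i) l i.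
Proof.
move=> fl; elim: r => [|i r IH].
  rewrite big_nil; under eq_fun do rewrite big_nil; exact: cvg_cst.
rewrite big_cons; under eq_fun do rewrite big_cons.
by case: ifP => // _; apply: cvgM.
Qed.

Let eventually_ge (u : nat -> R) (l c : R) : u @ \oo --> l -> c < l ->
  exists N : nat, forall n, (N <= n)%N -> c <= u n.
Proof.
move=> ul cl; have lc : 0 < l - c by rewrite subr_gt0.
have /cvgrPdist_le /(_ (l - c) lc) [N _ NP] := ul.
by exists N => n /NP /=; rewrite ler_norml => /andP[_]; rewrite lerD2l lerN2.
Qed.

Let eventually_le (u : nat -> R) (l c : R) : u @ \oo --> l -> l < c ->
  exists N : nat, forall n, (N <= n)%N -> u n <= c.
Proof.
move=> ul lc; have cl : 0 < c - l by rewrite subr_gt0.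
have /cvgrPdist_le /(_ (c - l) cl) [N _ NP] := ul.
by exists N => n /NP /=; rewrite distrC ler_norml => /andP[_]; rewrite lerD2r.
Qed.

Let eventually_large (x y : R) : 0 < y -> exists N : nat, forall n, (N <= n)%N -> x <= n%:R * y.
Proof.
move=> y0; exists (Num.bound (x / y)) => n nN; rewrite -ler_pdivrMr//.
rewrite (le_trans (ler_norm _))//.
have := archi_boundP (normr_ge0 (x / y)) => /ltW; move/le_trans; apply.
by rewrite ler_nat (leq_trans _ nN)// /Num.bound normr_id.
Qed.

Lemma quadratic_form_cvg (v : 'cV[R]_p) :
  (fun n : nat => dot (X n *m v) (X n *m v) / n%:R) @ \oo --> (v^T *m D *m v) 0 0.
Proof.
have -> : (v^T *m D *m v) 0 0 = \sum_j (\sum_i v i 0 * D i j) * v j 0.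
  rewrite mxE; apply: eq_bigr => j _; rewrite mxE; congr (_ * _).
  by apply: eq_bigr => i _; rewrite mxE.
have -> : (fun n : nat => dot (X n *m v) (X n *m v) / n%:R) =
    (fun n => \sum_j (\sum_i v i 0 * (((X n)^T *m X n) i j / n%:R)) * v j 0).
  apply/funext => n.
  have -> : dot (X n *m v) (X n *m v) = (v^T *m ((X n)^T *m X n) *m v) 0 0.
    by rewrite /dot trmx_mul !mulmxA.
  rewrite mxE mulr_suml; apply: eq_bigr => j _.
  have -> : (v^T *m ((X n)^T *m X n)) 0 j = \sum_i v i 0 * ((X n)^T *m X n) i j.
    by rewrite mxE; apply: eq_bigr => i _; rewrite [v^T _ _]mxE.
  rewrite mulrAC [in LHS]mulr_suml; congr (_ * _).
  by apply: eq_bigr => i _; rewrite mulrA.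
by apply: cvg_sumr => j; apply: cvgMl; apply: cvg_sumr => i; apply: cvgMr.
Qed.

Let det_D : \det D != 0.
Proof.
rewrite -unitfE -[_ \in _]/(D \in unitmx) -row_free_unit -kermx_eq0.
apply/rowV0P => v /sub_kermxP vD; apply/eqP; apply: contraT => v0.
have := Dpos (x := v^T); rewrite trmxK vD mul0mx mxE ltxx => H; apply: H.
by apply: contra v0 => /eqP vT; rewrite -[v]trmxK vT trmx0.
Qed.

(** The determinant of [X^T X / n] converges to that of [D], which is not zero. *)
Lemma gram_full_eventually :
  exists N : nat, forall n, (N <= n)%N -> (0 < n)%N /\ gram (X n) full \in unitmx.
Proof.
pose A n : 'M[R]_p := n%:R^-1 *: ((X n)^T *m X n).
have Acvg : (fun n => \det (A n)) @ \oo --> \det D.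
  rewrite /determinant; apply: cvg_sumr => s; apply: cvgMr; apply: cvg_prodr => i.
  under eq_fun do rewrite mxE mulrC.
  exact: XD.
have D0 : 0 < `|\det D| by rewrite normr_gt0 det_D.
have /cvgrPdist_lt /(_ _ D0) [N _ NP] := Acvg.
exists N.+1 => n nN; have n0 : (0 < n)%N by exact: leq_ltn_trans nN.
split=> //; have /NP /= dA : (N <= n)%N by exact: ltnW.
have detA : \det (A n) != 0.
  by apply: contraL dA => /eqP ->; rewrite subr0 ltxx.
have inj (x : 'cV[R]_p) : X n *m x = 0 -> x = 0.
  move=> Xx; have uA : A n \in unitmx by rewrite unitmxE unitfE.
  rewrite -[LHS]mul1mx -(mulVmx uA) -mulmxA /A -scalemxAl -mulmxA Xx.
  by rewrite !mulmx0 scaler0 mulmx0.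
apply: gram_unitP => x; pose E := \matrix_(l < p, j < #|full|) (l == enum_val j)%:R : 'M[R]_(p, #|full|).
have -> : Xsub (X n) full = X n *m E.
  apply/matrixP => i j; rewrite !mxE (bigD1 (enum_val j))//= !mxE eqxx mulr1.
  by rewrite big1 ?addr0// => l /negPf lj; rewrite mxE lj mulr0.
rewrite -mulmxA => /inj /colP Ex; apply/colP => j.
have := Ex (enum_val j); rewrite !mxE (bigD1 j)//= !mxE eqxx mul1r.
rewrite big1 ?addr0// => l lj; rewrite mxE (inj_eq enum_val_inj) eq_sym.
by rewrite (negPf lj) mul0r.
Qed.

Lemma signal_bounded : exists2 C, 0 < C & exists N : nat, forall n, (N <= n)%N ->
  forall b, dot (signal n b) (signal n b) <= C * n%:R.
Proof.
pose v b : 'cV[R]_p := \col_j (delta b (blk j) * betaT j 0).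
pose L b := `|((v b)^T *m D *m v b) 0 0|.
have C0 : 0 < \sum_b L b + 1 by rewrite ltr_wpDl// sumr_ge0// => b _; exact: normr_ge0.
exists (\sum_b L b + 1) => //.
have /fin_all_exists[N NP] : forall b, exists N : nat, forall n, (N <= n)%N ->
    dot (X n *m v b) (X n *m v b) / n%:R <= \sum_b L b + 1.
  move=> b; have lt_c : ((v b)^T *m D *m v b) 0 0 < \sum_b L b + 1.
    rewrite (le_lt_trans (ler_norm _))// [ltRHS](_ : _ = L b + (\sum_(c | c != b) L c + 1)).
      by rewrite ltrDl ltr_wpDl// sumr_ge0// => c _; exact: normr_ge0.
    by rewrite (bigD1 b)//= addrA.
  have [N NP] := eventually_le (@quadratic_form_cvg (v b)) lt_c.
  exists N => n nN.
  exact: (NP n nN).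
exists (\max_b N b).+1 => n nN b; have n0 : (0 < n)%N by exact: leq_ltn_trans nN.
rewrite -ler_pdivrMr ?ltr0n//; apply: NP.
by apply: leq_trans (ltnW nN); exact: leq_bigmax.
Qed.

(** The block contains a nonzero coefficient, so the limiting quadratic form is positive at its part
    of [betaT]; half of the limit is a safe rate. *)
Lemma signal_unbounded b : b \in blk @: T -> exists2 c, 0 < c & exists N : nat,
  forall n, (N <= n)%N -> c * n%:R <= dot (signal n b) (signal n b).
Proof.
move=> /imsetP[j]; rewrite inE => bj jb.
pose v : 'cV[R]_p := \col_j (delta b (blk j) * betaT j 0).
have v0 : v != 0.
  by apply: contra bj => /eqP/colP/(_ j); rewrite !mxE -jb eqxx mul1r => ->.
have L0 := Dpos v0; exists ((v^T *m D *m v) 0 0 / 2); first by rewrite divr_gt0.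
have [|N NP] := @eventually_ge _ _ ((v^T *m D *m v) 0 0 / 2) (@quadratic_form_cvg v).
  by rewrite ltr_pdivrMr// mulr_natr mulr2n ltrDl.
exists N.+1 => n nN; have n0 : (0 < n)%N by exact: leq_ltn_trans nN.
by rewrite -ler_pdivlMr ?ltr0n//; apply: NP; exact: ltnW.
Qed.

Lemma resid_dotE n G : gram (X n) full \in unitmx ->
  (betaT^T *m (X n)^T *m (1%:M - projmx (Xsub (X n) G)) *m (X n) *m betaT) 0 0 =
  dot (resid blk (X n) betaT G) (resid blk (X n) betaT G).
Proof.
move=> uF; have uG : gram (X n) G \in unitmx.
  by apply: (gram_unit_sub _ uF); apply/fintype.subsetP => j _; rewrite inE.
rewrite (projmxE blk); set P := blockproj _ _ _ _.
have sP : P^T = P by rewrite /P (blockproj_tr (@oX n)).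
have iP : P *m P = P.
  by rewrite /P (blockproj_idem (@oX n))//; apply/funext => b /=; rewrite mulr1.
have -> : resid blk (X n) betaT G = (1%:M - P) *m (X n *m betaT).
  by rewrite mulmxBl mul1mx.
rewrite -idem_dot; first by rewrite /dot trmx_mul !mulmxA.
- by rewrite linearB /= trmx1 sP.
- by rewrite mulmxBl mul1mx mulmxBr mulmx1 iP subrr subr0.
Qed.

Let blocksize_le G b : (blocksize blk G b <= p)%N.
Proof. by rewrite -[leqRHS]card_ord max_card. Qed.

Let min_half_lt (d tau x : R) : 0 < d -> d <= tau / 2 -> 0 < tau -> 0 < x ->
  [/\ 0 < Num.min (d / 2) x, Num.min (d / 2) x < tau, 2 * Num.min (d / 2) x <= d &
      Num.min (d / 2) x <= x].
Proof.
move=> d0 dt t0 x0; have h : Num.min (d / 2) x <= d / 2 by rewrite ge_min lexx.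
have h' : Num.min (d / 2) x <= x by rewrite ge_min lexx orbT.
by split => //; [rewrite lt_min x0 divr_gt0| |]; lra.
Qed.

Let widen_interval (n : nat) (tau d d1 S : R) : 2 * d1 <= d ->
  n%:R * (tau - 2 * d1) <= S <= n%:R * (tau + 2 * d1) ->
  n%:R * (tau - d) <= S <= n%:R * (tau + d).
Proof.
move=> dd /andP[S1 S2]; apply/andP; split.
  by apply: le_trans S1; rewrite ler_wpM2l// lerD2l lerN2.
by apply: (le_trans S2); rewrite ler_wpM2l// lerD2l.
Qed.

Let missing_arith (nn tau l d1 M E W Rm Rs S : R) : 0 <= nn -> 0 <= M ->
  d1 <= l / 16 -> 4 * M <= nn * d1 -> Rm <= M -> Rs <= M ->
  `|E - nn * tau| <= nn * d1 -> l / 2 * nn <= W ->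
  2^-1 * W + E - Rm - 3 * Rs <= S -> nn * (tau + l / 8) <= S.
Proof.
move=> n0 M0 dl Mn Rm0 Rs0; rewrite ler_norml => /andP[E1 _] lW; apply: le_trans.
have : nn * d1 <= nn * (l / 16) by rewrite ler_wpM2l.
rewrite mulrDr; move: Mn E1 lW.
have -> : l / 2 * nn = 8 * (nn * (l / 16)) by field.
have -> : nn * (l / 8) = 2 * (nn * (l / 16)) by field.
move: (nn * d1) (nn * tau) (nn * (l / 16)) => A B C *; lra.
Qed.

Let unit_gram n G : gram (X n) full \in unitmx -> gram (X n) G \in unitmx.
Proof. by move=> uF; apply: (gram_unit_sub _ uF); apply/fintype.subsetP => j _; rewrite inE. Qed.

Let blocksize_sub (G : {set 'I_p}) b : T \subset G -> (blocksize blk T b <= blocksize blk G b)%N.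
Proof.
move=> TG; apply: subset_leq_card; apply/fintype.subsetP => i.
by rewrite !inE => /andP[iT ->]; rewrite andbT (fintype.subsetP TG) ?inE.
Qed.

Let extra_arith (nn c M W Rs Q : R) : Rs <= M -> M <= nn * (c / 4) -> c * nn <= W ->
  2^-1 * W - Rs <= Q -> c / 4 * nn <= Q.
Proof.
move=> ? + + ?; have -> : c * nn = 4 * (nn * (c / 4)) by field.
have -> : c / 4 * nn = nn * (c / 4) by ring.
by move: (nn * _) => A *; lra.
Qed.

(** Eventually the residual signal exceeds [l n / 2]. Half of it survives the cross term and the
    noise takes at most [l n / 8], so the residual sum of squares is at least [n (sigma2 + l / 8)]
    on good noise. *)
Lemma BF_missing_cvg0 (G : {set 'I_p}) (l eps eta : R) : ~~ (T \subset G) -> 0 < l ->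
  (fun n : nat => ((betaT^T *m (X n)^T *m (1%:M - projmx (Xsub (X n) G))
     *m (X n) *m betaT) 0 0) / n%:R) @ \oo --> l ->
  0 < eps -> 0 < eta -> exists N : nat, forall n, (N <= n)%N ->
  gprob (mean n) sigma2 (fun y => eps < `|BF blk a (X n) G T y|) <= eta.
Proof.
move=> TG l0 cvgl eps0 eta0.
have [C C0 [N1 N1P]] := signal_bounded; have [N2 N2P] := gram_full_eventually.
have l80 : 0 < l / 8 by rewrite divr_gt0.
have l160 : 0 < l / 16 by rewrite divr_gt0.
have C00 : 0 < 2 * C + 1 by rewrite addr_gt0// mulr_gt0.
have [d /andP[d0 dt] [N3 N3P]] := bayes_factor_missing k a2 a4 p tau0 l80 C00 eps0.
have [d10 d1t d1d d1l] := min_half_lt d0 dt tau0 l160.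
set d1 := Num.min _ _ in d10 d1t d1d d1l.
have [M M0 /(_ M (lexx M) d1)] := badval_small tau0 p eta0.
rewrite d10 d1t => /(_ isT) [N4 N4P].
have [N5 N5P] := eventually_large (4 * M) d10.
have [N6 N6P] := eventually_large (2 * M) ltr01.
have [|N7 N7P] := @eventually_ge _ _ (l / 2) cvgl.
  by rewrite ltr_pdivrMr// mulr_natr mulr2n ltrDl.
exists (\max_(i <- [:: N1; N2; N3; N4; N5; N6; N7]) i) => n.
rewrite !big_cons big_nil !geq_max => /and5P[n1 n2 n3 n4 /and4P[n5 n6 n7 _]].
have [n0 uF] := N2P n n2.
have := N7P n n7; rewrite resid_dotE// ler_pdivlMr ?ltr0n// => W.
have M4 := N5P n n5; have := N6P n n6; rewrite mulr1 => M2.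
have M2d : 2 * M <= n%:R * d1 by apply: le_trans M4; rewrite ler_wpM2r ?(ltW M0)// ler_nat.
(* The empty polynomial is the constant 0: on good noise the event is impossible, and only bad noise
   counts. *)
apply: (@le_trans _ _ (pval blk G pred0 [::] + badval sigma2 n p d1 M)); last first.
  by rewrite /pval big_nil add0r N4P.
apply: (gprob_upper n0 (@oX n) uF tau0); first by rewrite d10.
- by move=> y _; rewrite /peval big_nil.
move=> e ge; have [Q0 S0] := good_noise_true alphaT n0 (@cX n) (@oX n) uF ge M2d M2 (N1P n n1).
have /and3P[gd gm gs] := ge.
rewrite (BF_integral_ratio _ a2 n0 (@cX n) (@oX n) uF) ltNge => /negP[].
have WS := missing_arith (ler0n R n) (ltW M0) d1l M4 gm gs gd W
  (rss_missing_lb alphaT betaT n0 (@cX n) (@oX n) uF G e).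
have QG0 b : 0 <= Qblk blk (X n) G (mean n + e) b.
  exact: (Qblk_ge0 _ (@oX n) (unit_gram G uF) b).
have /andP[BF0 BFe] := N3P n n3 _ _ _ (fun b => blocksize blk G b) _ _ (margc_gt0 R n0)
  (blocksize_le T) Q0 QG0 (widen_interval d1d S0) WS.
by rewrite ger0_norm.
Qed.

(** The extra predictor shares its block with a nonzero coefficient, so on good noise the regression
    sum of squares of that block is at least [c n / 4]. *)
Lemma BF_extra_cvg0 (G : {set 'I_p}) (j : 'I_p) (eps eta : R) : T \subset G ->
  j \in G :\: T -> blk j \in blk @: T -> 0 < eps -> 0 < eta ->
  exists N : nat, forall n, (N <= n)%N ->
  gprob (mean n) sigma2 (fun y => eps < `|BF blk a (X n) G T y|) <= eta.
Proof.
move=> TG jGT jT eps0 eta0.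
have [C C0 [N1 N1P]] := signal_bounded; have [N2 N2P] := gram_full_eventually.
have [c c0 [N7 N7P]] := signal_unbounded jT.
have c40 : 0 < c / 4 by rewrite divr_gt0.
have C00 : 0 < 2 * C + 1 by rewrite addr_gt0// mulr_gt0.
have [M M0 MP] := badval_small tau0 p eta0.
have [d /andP[d0 dt] [N3 N3P]] :=
  bayes_factor_extra k a2 a4 p tau0 C00 c40 (ltW M0) eps0.
have [d10 d1t d1d _] := min_half_lt d0 dt tau0 ltr01.
set d1 := Num.min _ _ in d10 d1t d1d.
have d1b : 0 < d1 < sigma2 by rewrite d10 d1t.
have [N4 N4P] := MP M (lexx M) d1 d1b.
have [N5 N5P] := eventually_large (2 * M) d10.
have [N6 N6P] := eventually_large (2 * M) ltr01.
have [N8 N8P] := eventually_large M c40.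
exists (\max_(i <- [:: N1; N2; N3; N4; N5; N6; N7; N8]) i) => n.
rewrite !big_cons big_nil !geq_max => /and5P[n1 n2 n3 n4 /and5P[n5 n6 n7 n8 _]].
have [n0 uF] := N2P n n2.
have M2d := N5P n n5; have := N6P n n6; rewrite mulr1 => M2.
apply: (@le_trans _ _ (pval blk G pred0 [::] + badval sigma2 n p d1 M)); last first.
  by rewrite /pval big_nil add0r N4P.
apply: (gprob_upper n0 (@oX n) uF tau0) => //.
  by move=> y _; rewrite /peval big_nil.
move=> e ge; have [Q0 S0] := good_noise_true alphaT n0 (@cX n) (@oX n) uF ge M2d M2 (N1P n n1).
have /and3P[gd gm gs] := ge.
rewrite (BF_integral_ratio _ a2 n0 (@cX n) (@oX n) uF) ltNge => /negP[].
have QTG b : Qblk blk (X n) T (mean n + e) b <= Qblk blk (X n) G (mean n + e) b <=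
    Qblk blk (X n) T (mean n + e) b + M.
  have /andP[q1 q2] := Qblk_nested alphaT (@cX n) (@oX n) uF b e TG.
  by rewrite q1 (le_trans q2)// lerD2l.
have QTl : exists2 b, (blocksize blk T b < blocksize blk G b)%N &
    c / 4 * n%:R <= Qblk blk (X n) T (mean n + e) b.
  exists (blk j).
    apply: proper_card; apply/properP; split.
      apply/fintype.subsetP => i; rewrite !inE => /andP[iT ->]; rewrite andbT.
      by rewrite (fintype.subsetP TG) ?inE.
    have /andP[jG jnT] : (j \in G) && (j \notin T) by move: jGT; rewrite finset.in_setD andbC.
    exists j; rewrite finset.in_set; first by rewrite jG eqxx.
    by rewrite (negPf jnT).
  have [q1 _] := Qblk_true_bounds alphaT betaT (@cX n) (@oX n) uF (blk j) e.
  exact: extra_arith gs (N8P n n8) (N7P n n7) q1.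
have /andP[BF0 BFe] := N3P n n3 _ _ _ (fun b => blocksize blk G b) _ _ (margc_gt0 R n0)
  (blocksize_le T) (blocksize_le G) Q0 (widen_interval d1d S0)
  (fun b => blocksize_sub b TG) QTG QTl.
by rewrite ger0_norm.
Qed.

Let dist_arith (w g v1 v2 b eta : R) : v1 <= w + eta / 2 -> w - eta / 2 <= v2 ->
  b <= eta / 2 -> g <= v1 + b -> v2 - b <= g -> `|w - g| <= eta.
Proof. by move=> *; rewrite ler_norml; apply/andP; split; lra. Qed.

Let upper_arith (B H e t : R) : - e <= B - H -> B <= t -> H <= t + e.
Proof. by move=> *; lra. Qed.

Let lower_arith (B H e t : R) : B - H <= e -> t < B -> t - e <= H.
Proof. by move=> *; lra. Qed.

(** On good noise the Bayes factor is within [del] of the product of the [Psi] at the noise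
    coordinates, so the event that it is at most [t] is squeezed between the events tested by [s2]
    and [s1]. *)
Lemma BF_limit_law (G : {set 'I_p}) : T \proper G ->
  (forall j, j \in G :\: T -> blk j \notin blk @: T) ->
  exists W : probability R R, (forall c : R, W [set c] != 1%E) /\
  forall t : R, W [set t] = 0%E -> forall eta : R, 0 < eta ->
  exists N : nat, forall n, (N <= n)%N ->
  `|fine (W `]-oo, t]) - gprob (mean n) sigma2 (fun y => BF blk a (X n) G T y <= t)| <= eta.
Proof.
move=> /properP[TG [j0 j0G j0T]] GT.
pose Pb := [pred b | b \notin blk @: T].
have Pj0 : Pb (blk j0) by apply: GT; rewrite inE j0T j0G.
have [W [Wc WP]] := @limit_law R a p k blk G Pb j0 a2 a4 j0G Pj0.
exists W; split => // t Wt eta eta0; have eta2 : 0 < eta / 2 by rewrite divr_gt0.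
have [M0 [del [M00 del0 sP]]] := WP t Wt _ eta2.
have [M1 M10 MP] := badval_small tau0 p eta2.
have t2 : 0 < 2 * sigma2 by rewrite mulr_gt0.
(* [M] serves two ends: [M1 <= M] controls the bad noise, and [M0 <= M / (2 sigma2)] makes the test
   polynomials valid for all noise coordinates that occur. *)
pose M := M1 + 2 * sigma2 * M0.
have M1M : M1 <= M by rewrite lerDl mulr_ge0// ltW.
have Mge0 : 0 <= M by exact: le_trans (ltW M10) M1M.
have M0M : M0 <= M / (2 * sigma2) by rewrite ler_pdivlMr// mulrC lerDr ltW.
have [s1 [s2 [s01 sB v1 v2]]] := sP _ M0M.
have [C C0 [N1 N1P]] := signal_bounded; have [N2 N2P] := gram_full_eventually.
have C00 : 0 < 2 * C + 1 by rewrite addr_gt0// mulr_gt0.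
have [d /andP[d0 dt] [N3 N3P]] := bayes_factor_limit k a2 a4 p tau0 C00 Mge0 del0.
have [d10 d1t d1d _] := min_half_lt d0 dt tau0 ltr01.
set d1 := Num.min _ _ in d10 d1t d1d.
have d1b : 0 < d1 < sigma2 by rewrite d10 d1t.
have [N4 N4P] := MP M M1M d1 d1b.
have [N5 N5P] := eventually_large (2 * M) d10.
have [N6 N6P] := eventually_large (2 * M) ltr01.
exists (\max_(i <- [:: N1; N2; N3; N4; N5; N6]) i) => n.
rewrite !big_cons big_nil !geq_max => /and5P[n1 n2 n3 n4 /and3P[n5 n6 _]].
have [n0 uF] := N2P n n2.
have M2d := N5P n n5; have := N6P n n6; rewrite mulr1 => M2.
pose xc e b := noise_coord blk (X n) sigma2 G e b.
have key e : good_noise blk (X n) sigma2 d1 M e ->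
    (forall b, 0 <= xc e b <= M / (2 * sigma2)) /\
    `|BF blk a (X n) G T (mean n + e) -
      \prod_(b | Pb b) Psi a (blocksize blk G b) (xc e b)| <= del.
  move=> ge; have /and3P[gd gm gs] := ge.
  have QM b : 0 <= dot e (blockproj blk (X n) G (delta b) *m e) <= M.
    rewrite (blockproj_dot_ge0 (@oX n) uF G e (delta_idem R b))/=.
    exact: le_trans (blockproj_le_Rspan (@oX n) uF G e (delta_idem R b)) gs.
  split=> [b|].
    have /andP[q1 q2] := QM b.
    by rewrite /xc /noise_coord ler_pM2r ?invr_gt0// q2 andbT divr_ge0// ltW.
  have [Q0 S0] := good_noise_true alphaT n0 (@cX n) (@oX n) uF ge M2d M2 (N1P n n1).
  rewrite (BF_integral_ratio _ a2 n0 (@cX n) (@oX n) uF).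
  have E1 b : ~~ Pb b -> blocksize blk T b = blocksize blk G b /\
      Qblk blk (X n) T (mean n + e) b = Qblk blk (X n) G (mean n + e) b.
    rewrite /Pb /= negbK => bT.
    have [|q1 q2] := Qblk_same alphaT (@oX n) uF (b := b) e TG; last by rewrite q1 q2.
    by move=> j /GT; apply: contraNneq => ->.
  have E2 b : Pb b -> [/\ blocksize blk T b = 0%N, Qblk blk (X n) T (mean n + e) b = 0 &
      0 <= Qblk blk (X n) G (mean n + e) b <= M].
    rewrite /Pb /= => bT; have [q1 q2] := Qblk_outside alphaT (@cX n) (@oX n) uF e TG bT.
    by rewrite q2; split => //; exact: blocksize_outside.
  have <- : \prod_(b | Pb b) Psi a (blocksize blk G b)
      (Qblk blk (X n) G (mean n + e) b / (2 * sigma2)) =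
      \prod_(b | Pb b) Psi a (blocksize blk G b) (xc e b).
    apply: eq_bigr => b; rewrite /Pb /= => bT.
    by have [_ ->] := Qblk_outside alphaT (@cX n) (@oX n) uF e TG bT.
  exact: (N3P n n3 Pb _ _ _ (fun b => blocksize blk G b) _ _ (margc_gt0 R n0)
    (blocksize_le T) Q0 (widen_interval d1d S0) E1 E2).
apply: (dist_arith v1 v2 (N4P n n4)).
  apply: (gprob_upper n0 (@oX n) uF tau0) => //; first by move=> y /s01[].
  move=> e /key[xM]; rewrite ler_norml => /andP[h1 h2] BFt.
  exact: (sB _ xM).1 (upper_arith h1 BFt).
apply: (gprob_lower n0 (@oX n) uF tau0) => //; first by move=> y /s01[].
move=> e /key[xM]; rewrite ler_norml => /andP[h1 h2]; rewrite -ltNge => BFt.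
exact: (sB _ xM).2 (lower_arith h2 BFt).
Qed.

End asymptotics.

Unset Implicit Arguments. Set Strict Implicit. Set Printing Implicit Defensive.

Theorem theorem5p2 (R : realType) (p k : nat) (blk : 'I_p -> 'I_k)
  (X : forall n : nat, 'M[R]_(n, p)) (D : 'M[R]_p) (a : R)
  (alphaT sigma2 : R) (betaT : 'cV[R]_p) :
  (* the k blocks partition the predictors *)
  (forall b : 'I_k, exists j, blk j = b) ->
  (* centered columns *)
  (forall n (j : 'I_p), \sum_(i < n) X n i j = 0) ->
  (* block orthogonality *)
  (forall n (j l : 'I_p), blk j != blk l -> \sum_(i < n) X n i j * X n i l = 0) ->
  (* (1/n) X^T X -> D, D positive definite *)
  (forall i j : 'I_p,
     (fun n : nat => ((X n)^T *m X n) i j / n%:R) @ \oo --> D i j) ->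
  (forall x : 'cV[R]_p, x != 0 -> 0 < (x^T *m D *m x) 0 0) ->
  2 < a -> a <= 4 ->
  0 < sigma2 ->
  let T := finset (fun j : 'I_p => betaT j 0 != 0) in
  let BT := blk @: T in
  (* identifiability of the true model *)
  (forall G : {set 'I_p}, ~~ (T \subset G) ->
     exists l : R, 0 < l /\
       (fun n : nat => ((betaT^T *m (X n)^T *m (1%:M - projmx (Xsub (X n) G))
                         *m (X n) *m betaT) 0 0) / n%:R) @ \oo --> l) ->
  let mu n := alphaT *: const_mx 1 + X n *m betaT in
  (* (i) *)
  (forall G : {set 'I_p}, T \proper G ->
     (forall j, j \in G :\: T -> blk j \notin BT) ->
     exists W : probability R R,
       (forall c : R, W [set c]%classic != 1%E) /\
       (forall t : R, W [set t]%classic = 0%E ->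
          (fun n : nat => gprob (mu n) sigma2
               (fun y => BF blk a (X n) G T y <= t))
            @ \oo --> fine (W `]-oo, t]%classic)))
  /\
  (* (ii) *)
  (forall G : {set 'I_p}, G != T ->
     ~ (T \proper G /\ (forall j, j \in G :\: T -> blk j \notin BT)) ->
     forall eps : R, 0 < eps ->
       (fun n : nat => gprob (mu n) sigma2
            (fun y => eps < `|BF blk a (X n) G T y|)) @ \oo --> 0).
Proof.
move=> _ cX oX XD Dpos a2 a4 s0 T BT ident mu; split.
  move=> G TG GT.
  have [W [Wc WP]] := BF_limit_law alphaT cX oX XD Dpos a2 a4 s0 TG GT.
  exists W; split => // t Wt; apply/cvgrPdist_le => e e0.
  by have [N NP] := WP t Wt e e0; exists N => // n /=; exact: NP.
move=> G GT nG eps eps0; apply/cvgrPdist_le => e e0.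
have [N NP] : exists N : nat, forall n, (N <= n)%N ->
    gprob (mu n) sigma2 (fun y => eps < `|BF blk a (X n) G T y|) <= e.
  have [TG|TG] := boolP (T \subset G); last first.
    have [l [l0 cl]] := ident G TG.
    exact: (BF_missing_cvg0 alphaT cX oX XD Dpos a2 a4 s0 TG l0 cl eps0 e0).
  (* Here [G] strictly contains [T], so failure of the condition in (i) yields an added predictor in
     a true block. *)
  have TpG : T \proper G by rewrite finset.properEneq eq_sym GT TG.
  have [/existsP[j /andP[jGT jB]]|/existsPn H] :=
      boolP [exists j, (j \in finset.setD G T) && (blk j \in BT)].
    exact: (BF_extra_cvg0 alphaT cX oX XD Dpos a2 a4 s0 TG jGT jB eps0 e0).
  by exfalso; apply: nG; split=> // j jGT; have := H j; rewrite jGT.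
exists N => // n /= nN; rewrite sub0r normrN ger0_norm; first exact: NP.
exact: gprob_ge0.
Qed.
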